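(* For every $d\in\mathbb{N}$ (with $d\ge 1$) there exists a constant $C_d<\infty$, depending only on $d$, such that the following holds. For all real numbers $a_1,\dots,a_d$ and all positive integers $\alpha_1,\dots,\alpha_d$, let $Q(t)=a_1t^{\alpha_1}+\dots+a_dt^{\alpha_d}$. Then the operator $$H_Qf(x)=\mathrm{p.v.}\int_{\mathbb{R}} f(x-t)\,e^{iQ(t)}\,\frac{dt}{t},$$ initially defined for Schwartz functions $f:\mathbb{R}\to\mathbb{C}$, extends to a bounded operator on $L^2(\mathbb{R})$ and satisfies $$\|H_Qf\|_{L^2(\mathbb{R})}\le C_d\,\|f\|_{L^2(\mathbb{R})}\quad\text{for all } f\in L^2(\mathbb{R}).$$ In particular $C_d$ does not depend on any of the $a_i$ or $\alpha_i$.
   Context: For a Schwartz function $f$ on $\mathbb{R}$, the principal value integral means $\mathrm{p.v.}\int_{\mathbb{R}} f(x-t)e^{iQ(t)}\frac{dt}{t}=\lim_{\varepsilon\to0^+}\int_{|t|>\varepsilon} f(x-t)e^{iQ(t)}\frac{dt}{t}$. The integral over $|t|>\varepsilon$ converges absolutely by the decay of $f$. *)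

(* Defs.v *)
From HB Require Import structures.
From mathcomp Require Import all_boot all_order all_algebra.
From mathcomp Require Import all_classical all_reals all_analysis.
From mathcomp Require Import complex.

Set Implicit Arguments.
Unset Strict Implicit.
Unset Printing Implicit Defensive.

Import Order.TTheory GRing.Theory Num.Theory.
Import numFieldNormedType.Exports.

Local Open Scope classical_set_scope.
Local Open Scope ring_scope.
Local Open Scope complex_scope.

(* The libraries provide neither a topology nor an integration theory on R[i]
   over R, so derivatives, integrals and limits of complex-valued functions
   are taken on the real and imaginary parts. *)

Section ComplexFunctions.
Context {R : realType}.
Implicit Types (f k : R -> R[i]) (Q : R -> R).

Local Notation mu := (@lebesgue_measure R).

Definition cmod (z : R[i]) : R := ComplexField.Normc.normc z.

Definition expi (y : R) : R[i] := cos y +i* sin y.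

Definition cderiven (n : nat) f : R -> R[i] :=
  fun x => derive1n n (fun y => complex.Re (f y)) x +i*
           derive1n n (fun y => complex.Im (f y)) x.

Definition csmooth f : Prop :=
  forall (n : nat) (x : R),
    derivable (derive1n n (fun y => complex.Re (f y))) x 1 /\
    derivable (derive1n n (fun y => complex.Im (f y))) x 1.

Definition schwartz f : Prop :=
  csmooth f /\
  forall m n : nat, exists B : R,
    forall x : R, `|x| ^+ m * cmod (cderiven n f x) <= B.

Definition cintegrable (D : set R) k : Prop :=
  mu.-integrable D (fun t => (complex.Re (k t))%:E) /\
  mu.-integrable D (fun t => (complex.Im (k t))%:E).

Definition cintegral (D : set R) k : R[i] :=
  (\int[mu]_(t in D) complex.Re (k t)) +i* (\int[mu]_(t in D) complex.Im (k t)).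

Definition truncated_integral k (eps : R) : R[i] :=
  cintegral [set t | eps < `|t|] k.

Definition pv_converges k : Prop :=
  [/\ forall eps : R, 0 < eps -> cintegrable [set t | eps < `|t|] k,
      cvg (complex.Re (truncated_integral k eps) @[eps --> 0^'+]) &
      cvg (complex.Im (truncated_integral k eps) @[eps --> 0^'+])].

(* Meaningful only when [pv_converges k], since [lim] is total. *)
Definition pv_integral k : R[i] :=
  lim (complex.Re (truncated_integral k eps) @[eps --> 0^'+]) +i*
  lim (complex.Im (truncated_integral k eps) @[eps --> 0^'+]).

Definition hilbert_integrand Q f (x : R) : R -> R[i] :=
  fun t => f (x - t) * expi (Q t) / t%:C.

Definition hilbert_transform Q f : R -> R[i] :=
  fun x => pv_integral (hilbert_integrand Q f x).

Definition cmeasurable f : Prop :=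
  measurable_fun [set: R] (fun x => complex.Re (f x)) /\
  measurable_fun [set: R] (fun x => complex.Im (f x)).

Definition L2norm f : \bar R := Lnorm mu 2%:E (fun x => (cmod (f x))%:E).

Definition in_L2 f : Prop := cmeasurable f /\ (L2norm f < +oo)%E.

(* A linear map from L^2(R; C) to itself, given on representatives: the second
   clause says that it descends to classes modulo equality a.e. *)
Definition L2_linear_operator (T : (R -> R[i]) -> (R -> R[i])) : Prop :=
  [/\ forall f, in_L2 f -> in_L2 (T f),
      forall f g, in_L2 f -> in_L2 g -> f = g %[ae mu] -> T f = T g %[ae mu] &
      forall (c : R[i]) f g, in_L2 f -> in_L2 g ->
        T (fun x => c * f x + g x) = (fun x => c * T f x + T g x) %[ae mu]].

End ComplexFunctions.

Definition fewnomial {R : realType} (d : nat) (a : 'I_d -> R)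
    (alpha : 'I_d -> nat) (t : R) : R :=
  \sum_(i < d) a i * t ^+ alpha i.

(* Main.v *)
(* It suffices to bound, for the real kernels cos(th + Q(t)) / t truncated to
   eps <= |t| <= N, the Fourier transform independently of eps, N and of the
   coefficients and exponents. A frequency adds one linear monomial to Q, so one
   must bound the integral of (cos P(t) - cos P(-t)) / t over [a, b] in terms of
   the number of monomials of P only. Let F_k(t) = k |c_k| t^k. In logarithmic
   scale these are exponentials whose rates differ by at least 1, so outside
   boundedly many intervals of bounded logarithmic length one F_k dominates all
   others by a large factor. On a remaining interval either all F_k are at most 1,
   and |P(t) - P(-t)| / t has a bounded integral, or the dominating F_k is at
   least 1, and an integration by parts against t P'(t), which is comparable
   with F_k, gives a bound.

   The passage from the multiplier to L2 avoids Plancherel's theorem: for Lipschitz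
   f with compact support, integrating |f^|^2 against exp(-de xi) over xi >= 0
   produces the quadratic form of f with Poisson kernel de / (de^2 + u^2), which
   is comparable with the L2 norm of f as de tends to 0. Fatou's lemma removes the
   truncations, and the operator extends by density of the Lipschitz functions
   of quadratic decay and completeness of L2. Constants are not tracked sharply, so
   that (a + b)^2 <= 2 a^2 + 2 b^2 can replace Minkowski's inequality. *)

Require Import Defs.
From HB Require Import structures.
From mathcomp Require Import all_boot all_order all_algebra.
From mathcomp Require Import all_classical all_reals all_analysis.
From mathcomp Require Import measurable_realfun complex ring lra.

Set Implicit Arguments.
Unset Strict Implicit.
Unset Printing Implicit Defensive.

Import Order.TTheory GRing.Theory Num.Theory.
Import numFieldNormedType.Exports.

Local Open Scope classical_set_scope.
Local Open Scope ring_scope.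

(** Uniformity comes from counting. There is at most one bad interval per pair of exponents, of
    logarithmic length at most [ln (la ^+ 2)] with [la] depending only on the number of monomials,
    so the coefficients merely move these intervals. Constants that do depend on the coefficients,
    such as the Lipschitz constant of the odd part of the kernel, serve convergence and
    measurability only and never reach the final estimate. Where all [F_k] are small, [t] and [- t]
    must be kept together, since only the cancellation between [P(t)] and [P(-t)] tames [1 / t].
    Where some [F_k] dominates, the two phases are treated separately with the same [F_k], because
    reflection changes only signs of coefficients. The free angle [th] serves to split [exp (i Q)]
    into [cos Q] and [cos (pi / 2 + Q)], and again to absorb the sine transform. The final constant
    is the square root of [64 C^2]: a factor 2 from [C^2 + C^2] for the multiplier, 2 from the ratio
    of the masses [pi] and [pi / 2] of the Poisson kernel, 4 from the extension by density, and 4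
    from recombining real and imaginary parts. *)

Section Derivatives.
Context {R : realType}.
Implicit Types (f g F G X h : R -> R) (x a b : R).

Lemma is_derive_val_eq f x d d' : is_derive x 1 f d -> d = d' -> is_derive x 1 f d'.
Proof. by move=> ? <-. Qed.

(* The library states these rules with the pointwise operations on functions;
   the forms below unify with explicit formulas. *)
Lemma is_derive_fcst (k : R) x : is_derive x 1 (fun=> k) (0 : R).
Proof. exact: is_derive_cst. Qed.

Lemma is_derive_fid x : is_derive x 1 (fun t => t) (1 : R).
Proof. exact: is_derive_id. Qed.

Lemma is_derive_fD f g x df dg : is_derive x 1 f df -> is_derive x 1 g dg ->
  is_derive x 1 (fun t => f t + g t) (df + dg).
Proof. by move=> ? ?; exact: is_deriveD. Qed.

Lemma is_derive_fB f g x df dg : is_derive x 1 f df -> is_derive x 1 g dg ->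
  is_derive x 1 (fun t => f t - g t) (df - dg).
Proof. by move=> ? ?; exact: is_deriveB. Qed.

Lemma is_derive_fN f x df : is_derive x 1 f df -> is_derive x 1 (fun t => - f t) (- df).
Proof. by move=> ?; exact: is_deriveN. Qed.

Lemma is_derive_fM f g x df dg : is_derive x 1 f df -> is_derive x 1 g dg ->
  is_derive x 1 (fun t => f t * g t) (f x * dg + g x * df).
Proof. by move=> ? ?; exact: is_deriveM. Qed.

Lemma is_derive_fZ k f x df : is_derive x 1 f df ->
  is_derive x 1 (fun t => k * f t) (k * df).
Proof. by move=> ?; exact: is_deriveZ. Qed.

Lemma is_derive_fX n x : is_derive x 1 (fun t => t ^+ n) (n%:R * x ^+ n.-1).
Proof.
have -> : (fun t : R => t ^+ n) = id ^+ n by apply/funext => t; rewrite exprfctE.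
apply: (is_derive_val_eq (is_deriveX n (is_derive_id x 1))).
by rewrite /GRing.scale /= mulr1 mulr_natl.
Qed.

Lemma is_derive_fV f x df : f x != 0 -> is_derive x 1 f df ->
  is_derive x 1 (fun t => (f t)^-1) (- df / f x ^+ 2).
Proof.
move=> f0 fd; apply: (is_derive_val_eq (is_deriveV f0 fd)).
by rewrite /GRing.scale /= mulNr mulNr mulrC.
Qed.

Lemma is_derive_fcomp f g x df dg : is_derive (g x) 1 f df -> is_derive x 1 g dg ->
  is_derive x 1 (fun t => f (g t)) (df * dg).
Proof. by move=> fd gd; exact: is_derive1_comp fd gd. Qed.

Lemma is_derive_fsum (I : Type) (s : seq I) (f df : I -> R -> R) x :
  (forall i, is_derive x 1 (f i) (df i x)) ->
  is_derive x 1 (fun t => \sum_(i <- s) f i t) (\sum_(i <- s) df i x).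
Proof.
move=> fdf; elim: s => [|i s IH].
  by under eq_fun do rewrite big_nil; rewrite big_nil; exact: is_derive_fcst.
by under eq_fun do rewrite big_cons; rewrite big_cons; exact: is_derive_fD.
Qed.

Lemma derive_within_continuous F a b :
  (forall t, a <= t <= b -> exists l : R, is_derive t 1 F l) ->
  {within `[a, b], continuous F}.
Proof.
move=> dF; apply: derivable_within_continuous => t; rewrite in_itv /= => tab.
by have [l dl] := dF t tab; apply: (@ex_derive _ _ _ _ _ _ l).
Qed.

Lemma mvt_le F f a b (M : R) : a <= b ->
  (forall t, a <= t <= b -> is_derive t 1 F (f t)) ->
  (forall t, a <= t <= b -> f t <= M) -> F b - F a <= M * (b - a).
Proof.
move=> ab dF fM; have [||c] := @MVT_segment _ F f a b ab.
- by move=> t; rewrite in_itv /= => /andP[ta tb]; apply: dF; rewrite !ltW.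
- by apply: derive_within_continuous => t tab; exists (f t); exact: dF.
- by rewrite in_itv /= => cab ->; rewrite ler_wpM2r ?subr_ge0// fM.
Qed.

(** The mean value inequality is applied to [X - F - G] and [F - X - G]. This estimates an
    antiderivative [X] without integrating: [F] carries an explicit main part and [G] majorizes the
    error. *)
Lemma derive_comparison X h F f G g a b : a <= b ->
  (forall t, a <= t <= b -> is_derive t 1 X (h t)) ->
  (forall t, a <= t <= b -> is_derive t 1 F (f t)) ->
  (forall t, a <= t <= b -> is_derive t 1 G (g t)) ->
  (forall t, a <= t <= b -> `|h t - f t| <= g t) ->
  `|X b - X a - (F b - F a)| <= G b - G a.
Proof.
move=> ab dX0 dF dG hfg.
have H1 := @mvt_le (fun t => X t - F t - G t) (fun t => h t - f t - g t) a b 0 ab.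
have H2 := @mvt_le (fun t => F t - X t - G t) (fun t => f t - h t - g t) a b 0 ab.
have {}H1 : (X b - F b - G b) - (X a - F a - G a) <= 0 * (b - a).
  apply: H1 => t tab; first by apply: is_derive_fB (is_derive_fB _ _) _; auto.
  by rewrite subr_le0 (le_trans (ler_norm _)) ?hfg.
have {}H2 : (F b - X b - G b) - (F a - X a - G a) <= 0 * (b - a).
  apply: H2 => t tab; first by apply: is_derive_fB (is_derive_fB _ _) _; auto.
  by rewrite subr_le0 (le_trans (ler_norm _)) // distrC hfg.
by rewrite ler_norml; apply/andP; split; lra.
Qed.

Lemma cos_lipschitz x y : `|cos x - cos y| <= `|x - y|.
Proof.
wlog xy : x y / y <= x => [H|].
  by case: (leP y x) => [/H//|/ltW /H]; rewrite distrC (distrC y).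
rewrite (ger0_norm (x := x - y)) ?subr_ge0//.
have -> : cos x - cos y = cos x - cos y - ((fun=> 0) x - (fun=> 0) y : R).
  by rewrite subrr subr0.
apply: (@derive_comparison cos (fun t => - sin t) _ (fun=> 0) id (fun=> 1)) => //.
by move=> t _; rewrite subr0 normrN ler_norml sin_geN1 sin_le1.
Qed.

End Derivatives.

(** * Oscillatory integrals with sparse phases *)

Section OscillatoryBound.
Context {R : realType}.
Implicit Types (S : seq nat) (c : nat -> R) (a b t th : R).

Definition phase th c S t : R := th + \sum_(k <- S) c k * t ^+ k.

(** [t] times the derivative of [phase]; the Euler form preserves the powers of [t], so that its
    terms can be compared one by one. *)
Definition phase_euler c S t : R := \sum_(k <- S) k%:R * c k * t ^+ k.
Local Notation psi := phase_euler.

(* Euler derivative [t d/dt] of the absolute value of the k-th monomial *)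
Definition term_euler c k t : R := k%:R * `|c k| * t ^+ k.
Local Notation F := term_euler.

Lemma derive_psum c S t :
  is_derive t 1 (fun t => \sum_(k <- S) c k * t ^+ k)
    (\sum_(k <- S) c k * (k%:R * t ^+ k.-1)).
Proof.
apply: (@is_derive_fsum R _ S (fun k t => c k * t ^+ k)
  (fun k t => c k * (k%:R * t ^+ k.-1))) => k.
by apply: is_derive_fZ; exact: is_derive_fX.
Qed.

Lemma natX_pred k t : t != 0 -> k%:R * t ^+ k.-1 = k%:R * t ^+ k / t.
Proof.
by case: k => [|k] t0; rewrite ?mul0r//= exprSr mulrA mulfK.
Qed.

Lemma derive_phase th c S t : t != 0 ->
  is_derive t 1 (phase th c S) (psi c S t / t).
Proof.
move=> t0; apply: (is_derive_val_eq (is_derive_fD (is_derive_fcst th t) (derive_psum c S t))); rewrite add0r /phase_euler mulr_suml.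
by apply: eq_bigr => k _; rewrite natX_pred// -!mulrA; ring.
Qed.

Lemma derive_psi c S t : t != 0 ->
  is_derive t 1 (psi c S) (\sum_(k <- S) k%:R * (k%:R * c k * t ^+ k) / t).
Proof.
move=> t0; apply: (is_derive_val_eq (derive_psum (fun k => k%:R * c k) S t)).
by apply: eq_bigr => k _; rewrite natX_pred//; ring.
Qed.

Lemma term_euler_ge0 c k t : 0 <= t -> 0 <= F c k t.
Proof. by move=> t0; rewrite !mulr_ge0// exprn_ge0. Qed.

Lemma term_euler_le c k a b : 0 <= a -> a <= b -> F c k a <= F c k b.
Proof.
by move=> a0 ab; rewrite ler_wpM2l ?mulr_ge0// lerXn2r ?nnegrE// (le_trans a0).
Qed.

Lemma derive_term_euler c k t : t != 0 -> is_derive t 1 (F c k) (k%:R * F c k t / t).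
Proof.
move=> t0; apply: (is_derive_val_eq (is_derive_fZ (k%:R * `|c k|) (is_derive_fX k t))).
by rewrite natX_pred// /term_euler; ring.
Qed.

Lemma normr_term c k t : 0 <= t -> `|k%:R * c k * t ^+ k| = F c k t.
Proof. by move=> t0; rewrite !normrM normrX normr_nat (ger0_norm t0). Qed.

(** The remaining [size S - 1] terms are each at most [F c k0 t / (2 * size S)], so together they
    cancel at most half of the dominating one. *)
Lemma psi_lower c S k0 t : 0 < t -> uniq S -> k0 \in S ->
  (forall j, j \in S -> j != k0 -> 2 * (size S)%:R * F c j t <= F c k0 t) ->
  F c k0 t / 2 <= `|psi c S t|.
Proof.
move=> t0 uS k0S dom; rewrite /phase_euler (big_rem k0)//=.
set s := (X in _ + X).
have F0 := term_euler_ge0 c k0 (ltW t0).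
have ss : `|s| <= F c k0 t / 2.
  have n0 : 0 < (size S)%:R :> R by rewrite ltr0n; case: (S) k0S.
  apply: (@le_trans _ _ (\sum_(j <- rem k0 S) (2 * (size S)%:R)^-1 * F c k0 t)).
    apply: le_trans (ler_norm_sum _ _ _) _; rewrite big_seq [leRHS]big_seq.
    apply: ler_sum => j; rewrite mem_rem_uniq// inE => /andP[jk jS].
    rewrite normr_term ?(ltW t0)// mulrC ler_pdivlMr ?mulr_gt0//.
    by rewrite mulrC dom.
  rewrite big_const_seq count_predT iter_addr_0 size_rem// -[leLHS]mulr_natl.
  pose m : R := (size S).-1%:R; rewrite -/m.
  have -> : m * ((2 * (size S)%:R)^-1 * F c k0 t) = m / (size S)%:R * (F c k0 t / 2).
    by field; rewrite gt_eqF.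
  rewrite ler_piMl ?divr_ge0// ler_pdivrMr// mul1r ler_nat.
  exact: leq_pred.
have := ler_normD (k0%:R * c k0 * t ^+ k0 + s) (- s).
rewrite addrK normrN normr_term ?(ltW t0)//; lra.
Qed.

(* With psi = t * phase', the choice P = sin phase / psi gives
   cos phase / t - P' = sin phase * psi' / psi^2, and |psi'| / psi^2 is at most
   the derivative of G = 4 \sum_j (F_j / F_k0 - 1 / F_k0), where the first
   quotient is kept only for j > k0 (otherwise it decreases). *)
Lemma dominated_primitive th c S k0 a b : 0 < a -> a <= b -> uniq S ->
  k0 \in S -> 1 <= F c k0 a ->
  (forall t j, a <= t <= b -> j \in S -> j != k0 ->
    2 * (size S)%:R * F c j t <= F c k0 t) ->
  exists P p G g : R -> R,
    [/\ forall t, a <= t <= b -> is_derive t 1 P (p t),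
        forall t, a <= t <= b -> is_derive t 1 G (g t),
        forall t, a <= t <= b -> `|cos (phase th c S t) / t - p t| <= g t,
        `|P b - P a| <= 4 & G b - G a <= 8 * (size S)%:R].
Proof.
move=> a0 ab uS k0S Fa1 dom.
have n1 : 1 <= (size S)%:R :> R by rewrite ler1n; case: (S) k0S.
have tp t : a <= t <= b -> 0 < t by case/andP => /(lt_le_trans a0).
have u1 t : a <= t <= b -> 1 <= F c k0 t.
  by case/andP => at_ _; apply: le_trans Fa1 _; apply: term_euler_le => //; exact: ltW.
have u0 t : a <= t <= b -> 0 < F c k0 t.
  by move=> /u1; apply: lt_le_trans.
have vu t j : a <= t <= b -> j \in S -> F c j t <= F c k0 t.
  move=> tab jS; have [->//|jk] := eqVneq j k0.
  apply: le_trans (dom t j tab jS jk); rewrite ler_peMl ?term_euler_ge0 ?(ltW (tp _ tab))//.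
  lra.
have psiu t : a <= t <= b -> F c k0 t / 2 <= `|psi c S t|.
  by move=> tab; apply: psi_lower => // [|j]; [exact: tp|exact: dom].
have psi0 t : a <= t <= b -> psi c S t != 0.
  by move=> tab; rewrite -normr_gt0 (lt_le_trans _ (psiu t tab))// divr_gt0// u0.
pose psi' t : R := \sum_(k <- S) k%:R * (k%:R * c k * t ^+ k) / t.
pose ph := phase th c S.
pose r t j : R := if (k0 < j)%N then F c j t * (F c k0 t)^-1 else 0.
pose r' t j : R := if (k0 < j)%N then
  (j%:R - k0%:R) / t * (F c j t / F c k0 t) else 0.
exists (fun t => sin (ph t) * (psi c S t)^-1).
exists (fun t => sin (ph t) * (- psi' t / psi c S t ^+ 2) +
  (psi c S t)^-1 * (cos (ph t) * (psi c S t / t))).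
(* The factor 4 is the inverse square of the [1 / 2] lost in [psi_lower]. *)
exists (fun t => 4 * \sum_(j <- S) (r t j - (F c k0 t)^-1)).
exists (fun t => 4 * \sum_(j <- S)
  (r' t j + k0%:R * F c k0 t / t / F c k0 t ^+ 2)).
split.
- move=> t tab; apply: is_derive_fM.
    by apply: is_derive_fcomp; apply: derive_phase; rewrite gt_eqF// tp.
  by apply: is_derive_fV (psi0 _ tab) _; apply: derive_psi; rewrite gt_eqF// tp.
- move=> t tab; apply: is_derive_fZ.
  have t0 : t != 0 by rewrite gt_eqF// tp.
  have U0 : F c k0 t != 0 by rewrite gt_eqF// u0.
  apply: (@is_derive_fsum R _ S (fun j t => r t j - (F c k0 t)^-1)
    (fun j t => r' t j + k0%:R * F c k0 t / t / F c k0 t ^+ 2)) => j.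
  have H : is_derive t 1 (fun t => r t j) (r' t j).
    rewrite /r /r'; case: ifP => _; last exact: is_derive_fcst.
    apply: (is_derive_val_eq (is_derive_fM (derive_term_euler c j t0) (is_derive_fV U0 (derive_term_euler c k0 t0)))).
    by field; rewrite U0.
  apply: (is_derive_val_eq (is_derive_fB H (is_derive_fV U0 (derive_term_euler c k0 t0)))).
  by field; rewrite U0.
- move=> t tab; rewrite -/ph.
  have t0 := tp _ tab; have U0 := u0 _ tab; have U1 := u1 _ tab.
  have -> : cos (ph t) / t - (sin (ph t) * (- psi' t / psi c S t ^+ 2) +
    (psi c S t)^-1 * (cos (ph t) * (psi c S t / t))) =
    sin (ph t) * (psi' t / psi c S t ^+ 2).
    by field; rewrite psi0// gt_eqF.
  rewrite normrM (le_trans (y := 1 * `|psi' t / psi c S t ^+ 2|))//.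
    by rewrite ler_wpM2r// ler_norml sin_geN1 sin_le1.
  rewrite mul1r normrM normfV normrX.
  apply: (@le_trans _ _ ((\sum_(j <- S) j%:R * F c j t / t) / (F c k0 t / 2) ^+ 2)).
    apply: ler_pM => //; rewrite ?invr_ge0 ?exprn_ge0//.
      apply: le_trans (ler_norm_sum _ _ _) _; apply: ler_sum => j _.
      by rewrite normrM normfV (ger0_norm (ltW t0)) normrM normr_term ?normr_nat// ltW.
    rewrite lef_pV2 ?posrE ?exprn_gt0 ?normr_gt0 ?psi0 ?divr_gt0//.
    by rewrite lerXn2r ?nnegrE ?divr_ge0 ?psiu// ltW.
  have -> : ((F c k0 t / 2) ^+ 2)^-1 = 4 * (F c k0 t ^+ 2)^-1.
    by field; rewrite gt_eqF.
  rewrite mulrCA ler_pM2l// mulr_suml big_seq [leRHS]big_seq.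
  apply: ler_sum => j jS; rewrite /r'.
  have V0 : 0 <= F c j t by rewrite term_euler_ge0// ltW.
  have VU := vu t j tab jS.
  move: (F c j t) (F c k0 t) V0 VU U0 U1 => v u v0 vu' u0' u1'.
  (* For [k0 < j] the claim reduces to [1 <= u] and [v <= u]; otherwise it follows from
     [j * v <= k0 * u]. *)
  case: ifPn => [kj|]; last rewrite -leqNgt => jk.
    have kj' : (k0%:R : R) <= j%:R by rewrite ler_nat ltnW.
    rewrite -subr_ge0.
    have -> : (j%:R - k0%:R) / t * (v / u) + k0%:R * u / t / u ^+ 2 -
      j%:R * v / t / u ^+ 2 =
      ((j%:R - k0%:R) * v * (u - 1) + k0%:R * (u - v)) / (t * u ^+ 2).
      by field; rewrite !gt_eqF.
    by rewrite divr_ge0 ?addr_ge0 ?mulr_ge0 ?subr_ge0 ?exprn_ge0// ltW.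
  rewrite add0r !ler_wpM2r ?invr_ge0 ?exprn_ge0 ?(ltW t0) ?(ltW u0')//.
  by rewrite ler_pM ?ler_nat.
- have ua : a <= a <= b by rewrite lexx.
  have ub : a <= b <= b by rewrite lexx andbT.
  (* [psi] is at least [1 / 2] in modulus because [1 <= F c k0]; the two endpoints together give
     4. *)
  have H t : a <= t <= b -> `|sin (ph t) * (psi c S t)^-1| <= 2.
    move=> tab; rewrite normrM normfV -[leRHS]mul1r ler_pM ?invr_ge0//.
      by rewrite ler_norml sin_geN1 sin_le1.
    rewrite -[leRHS]invrK lef_pV2 ?posrE ?normr_gt0 ?psi0//.
    by rewrite (le_trans _ (psiu _ tab))//; have := u1 _ tab; lra.
  by rewrite (le_trans (ler_normB _ _))//; have := H _ ua; have := H _ ub; lra.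
- have ua : a <= a <= b by rewrite lexx.
  have ub : a <= b <= b by rewrite lexx andbT.
  rewrite -mulrBr -sumrB.
  (* Each term grows by at most 2, since both [r] and [1 / F c k0] stay in [[0, 1]]. *)
  have : \sum_(j <- S) (r b j - (F c k0 b)^-1 - (r a j - (F c k0 a)^-1)) <=
      \sum_(j <- S) 2.
    rewrite big_seq [leRHS]big_seq; apply: ler_sum => j jS.
    have ra : 0 <= r a j.
      by rewrite /r; case: ifP => // _; rewrite divr_ge0 ?term_euler_ge0 ?(ltW (u0 _ _))// ltW.
    have rb : r b j <= 1.
      by rewrite /r; case: ifP => // _; rewrite ler_pdivrMr ?u0// mul1r vu.
    have Fb : 0 <= (F c k0 b)^-1 by rewrite invr_ge0 ltW// u0.
    have Fa : (F c k0 a)^-1 <= 1 by rewrite invf_le1// u0.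
    lra.
  rewrite big_const_seq count_predT iter_addr_0 -[_ *+ size S]mulr_natr; lra.
Qed.

End OscillatoryBound.

(** * Bad intervals and the uniform oscillatory bound *)

Section OscillatoryIntegral.
Context {R : realType}.
Implicit Types (S : seq nat) (c : nat -> R) (X : R -> R) (a b t th : R).
Local Notation F := term_euler.

(* Removing one bad interval leaves at most two intervals, whence the doubling. *)
Lemma split_at_bad_intervals X (A M : R) (B : seq (R * R)) a b :
  0 <= A -> 0 <= M -> a <= b ->
  (forall lr, lr \in B -> lr.1 <= lr.2) ->
  (forall lr x y, lr \in B -> a <= x -> x <= y -> y <= b ->
     lr.1 <= x -> y <= lr.2 -> `|X y - X x| <= M) ->
  (forall x y, a <= x -> x <= y -> y <= b ->
     (forall lr, lr \in B -> y <= lr.1 \/ lr.2 <= x) -> `|X y - X x| <= A) ->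
  `|X b - X a| <= 2 ^+ size B * (A + M) - M.
Proof.
move=> A0 M0; elim: B a b => [|[l r] B IH] a b ab lrB HM HA.
  by rewrite expr0 mul1r addrK; exact: HA.
have lr : l <= r by apply: (lrB (l, r)); rewrite mem_head.
have rec x y : a <= x -> x <= y -> y <= b -> y <= l \/ r <= x ->
    `|X y - X x| <= 2 ^+ size B * (A + M) - M.
  move=> ax xy yb av; apply: IH => //.
  - by move=> p pB; apply: lrB; rewrite inE pB orbT.
  - move=> p x' y' pB xx' x'y' y'y; apply: (HM p) => //.
    + by rewrite inE pB orbT.
    + exact: le_trans xx'.
    + exact: le_trans yb.
  - move=> x' y' xx' x'y' y'y H; apply: HA => //.
    + exact: le_trans xx'.
    + exact: le_trans yb.
    + move=> p; rewrite inE => /predU1P[->/=|]; last exact: H.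
      by case: av => [/(le_trans y'y)|/le_trans/(_ xx')]; [left|right].
have K0 : 0 <= 2 ^+ size B * (A + M) - M.
  rewrite subr_ge0 -[leLHS]mul1r ler_pM ?exprn_ege1 ?ler1n//; lra.
rewrite [size _]/= exprS -mulrA.
set K := 2 ^+ size B * (A + M) in rec K0 *.
have [bl|lb] := leP b l.
  by have := rec a b (lexx _) ab (lexx _) (or_introl bl); lra.
have [ra|ar] := leP r a.
  by have := rec a b (lexx _) ab (lexx _) (or_intror ra); lra.
(* Clamping [l] and [r] to [[a, b]] leaves two outer pieces, possibly degenerate, of cost [K - M]
   each, and a middle one of cost [M]. Their sum [2 * K - M] reproduces the shape of the bound. *)
have H1 : `|X (Num.max a l) - X a| <= K - M.
  have [al|la] := leP a l; last by rewrite subrr normr0.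
  by apply: rec => //; [exact: ltW|left].
have H2 : `|X b - X (Num.min b r)| <= K - M.
  have [br|rb] := leP b r; first by rewrite subrr normr0.
  by apply: rec => //; [exact: ltW|exact: ltW|right].
have H3 : `|X (Num.min b r) - X (Num.max a l)| <= M.
  apply: (HM (l, r)); rewrite ?mem_head ?le_max ?lexx ?orbT//=.
  - by rewrite ge_max !le_min ab lr !ltW.
  - by rewrite ge_min lexx.
  - by rewrite ge_min lexx orbT.
have -> : X b - X a = (X b - X (Num.min b r)) +
  (X (Num.min b r) - X (Num.max a l)) + (X (Num.max a l) - X a) by ring.
by rewrite (le_trans (ler_normD _ _))// (le_trans (lerD (ler_normD _ _) (lexx _)))//; lra.
Qed.

Lemma root_exists (A : R) (k : nat) : 0 < A -> (0 < k)%N ->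
  exists2 p : R, 0 < p & p ^+ k = A.
Proof.
move=> A0 k0; exists (A `^ (k%:R^-1)); first exact: powR_gt0.
by rewrite -powR_mulrn ?powR_ge0// -powRrM mulVf ?powRr1 ?pnatr_eq0 -?lt0n// ltW.
Qed.

Lemma seq_argmax (T : eqType) (s : seq T) (f : T -> R) : s != [::] ->
  exists2 k, k \in s & forall j, j \in s -> f j <= f k.
Proof.
elim: s => // x s IH _; have [->|s0] := eqVneq s [::].
  by exists x; rewrite ?mem_head// => j; rewrite inE => /eqP ->.
have [k ks kM] := IH s0; have [xk|kx] := leP (f x) (f k).
  by exists k; rewrite ?inE ?ks ?orbT// => j /predU1P[->//|/kM].
exists x; rewrite ?mem_head// => j; rewrite inE => /predU1P[->//|/kM jk].
exact: le_trans (ltW kx).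
Qed.

(** The diagonal case compares [F c i] with the threshold 1 instead of another monomial, so that one
    family of bad intervals indexed by pairs serves both purposes. *)
Definition separated (la : R) c (i j : nat) x y : Prop :=
  if i == j then 1 <= F c i x \/ F c i y <= 1
  else (forall t, x <= t <= y -> la * F c i t <= F c j t) \/
       (forall t, x <= t <= y -> la * F c j t <= F c i t).

(* Outside a multiplicative neighbourhood of its crossing point with another
   monomial, a monomial dominates or is dominated by the factor [la]. *)
Lemma separated_outside (la : R) c i j : 1 <= la ->
  (0 < i)%N -> (0 < j)%N -> c i != 0 -> c j != 0 ->
  exists lr : R * R, [/\ 0 < lr.1, lr.1 <= lr.2, lr.2 <= la ^+ 2 * lr.1 &
    forall x y, 0 < x -> x <= y -> y <= lr.1 \/ lr.2 <= x ->
    separated la c i j x y].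
Proof.
move=> la1 i0 j0 ci cj; rewrite /separated.
have A0 k : (0 < k)%N -> c k != 0 -> 0 < k%:R * `|c k|.
  by move=> k0 ck; rewrite mulr_gt0 ?ltr0n ?normr_gt0.
have [_|ij] := eqVneq i j.
  (* The threshold 1 is crossed at a single point [p], and a degenerate interval is enough. *)
  have Ai : 0 < (i%:R * `|c i|)^-1 by rewrite invr_gt0 A0.
  have [p p0 pE] := root_exists Ai i0.
  exists (p, p) => /=; split => //.
    by rewrite ler_peMl ?exprn_ege1// ltW.
  have Fp : F c i p = 1 by rewrite /term_euler pE mulfV// gt_eqF// A0.
  move=> x y x0 xy [yp|px]; [right|left]; rewrite -Fp.
    by apply: term_euler_le => //; rewrite (le_trans _ xy)// ltW.
  by apply: term_euler_le => //; exact: ltW.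
wlog ji : i j i0 j0 ci cj ij / (j < i)%N => [H|].
  have [/H|] := ltnP j i; first exact.
  rewrite leq_eqVlt (negbTE ij) /= => /H[]//; first by rewrite eq_sym.
  move=> lr [l0 lr' rl HH]; exists lr; split => // x y x0 xy av.
  by case: (HH x y x0 xy av) => ?; [right|left].
have d0 : (0 < i - j)%N by rewrite subn_gt0.
have Aij : 0 < (j%:R * `|c j|) / (i%:R * `|c i|) by rewrite divr_gt0 ?A0.
(* The two monomials agree at [p], so [F c i t / F c j t = (t / p) ^+ (i - j)]. Moving away from [p]
   by a factor [la] changes this ratio by a factor at least [la], because [1 <= i - j]. *)
have [p p0 pE] := root_exists Aij d0.
have la0 : 0 < la by apply: lt_le_trans la1.
exists (p / la, la * p) => /=; split.
- by rewrite divr_gt0.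
- rewrite ler_pdivrMr// mulrC mulrA ler_peMl ?(ltW p0)//.
  by rewrite -expr2 exprn_ege1.
- by rewrite expr2 -mulrA (mulrC p) mulVKf// gt_eqF.
have [A AE] : exists A : R, A = i%:R * `|c i| by eexists.
have A00 : 0 <= A by rewrite AE ltW ?A0.
have FE t : F c i t = A * t ^+ (i - j) * t ^+ j.
  by rewrite AE -mulrA -exprD subnK// ltnW.
have FjE t : F c j t = A * p ^+ (i - j) * t ^+ j.
  by rewrite AE /term_euler pE mulrCA mulfV ?mulr1// gt_eqF// A0.
have laX (s : R) : 0 <= s -> la * s ^+ (i - j) <= (la * s) ^+ (i - j).
  by move=> s0; rewrite exprMn ler_wpM2r ?exprn_ge0// ler_eXnr.
move=> x y x0 xy [yp|px]; [left|right] => t /andP[xt ty];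
  have t0 : 0 < t by apply: lt_le_trans xt.
all: rewrite FE FjE !mulrA ler_wpM2r ?exprn_ge0 ?(ltW t0)//.
all: rewrite -mulrA mulrCA ler_wpM2l//.
  apply: le_trans (laX _ (ltW t0)) _; rewrite lerXn2r ?nnegrE ?mulr_ge0 ?(ltW la0) ?(ltW t0) ?(ltW p0)//.
  by rewrite mulrC -ler_pdivlMr// (le_trans ty).
apply: le_trans (laX _ (ltW p0)) _; rewrite lerXn2r ?nnegrE ?mulr_ge0 ?(ltW la0) ?(ltW t0) ?(ltW p0)//.
exact: le_trans xt.
Qed.

(** The integrand [cos (phase th c S t) / t] folded onto [t > 0]; the minus sign reflects that
    [1 / t] is odd. *)
Definition osc_integrand th c S t : R := (cos (phase th c S t) - cos (phase th c S (- t))) / t.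

(** Coefficients of the reflected phase: only signs change, so every condition on [F] carries over
    to [- t]. *)
Definition sign_coef c (k : nat) : R := (-1) ^+ k * c k.

Lemma phase_opp th c S t : phase th c S (- t) = phase th (sign_coef c) S t.
Proof.
congr (_ + _); apply: eq_bigr => k _.
by rewrite /sign_coef (exprNn t) mulrCA mulrA.
Qed.

Lemma term_euler_sign c k t : F (sign_coef c) k t = F c k t.
Proof. by rewrite /term_euler /sign_coef normrM normrX normrN1 expr1n mul1r. Qed.

(** If all [F c k] are below 1 at [a], diagonal separation keeps them at most 1 up to [b], and the
    Lipschitz bound for cosine costs [2 * size S]. Otherwise the largest [F c k] at [a] dominates on
    all of [[a, b]], and [dominated_primitive], used for both signs of [t], costs twice
    [4 + 8 * size S]. *)
Lemma osc_separated_bound (la : R) th c S X a b : 0 < a -> a <= b ->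
  2 <= la -> 2 * (size S)%:R <= la -> uniq S ->
  (forall k, k \in S -> (0 < k)%N /\ c k != 0) ->
  (forall t, a <= t <= b -> is_derive t 1 X (osc_integrand th c S t)) ->
  (forall i j, i \in S -> j \in S -> separated la c i j a b) ->
  `|X b - X a| <= 8 + 16 * (size S)%:R.
Proof.
move=> a0 ab la2 lan uS Sk dX0 sep.
have tp t : a <= t <= b -> 0 < t by case/andP => /(lt_le_trans a0).
have n0 : 0 <= (size S)%:R :> R by [].
have [[k1 k1S Fk1]|small] := pselect (exists2 k, k \in S & 1 <= F c k a); last first.
  have Fb k : k \in S -> F c k b <= 1.
    move=> kS; have := sep k k kS kS; rewrite /separated eqxx => -[F1|//].
    by exfalso; apply: small; exists k.
  (* The integrand is at most the sum of the [2 * |c k| * t ^+ k.-1], which the derivative of [G]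
     majorizes because [1 <= k]. *)
  pose G t : R := 2 * \sum_(k <- S) `|c k| * t ^+ k.
  have dG t : a <= t <= b ->
      is_derive t 1 G (2 * \sum_(k <- S) `|c k| * (k%:R * t ^+ k.-1)).
    by move=> tab; apply: is_derive_fZ; exact: (derive_psum (fun k => `|c k|)).
  have := @derive_comparison _ X (osc_integrand th c S) (fun=> 0) (fun=> 0) G _ a b ab dX0
    (fun t _ => is_derive_fcst _ _) dG.
  rewrite subrr subr0 => H; apply: le_trans (H _) _.
    move=> t tab; have t0 := tp t tab.
    rewrite subr0 /osc_integrand normrM normfV (ger0_norm (ltW t0)) ler_pdivrMr//.
    apply: le_trans (cos_lipschitz _ _) _.
    rewrite /phase opprD addrACA subrr add0r -sumrB -mulrA mulr_suml mulr_sumr.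
    apply: le_trans (ler_norm_sum _ _ _) _; rewrite big_seq [leRHS]big_seq.
    apply: ler_sum => k kS; have [k0 _] := Sk k kS.
    rewrite natX_pred ?gt_eqF// !mulrA divfK ?gt_eqF// -mulrBr normrM.
    rewrite -!mulrA mulrCA ler_wpM2l//.
    apply: (@le_trans _ _ (2 * t ^+ k)).
      rewrite (le_trans (ler_normB _ _))// !normrX normrN (ger0_norm (ltW t0)).
      by rewrite mulr_natl mulr2n.
    rewrite ler_pM2l// ler_peMl ?exprn_ge0 ?ler1n// ltW//.
  have Ga : 0 <= G a.
    by rewrite mulr_ge0// sumr_ge0// => k _; rewrite mulr_ge0 ?exprn_ge0// ltW.
  have Gb : G b <= 2 * (size S)%:R.
    rewrite ler_pM2l// -sum1_size natr_sum big_seq [leRHS]big_seq.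
    apply: ler_sum => k kS; have [k0 _] := Sk k kS.
    apply: le_trans (Fb k kS); rewrite /term_euler -mulrA ler_peMl ?ler1n//.
    by rewrite mulr_ge0 ?exprn_ge0// ltW// (lt_le_trans a0).
  lra.
have [|k0 k0S Fk0] := @seq_argmax _ S (F c ^~ a).
  by apply/eqP => S0; rewrite S0 in k1S.
have F1 : 1 <= F c k0 a := le_trans Fk1 (Fk0 _ k1S).
have dom t j : a <= t <= b -> j \in S -> j != k0 ->
    2 * (size S)%:R * F c j t <= F c k0 t.
  move=> tab jS jk; have := sep j k0 jS k0S; rewrite /separated (negbTE jk).
  (* The opposite alternative already fails at [t = a], where [F c k0] is maximal and at least 1
     while [2 <= la]. *)
  case=> [/(_ t tab)|/(_ a)]; last first.
    rewrite lexx ab => /(_ isT) H; have := Fk0 j jS.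
    have : 2 * F c k0 a <= la * F c k0 a by rewrite ler_wpM2r// (le_trans _ F1).
    by move=> H1 H2; exfalso; move: H H1 H2 F1; lra.
  by apply: le_trans; rewrite ler_wpM2r// term_euler_ge0// ltW// tp.
have dom' t j : a <= t <= b -> j \in S -> j != k0 ->
    2 * (size S)%:R * F (sign_coef c) j t <= F (sign_coef c) k0 t.
  by rewrite !term_euler_sign; exact: dom.
have F1' : 1 <= F (sign_coef c) k0 a by rewrite term_euler_sign.
have [P [p [G [g [dP dG pg Pab Gab]]]]] :=
  dominated_primitive th a0 ab uS k0S F1 dom.
have [P' [p' [G' [g' [dP' dG' pg' Pab' Gab']]]]] :=
  dominated_primitive th a0 ab uS k0S F1' dom'.
have := @derive_comparison _ X _ (fun t => P t - P' t) (fun t => p t - p' t)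
  (fun t => G t + G' t) (fun t => g t + g' t) a b ab dX0.
move=> H; have {}H := H
  (fun t tab => is_derive_fB (dP t tab) (dP' t tab)) (fun t tab => is_derive_fD (dG t tab) (dG' t tab)).
have {}H : `|X b - X a - (P b - P' b - (P a - P' a))| <= G b + G' b - (G a + G' a).
  apply: H => t tab; have := pg t tab; have := pg' t tab.
  rewrite /osc_integrand phase_opp => q' q.
  have -> : (cos (phase th c S t) - cos (phase th (sign_coef c) S t)) / t - (p t - p' t)
    = (cos (phase th c S t) / t - p t) - (cos (phase th (sign_coef c) S t) / t - p' t).
    by ring.
  by rewrite (le_trans (ler_normB _ _))// lerD.
have -> : X b - X a = (X b - X a - (P b - P' b - (P a - P' a))) +
  ((P b - P a) - (P' b - P' a)) by ring.
rewrite (le_trans (ler_normD _ _))// (le_trans (lerD (lexx _) (ler_normB _ _)))//.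
lra.
Qed.

Theorem osc_bound (n : nat) : exists C : R,
  forall S c th X a b, uniq S -> (size S <= n)%N ->
  (forall k, k \in S -> (0 < k)%N /\ c k != 0) ->
  0 < a -> a <= b ->
  (forall t, a <= t <= b -> is_derive t 1 X (osc_integrand th c S t)) ->
  `|X b - X a| <= C.
Proof.
(* [la] lets one monomial beat all others jointly. [A] is the cost of a good interval and [M] that
   of a bad one, where the trivial bound [2 / t] integrates to at most [2 * ln (la ^+ 2)]. *)
pose la : R := 2 * n.+1%:R; pose A : R := 8 + 16 * n%:R.
pose M : R := 2 * ln (la ^+ 2).
have n1 : 1 <= n.+1%:R :> R by rewrite ler1n.
have la2 : 2 <= la by rewrite /la; lra.
have la0 : 0 < la by lra.
have A0 : 0 <= A by rewrite addr_ge0// mulr_ge0.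
have M0 : 0 <= M by rewrite mulr_ge0// ln_ge0// exprn_ege1//; lra.
exists (2 ^+ (n * n) * (A + M)) => S c th X a b uS Sn Sk a0 ab dX0.
(* The implication lets pairs outside [S] receive the dummy interval [(0, 0)], so a single choice
   function covers all pairs; at most [n * n] of its values are used. *)
have Q (ij : nat * nat) : exists lr : R * R, ij.1 \in S -> ij.2 \in S ->
    [/\ 0 < lr.1, lr.1 <= lr.2, lr.2 <= la ^+ 2 * lr.1 &
    forall x y, 0 < x -> x <= y -> y <= lr.1 \/ lr.2 <= x ->
    separated la c ij.1 ij.2 x y].
  have [i1|] := boolP (ij.1 \in S); last by move=> _; exists (0, 0).
  have [i2|] := boolP (ij.2 \in S); last by move=> _; exists (0, 0).
  have [p1 c1] := Sk _ i1; have [p2 c2] := Sk _ i2.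
  have la1 : 1 <= la by lra.
  by have [lr lrP] := separated_outside la1 p1 p2 c1 c2; exists lr.
have [f fP] := choice Q.
pose B := [seq f ij | ij <- [seq (i, j) | i <- S, j <- S]].
have fB lr : lr \in B -> [/\ 0 < lr.1, lr.1 <= lr.2 & lr.2 <= la ^+ 2 * lr.1].
  move=> /mapP[[i j] /allpairsP[[i' j'] [/= iS jS [-> ->]]] ->].
  by have [] := fP (i', j') iS jS.
apply: (@le_trans _ _ (2 ^+ size B * (A + M) - M)); last first.
  rewrite lerBlDr -[leLHS]addr0 lerD// ler_wpM2r ?addr_ge0//.
  rewrite ler_eXn2l ?ltr1n// size_map size_allpairs.
  exact: leq_mul.
apply: split_at_bad_intervals => //.
- by move=> lr /fB[].
- move=> lr x y /fB[l0 lr' rl] ax xy yb lx yr.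
  have x0 : 0 < x by apply: lt_le_trans ax.
  have y0 : 0 < y by apply: lt_le_trans xy.
  have dX' t : x <= t <= y -> is_derive t 1 X (osc_integrand th c S t).
    by case/andP => xt ty; apply: dX0; rewrite (le_trans ax xt) (le_trans ty).
  have := @derive_comparison _ X _ (fun=> 0) (fun=> 0) (fun t => 2 * ln t)
    (fun t => 2 * t^-1) x y xy dX' (fun t _ => is_derive_fcst _ _).
  rewrite subrr subr0 => H; apply: le_trans (H _ _) _.
  + move=> t /andP[xt _]; apply: is_derive_fZ; apply: is_derive1_ln.
    exact: lt_le_trans xt.
  + move=> t /andP[xt _]; have t0 : 0 < t by exact: lt_le_trans xt.
    rewrite subr0 normrM normfV (ger0_norm (ltW t0)) ler_wpM2r ?invr_ge0 ?(ltW t0)//.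
    rewrite (le_trans (ler_normB _ _))//.
    by have := cos_max (phase th c S t); have := cos_max (phase th c S (- t)); lra.
  + rewrite -mulrBr ler_pM2l// -ln_div ?posrE// ler_ln ?posrE ?divr_gt0 ?exprn_gt0//.
    rewrite ler_pdivrMr// (le_trans yr)// (le_trans rl)//.
    by rewrite ler_wpM2l ?exprn_ge0 ?(ltW la0).
- move=> x y ax xy yb av.
  have x0 : 0 < x by apply: lt_le_trans ax.
  apply: (@le_trans _ _ (8 + 16 * (size S)%:R)); last first.
    by rewrite lerD2l ler_pM2l// ler_nat.
  apply: (@osc_separated_bound la th c S X x y) => //.
  + by rewrite ler_pM2l// ler_nat (leq_trans Sn).
  + by move=> t /andP[xt ty]; apply: dX0; rewrite (le_trans ax xt) (le_trans ty).
  + move=> i j iS jS; have [_ _ _] := fP (i, j) iS jS; apply => //.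
    by apply: av; apply: map_f; apply/allpairsP; exists (i, j).
Qed.

End OscillatoryIntegral.

(** * Integration on the real line *)

Section Integrals.
Context {R : realType}.
Local Notation mu := (@lebesgue_measure R).
Implicit Types (f g h : R -> R) (x y a b : R).

(** Integrals run over the whole line and domains become indicator factors, so that linearity,
    Fubini and changes of variable are needed in one form only. *)
Definition L1 f := mu.-integrable [set: R] (EFin \o f).
Definition intR f : R := \int[mu]_x f x.

Lemma L1_measurable f : L1 f -> measurable_fun [set: R] f.
Proof. by move=> /measurable_int /measurable_EFinP. Qed.

Lemma L1_dom f g : measurable_fun [set: R] f -> L1 g ->
  (forall x, `|f x| <= g x) -> L1 f.
Proof.
move=> mf Lg fg; apply: le_integrable Lg => //; first exact/measurable_EFinP.
by move=> x _ /=; rewrite lee_fin (le_trans (fg x))// ler_norm.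
Qed.

Lemma L1D f g : L1 f -> L1 g -> L1 (fun x => f x + g x).
Proof. by move=> Lf Lg; exact: integrableD Lf Lg. Qed.

Lemma L1B f g : L1 f -> L1 g -> L1 (fun x => f x - g x).
Proof. by move=> Lf Lg; exact: integrableB Lf Lg. Qed.

Lemma L1Z k f : L1 f -> L1 (fun x => k * f x).
Proof. by move=> Lf; exact: integrableZl Lf. Qed.

Lemma L1abs f : L1 f -> L1 (fun x => `|f x|).
Proof. by move=> Lf; exact: integrable_norm Lf. Qed.

Lemma L1_mul_bounded f g (M : R) : L1 f -> measurable_fun [set: R] g ->
  (forall x, `|g x| <= M) -> L1 (fun x => f x * g x).
Proof.
move=> Lf mg gM; apply: (@L1_dom _ (fun x => M * `|f x|)).
- by apply: measurable_funM => //; exact: L1_measurable.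
- by apply: L1Z; exact: L1abs.
- by move=> x; rewrite normrM mulrC ler_wpM2r.
Qed.

Lemma L1_itv a b : L1 (\1_`[a, b]).
Proof. exact: integrable_indic_itv. Qed.

Lemma L1_bounded_support f (B M : R) : measurable_fun [set: R] f ->
  (forall x, `|f x| <= M) -> (forall x, B < `|x| -> f x = 0) -> L1 f.
Proof.
move=> mf fM fB; apply: (@L1_dom _ (fun x => M * \1_`[-B, B] x)) => //.
  by apply: L1Z; exact: L1_itv.
move=> x; rewrite indicE; case: (boolP (x \in _)) => [|/negP xB].
  by rewrite mulr1.
rewrite fB ?normr0 ?mulr0// ltNge; apply/negP; rewrite ler_norml => xB'.
by apply: xB; rewrite inE /= in_itv.
Qed.

Lemma eq_intR f g : f =1 g -> intR f = intR g.
Proof. by move=> fg; apply: eq_Rintegral => x _. Qed.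

Lemma intR0 : intR (fun=> 0 : R) = 0.
Proof. by rewrite /intR /Rintegral integral0. Qed.

Lemma intRD f g : L1 f -> L1 g -> intR (fun x => f x + g x) = intR f + intR g.
Proof. by move=> ? ?; exact: RintegralD. Qed.

Lemma intRB f g : L1 f -> L1 g -> intR (fun x => f x - g x) = intR f - intR g.
Proof. by move=> ? ?; exact: RintegralB. Qed.

Lemma intRZ k f : L1 f -> intR (fun x => k * f x) = k * intR f.
Proof. by move=> ?; exact: RintegralZl. Qed.

Lemma intR_ge0 f : (forall x, 0 <= f x) -> 0 <= intR f.
Proof. by move=> f0; exact: Rintegral_ge0. Qed.

Lemma intR_le f g : L1 f -> L1 g -> (forall x, f x <= g x) -> intR f <= intR g.
Proof. by move=> Lf Lg fg; exact: le_Rintegral. Qed.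

Lemma intR_norm f : L1 f -> `|intR f| <= intR (fun x => `|f x|).
Proof. by move=> Lf; exact: le_normr_Rintegral. Qed.

Lemma intR_norm_le f g : measurable_fun [set: R] f -> L1 g ->
  (forall x, `|f x| <= g x) -> `|intR f| <= intR g.
Proof.
move=> mf Lg fg; have Lf := L1_dom mf Lg fg.
by rewrite (le_trans (intR_norm Lf))// intR_le//; exact: L1abs.
Qed.

Lemma EFin_intR f : L1 f -> (\int[mu]_x (f x)%:E = (intR f)%:E)%E.
Proof. by move=> Lf; rewrite /intR /Rintegral fineK//; exact: integrable_fin_num. Qed.

Lemma intR_itv (f : R -> R) (D : set R) : measurable D ->
  \int[mu]_(x in D) f x = intR (fun x => \1_D x * f x).
Proof.
move=> mD; rewrite Rintegral_mkcond; apply: eq_intR => x.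
by rewrite patchE indicE; case: ifP => /= xD; rewrite ?mul1r ?mul0r.
Qed.

Lemma L1_restrict (f : R -> R) (D : set R) : measurable D ->
  mu.-integrable D (EFin \o f) <-> L1 (fun x => \1_D x * f x).
Proof.
move=> mD; have E : EFin \o (fun x => \1_D x * f x) = (EFin \o f) \_ D.
  apply/funext => x; rewrite patchE /= indicE.
  by case: ifP => _; rewrite ?mul1r ?mul0r.
by rewrite /L1 E; exact: integrable_mkcond.
Qed.

Section Fubini.
Variables (F : R -> R -> R) (u v : R -> R).
Hypothesis mF : measurable_fun [set: R * R] (fun p => F p.1 p.2).
Hypotheses (Lu : L1 u) (Lv : L1 v).
Hypothesis Fuv : forall x y, `|F x y| <= u x * v y.

Let f2 (p : R * R) : \bar R := (F p.1 p.2)%:E.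

Let mf2 : measurable_fun [set: R * R] f2.
Proof. exact/measurable_EFinP. Qed.

(** A majorant of product form makes every slice integrable, not just almost every one, so inner
    integrals may be rewritten pointwise. *)
Lemma fubini_slice x : L1 (F x).
Proof.
apply: (@L1_dom _ (fun y => u x * v y)); last exact: Fuv.
- exact: (measurableT_comp mF (measurable_pair1 x)).
- exact: L1Z.
Qed.

Let F2 y : L1 (F ^~ y).
Proof.
apply: (@L1_dom _ (fun x => v y * u x)).
- exact: (measurableT_comp mF (measurable_pair2 y)).
- exact: L1Z.
- by move=> x; rewrite mulrC Fuv.
Qed.

Let if2 : (mu \x mu)%E.-integrable setT f2.
Proof.
apply/integrable12ltyP => //.
apply: (@le_lt_trans _ _ (\int[mu]_x (`|u x| * intR (fun y => `|v y|))%:E)%E).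
  apply: ge0_le_integral => //.
  - by move=> x _; apply: integral_ge0.
  - apply: (@measurable_fun_fubini_tonelli_F _ _ _ _ R mu (abse \o f2)) => //=.
    exact: measurableT_comp.
  - apply/measurable_EFinP; apply: measurable_funM => //.
    by apply: measurableT_comp => //; exact: L1_measurable.
  - move=> x _; rewrite EFinM -EFin_intR; last exact: L1abs.
    rewrite -ge0_integralZl_EFin//; last first.
      by apply/measurable_EFinP; apply: measurableT_comp => //; exact: L1_measurable.
    apply: ge0_le_integral => //.
    + by apply: measurableT_comp => //; have /measurable_int := fubini_slice x.
    + apply/measurable_EFinP; apply: measurable_funM => //.
      by apply: measurableT_comp => //; exact: L1_measurable.
    + by move=> y _; rewrite /= lee_fin -normrM (le_trans (Fuv x y))// ler_norm.
have /integrable_fin_num : L1 (fun x => `|u x| * intR (fun y => `|v y|)).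
  under eq_fun do rewrite mulrC.
  by apply: L1Z; exact: L1abs.
by move=> /(_ measurableT); rewrite ltey_eq => ->.
Qed.

Lemma fubini_L1 : L1 (fun x => intR (F x)).
Proof.
have := integrable_fubini_F if2; apply: eq_integrable => // x _ /=.
by rewrite /fubini_F -EFin_intR ?fubini_slice.
Qed.

Lemma fubini_swap : intR (fun x => intR (F x)) = intR (fun y => intR (F ^~ y)).
Proof.
rewrite /intR /Rintegral; congr fine.
under eq_integral do rewrite -/(intR _) -EFin_intR ?fubini_slice//.
under [RHS]eq_integral do rewrite -/(intR _) -EFin_intR//.
exact: (Fubini if2).
Qed.

End Fubini.

Section Invariance.

Lemma integral_invariant (phi : R -> R) (f : R -> \bar R) :
  measurable_fun [set: R] phi ->
  (forall A : set R, measurable A -> pushforward mu phi A = mu A) ->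
  measurable_fun [set: R] f ->
  (\int[mu]_x f (phi x) = \int[mu]_x f x)%E.
Proof.
move=> mphi inv mf.
have H (g : R -> \bar R) : measurable_fun [set: R] g -> (forall x, 0 <= g x)%E ->
    (\int[mu]_x g (phi x) = \int[mu]_x g x)%E.
  move=> mg g0; have := @ge0_integral_pushforward _ _ (measurableTypeR R) (measurableTypeR R) R phi mphi mu setT g.
  rewrite preimage_setT => <- //.
  by apply: eq_measure_integral => A mA _; exact: inv.
rewrite integralE [RHS]integralE; congr (_ - _)%E.
  rewrite -(H f^\+%E)//; last exact: measurable_funepos.
  by apply: eq_integral => x _; rewrite !funeposE.
rewrite -(H f^\-%E)//; last exact: measurable_funeneg.
by apply: eq_integral => x _; rewrite !funenegE.
Qed.

(** Lebesgue measure is determined by its values on the intervals []b, c]], and the preimage of such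
    an interval is a translate of the same length. *)
Lemma pushforward_shift a (A : set R) : measurable A ->
  pushforward mu (fun x : measurableTypeR R => x + a : measurableTypeR R) A = mu A.
Proof.
move=> mA; apply/esym/lebesgue_measure_unique => //; first exact: measurable_funD.
move=> _ _ [[b c] _ <-] /=.
have -> : pushforward mu (fun x : measurableTypeR R => x + a : measurableTypeR R)
    `]b, c] = mu `]b - a, c - a].
  rewrite /pushforward; congr (mu _); apply/seteqP; split => x /=;
  by rewrite !in_itv/= ltrBlDr lerBrDr.
rewrite !lebesgue_measure_itv/= !lte_fin ltrD2r.
by congr (if _ then _ else _); rewrite -!EFinB; congr (_%:E); ring.
Qed.

Lemma integral_shift a (f : R -> \bar R) : measurable_fun [set: R] f ->
  (\int[mu]_x f (x + a)%R = \int[mu]_x f x)%E.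
Proof.
move=> mf; apply: (@integral_invariant (fun x => x + a)) => //.
  exact: measurable_funD.
exact: pushforward_shift.
Qed.

Lemma integral_opp (f : R -> \bar R) : measurable_fun [set: R] f ->
  (\int[mu]_x f (- x)%R = \int[mu]_x f x)%E.
Proof.
by move=> mf; apply: (@integral_invariant -%R) => //; exact: lebesgue_measureN.
Qed.

Lemma intR_shift a f : measurable_fun [set: R] f -> intR (fun x => f (x + a)) = intR f.
Proof.
move=> mf; rewrite /intR /Rintegral; congr fine.
by apply: (integral_shift a (f := EFin \o f)); exact/measurable_EFinP.
Qed.

Lemma intR_opp f : measurable_fun [set: R] f -> intR (fun x => f (- x)) = intR f.
Proof.
move=> mf; rewrite /intR /Rintegral; congr fine.
by apply: (integral_opp (f := EFin \o f)); exact/measurable_EFinP.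
Qed.

Lemma L1_opp f : L1 f -> L1 (fun x => f (- x)).
Proof.
move=> Lf; have mf := L1_measurable Lf; apply/integrableP; split.
  by apply/measurable_EFinP; apply: (measurableT_comp mf).
rewrite (integral_opp (f := fun x => `|(f x)%:E|%E)); first by case/integrableP: Lf.
by do 2!apply: measurableT_comp => //.
Qed.

Lemma L1_shift a f : L1 f -> L1 (fun x => f (x + a)).
Proof.
move=> Lf; have mf := L1_measurable Lf; apply/integrableP; split.
  apply/measurable_EFinP; apply: (measurableT_comp mf); exact: measurable_funD.
rewrite (integral_shift a (f := fun x => `|(f x)%:E|%E)).
  by case/integrableP: Lf.
by do 2!apply: measurableT_comp => //.
Qed.

End Invariance.

End Integrals.

(** * Fundamental theorem of calculus and the exponential frequency weight *)

Section FundamentalTheorem.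
Context {R : realType}.
Local Notation mu := (@lebesgue_measure R).
Implicit Types (f g F : R -> R) (a b x t u : R).

Lemma intR_FTC f F a b : a <= b ->
  (forall t, a <= t <= b -> is_derive t 1 F (f t)) ->
  (forall t, a <= t <= b -> {for t, continuous f}) ->
  L1 (fun x => \1_`[a, b] x * f x) /\
  intR (fun x => \1_`[a, b] x * f x) = F b - F a.
Proof.
move=> ab dF cf.
have wf : {within `[a, b], continuous f}.
  by apply: continuous_in_subspaceT => t /set_mem/=; rewrite in_itv; exact: cf.
have Lf : mu.-integrable `[a, b] (EFin \o f).
  by apply: continuous_compact_integrable => //; exact: segment_compact.
split; first exact: (L1_restrict f (measurable_itv _)).1 Lf.
rewrite -intR_itv//; move: ab; rewrite le_eqVlt => /predU1P[<-|ab].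
  by rewrite set_itv1 Rintegral_set1 subrr.
rewrite /Rintegral (@continuous_FTC2 _ f F)//.
- have dF' t : a <= t <= b -> {for t, continuous F}.
    move=> /dF [? _]; apply/differentiable_continuous.
    exact/derivable1_diffP.
  split.
  + by move=> x; rewrite in_itv/= => /andP[ax xb]; have [] := dF x; rewrite ?ltW.
  + by apply: cvg_at_right_filter; apply: dF'; rewrite lexx ltW.
  + by apply: cvg_at_left_filter; apply: dF'; rewrite lexx ltW.
- move=> x; rewrite in_itv/= => /andP[ax xb]; rewrite derive1E.
  by have [] := dF x; rewrite ?ltW.
Qed.

Lemma intR_FTCy f F a (l : R) : (forall x, 0 <= f x) -> continuous f ->
  (forall x, is_derive x 1 F (f x)) -> F x @[x --> +oo] --> l ->
  L1 (fun x => \1_`[a, +oo[ x * f x) /\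
  intR (fun x => \1_`[a, +oo[ x * f x) = l - F a.
Proof.
move=> f0 cf dF Fl.
have E : (\int[mu]_(x in `[a, +oo[) (f x)%:E = l%:E - (F a)%:E)%E.
  apply: (@ge0_continuous_FTC2y R f F a l) => //.
  - exact: continuous_subspaceT.
  - apply: cvg_at_right_filter; apply/differentiable_continuous.
    by apply/derivable1_diffP; have [] := dF a.
  - by move=> x _; rewrite derive1E; have [] := dF x.
split; last by rewrite -intR_itv// /Rintegral E.
have Lf : mu.-integrable `[a, +oo[ (EFin \o f).
  apply/integrableP; split.
    apply/measurable_EFinP; apply: measurable_funTS.
    exact: continuous_measurable_fun.
  under eq_integral do rewrite /= ger0_norm//.
  by rewrite E -EFinB ltry.
exact: (L1_restrict f (measurable_itv _)).1 Lf.
Qed.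

Lemma derive_continuous f (df : R -> R) : (forall x, is_derive x 1 f (df x)) ->
  continuous f.
Proof.
move=> dF x; apply/differentiable_continuous/derivable1_diffP.
by have [] := dF x.
Qed.

(** Only frequencies [t >= 0] are weighted: for real functions the cosine transform is even and the
    sine transform odd, so their squares carry all information there. *)
Definition abel_weight (de : R) (t : R) : R := \1_`[0, +oo[ t * expR (- (de * t)).

Lemma derive_expRZ de t :
  is_derive t 1 (fun t => expR (- (de * t))) (expR (- (de * t)) * - de).
Proof.
apply: is_derive_fcomp; apply: (is_derive_val_eq (is_derive_fN (is_derive_fZ de (is_derive_fid t)))); by rewrite mulr1.
Qed.

Lemma expRZ_cvg0 de : 0 < de -> expR (- (de * x)) @[x --> +oo] --> (0 : R).
Proof.
move=> de0; apply: (@cvg_comp _ _ _ (fun x => de * x) (fun x => expR (- x))).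
  exact: gt0_cvgMry.
exact: cvgr_expR.
Qed.

Lemma L1_abel_weight de : 0 < de -> L1 (abel_weight de).
Proof.
move=> de0; have [] := @intR_FTCy (fun t => expR (- (de * t)))
  (fun t => - de^-1 * expR (- (de * t))) 0 (- de^-1 * 0) => //.
- exact: (derive_continuous (derive_expRZ de)).
- move=> x; apply: (is_derive_val_eq (is_derive_fZ _ (derive_expRZ de x))).
  by field; rewrite gt_eqF.
- by apply: cvgMl_tmp; exact: expRZ_cvg0.
Qed.

Lemma abel_weight_ge0 de t : 0 <= abel_weight de t.
Proof. by rewrite mulr_ge0 ?expR_ge0// indicE. Qed.

(* Adding [1] makes the integrand nonnegative, as the improper fundamental
   theorem of calculus requires. *)
Lemma intR_abel_cos de u : 0 < de ->
  intR (fun t => abel_weight de t * cos (u * t)) = de / (de ^+ 2 + u ^+ 2).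
Proof.
move=> de0; pose E t := expR (- (de * t)).
have D0 : de ^+ 2 + u ^+ 2 != 0.
  by rewrite gt_eqF// ltr_pwDl ?exprn_gt0// sqr_ge0.
pose D := de ^+ 2 + u ^+ 2.
(* The first term is the primitive of [E t * cos (u * t)] given by two integrations by parts; the
   second accounts for the added 1. *)
pose G t := E t * (u * sin (u * t) - de * cos (u * t)) / D - E t / de.
have dsinu t : is_derive t 1 (fun t => sin (u * t)) (cos (u * t) * u).
  by apply: is_derive_fcomp; apply: (is_derive_val_eq (is_derive_fZ u (is_derive_fid t))); rewrite mulr1.
have dcosu t : is_derive t 1 (fun t => cos (u * t)) (- sin (u * t) * u).
  by apply: is_derive_fcomp; apply: (is_derive_val_eq (is_derive_fZ u (is_derive_fid t))); rewrite mulr1.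
have dE t : is_derive t 1 E (E t * - de) := derive_expRZ de t.
pose g t := E t * (1 + cos (u * t)).
have dG t : is_derive t 1 G (g t).
  apply: (is_derive_val_eq (is_derive_fB (is_derive_fM (is_derive_fM (dE t) (is_derive_fB (is_derive_fZ u (dsinu t)) (is_derive_fZ de (dcosu t)))) (is_derive_fcst D^-1 t))
    (is_derive_fM (dE t) (is_derive_fcst de^-1 t)))).
  by rewrite /g /D; field; rewrite D0 gt_eqF.
have cg : continuous g.
  by apply: derive_continuous => t; exact: is_derive_fM (dE t) (is_derive_fD (is_derive_fcst 1 t) (dcosu t)).
have g0 t : 0 <= g t by rewrite mulr_ge0 ?expR_ge0// -lerBlDl sub0r cos_geN1.
have E0 : E x @[x --> +oo] --> (0 : R) by exact: expRZ_cvg0.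
have G0 : G x @[x --> +oo] --> (0 : R).
  pose K := (`|u| + de) / D + de^-1.
  have K0 : 0 <= K by rewrite addr_ge0 ?divr_ge0 ?invr_ge0 ?addr_ge0 ?sqr_ge0// ltW.
  apply: (@squeeze_cvgr _ _ _ _ (fun t => - (K * E t)) (fun t => K * E t)).
  - near=> t; rewrite -ler_norml /G /K.
    have Et : 0 <= E t := expR_ge0 _.
    rewrite (le_trans (ler_normB _ _))// mulrDl lerD//; last first.
      by rewrite normrM (ger0_norm Et) normfV gtr0_norm// mulrC.
    rewrite !normrM (ger0_norm Et) normfV [X in _ / X]ger0_norm; last first.
      by rewrite addr_ge0 ?sqr_ge0.
    have -> : (`|u| + de) / D * E t = E t * (`|u| + de) / D by ring.
    rewrite ler_wpM2r ?invr_ge0 ?addr_ge0 ?sqr_ge0// ler_wpM2l//.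
    rewrite (le_trans (ler_normB _ _))// !normrM lerD//.
      by rewrite ler_piMr// ler_norml sin_geN1 sin_le1.
    by rewrite (gtr0_norm de0) ler_piMr ?(ltW de0)// cos_max.
  - by rewrite -oppr0 -(mulr0 K); apply: cvgN; exact: cvgMl_tmp.
  - by rewrite -(mulr0 K); exact: cvgMl_tmp.
have [Lg Ig] := @intR_FTCy g G 0 0 g0 cg dG G0.
have Lw := L1_abel_weight de0.
have Iw : intR (abel_weight de) = de^-1.
  have [] := @intR_FTCy E (fun t => - de^-1 * E t) 0 (- de^-1 * 0) => //.
  - by move=> x; exact: expR_ge0.
  - exact: derive_continuous dE.
  - by move=> x; apply: (is_derive_val_eq (is_derive_fZ _ (dE x))); field; rewrite gt_eqF.
  - exact: cvgMl_tmp.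
  - by move=> _ ->; rewrite /E !mulr0 oppr0 expR0; ring.
have -> : intR (fun t => abel_weight de t * cos (u * t)) =
    intR (fun t => \1_`[0, +oo[ t * g t - abel_weight de t).
  by apply: eq_intR => t; rewrite /g /abel_weight -/(E t); ring.
rewrite intRB// Ig Iw /G /E !mulr0 sin0 cos0 oppr0 expR0 /D.
by field; rewrite D0 gt_eqF.
Unshelve. all: by end_near. Qed.

End FundamentalTheorem.

(** * An L2 bound for convolutions with a bounded multiplier *)

Section BoxedDoubleIntegrals.
Context {R : realType}.
Implicit Types (F G : R -> R -> R) (B K : R).

(** The bound is kept as a product of functions of one variable, the form of majorant that the
    Fubini lemmas take. *)
Definition boxed B F : Prop :=
  measurable_fun [set: R * R] (fun p => F p.1 p.2) /\
  exists K, forall x y, `|F x y| <= (K * \1_`[-B, B] x) * \1_`[-B, B] y.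

Definition intR2 F : R := intR (fun x => intR (F x)).

Lemma boxed_L1 B F : boxed B F ->
  [/\ forall x, L1 (F x), L1 (fun x => intR (F x)) &
      intR2 F = intR2 (fun x y => F y x)].
Proof.
move=> [mF [K FK]].
have Lu : L1 (fun x : R => K * \1_`[-B, B] x) by apply: L1Z; exact: L1_itv.
have Lv := L1_itv (- B) B.
split.
- exact: (fubini_slice mF Lv FK).
- exact: (fubini_L1 mF Lu Lv FK).
- exact: (fubini_swap mF Lu Lv FK).
Qed.

Lemma intR2D B F G : boxed B F -> boxed B G ->
  intR2 (fun x y => F x y + G x y) = intR2 F + intR2 G.
Proof.
move=> /boxed_L1[Fx F1 _] /boxed_L1[Gx G1 _].
by rewrite /intR2 -intRD//; apply: eq_intR => x; rewrite intRD.
Qed.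

Lemma intR2Z B k F : boxed B F -> intR2 (fun x y => k * F x y) = k * intR2 F.
Proof.
move=> /boxed_L1[Fx F1 _].
by rewrite /intR2 -intRZ//; apply: eq_intR => x; rewrite intRZ.
Qed.

Lemma intR2_le B F G : boxed B F -> boxed B G ->
  (forall x y, F x y <= G x y) -> intR2 F <= intR2 G.
Proof.
move=> /boxed_L1[Fx F1 _] /boxed_L1[Gx G1 _] FG.
by apply: intR_le => // x; exact: intR_le.
Qed.

Lemma eq_intR2 F G : (forall x y, F x y = G x y) -> intR2 F = intR2 G.
Proof. by move=> FG; apply: eq_intR => x; exact: eq_intR. Qed.

Lemma boxedP B F (K : R) :
  measurable_fun [set: R * R] (fun p => F p.1 p.2) ->
  (forall x y, `|F x y| <= K) ->
  boxed B (fun x y => \1_`[-B, B] x * \1_`[-B, B] y * F x y).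
Proof.
move=> mF FK; split; last first.
  exists K => x y; rewrite normrM ger0_norm ?mulr_ge0// ?indicE//.
  by rewrite mulrC -mulrA ler_wpM2r ?mulr_ge0.
have mchi : measurable_fun [set: R] (\1_`[-B, B] : R -> R).
  exact: measurable_indic.
apply: measurable_funM => //; apply: measurable_funM.
  exact: measurableT_comp mchi measurable_fst.
exact: measurableT_comp mchi measurable_snd.
Qed.

End BoxedDoubleIntegrals.

(** * The quadratic form of the Poisson kernel *)

Section PoissonForm.
Context {R : realType}.
Implicit Types (f g : R -> R) (x y B M L de : R).

(** Poisson kernel without the factor [1 / pi], so of total mass [pi]; this is the value found in
    [intR_abel_cos]. *)
Definition poisson de u : R := de / (de ^+ 2 + u ^+ 2).

Lemma poisson_den de u : 0 < de -> 0 < de ^+ 2 + u ^+ 2.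
Proof. by move=> d0; rewrite ltr_pwDl ?exprn_gt0// sqr_ge0. Qed.

Lemma poisson_ge0 de u : 0 < de -> 0 <= poisson de u.
Proof. by move=> d0; rewrite divr_ge0 ?ltW// poisson_den. Qed.

Lemma poisson_le de u : 0 < de -> poisson de u <= de^-1.
Proof.
move=> d0; rewrite ler_pdivrMr ?poisson_den// mulrC ler_pdivlMr//.
by rewrite -expr2 lerDl sqr_ge0.
Qed.

(** Absorbs the factor [(x - y) ^+ 2] produced by a Lipschitz bound on [(f x - f y) ^+ 2], which
    leaves an error of order [de]. *)
Lemma poisson_sqr_le de u : 0 < de -> u ^+ 2 * poisson de u <= de.
Proof.
move=> d0; rewrite mulrA ler_pdivrMr ?poisson_den// mulrC ler_wpM2l ?(ltW d0)//.
by rewrite lerDr sqr_ge0.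
Qed.

Lemma poissonB de x y : poisson de (x - y) = poisson de (y - x).
Proof. by rewrite /poisson -(sqrrN (x - y)) opprB. Qed.

Lemma continuous_poisson de : 0 < de -> continuous (poisson de).
Proof.
move=> d0; apply: (derive_continuous (df := fun u =>
  de * (- (0 + 2%:R * u ^+ 2.-1) / (de ^+ 2 + u ^+ 2) ^+ 2))) => u.
apply: is_derive_fZ; apply: (@is_derive_fV _ (fun u => de ^+ 2 + u ^+ 2)).
  by rewrite gt_eqF// poisson_den.
exact: is_derive_fD (is_derive_fcst _ _) (is_derive_fX _ _).
Qed.

Lemma poisson_mass de B x : 0 < de -> 0 <= B ->
  L1 (fun y => \1_`[-B, B] y * poisson de (x - y)) /\
  intR (fun y => \1_`[-B, B] y * poisson de (x - y)) =
  atan ((x + B) / de) - atan ((x - B) / de).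
Proof.
move=> d0 B0; have B0' : - B <= B by lra.
have := @intR_FTC R (fun y => poisson de (x - y)) (fun y => - atan ((x - y) / de))
  (- B) B B0'.
case=> [t _|t _|L ->]; last by rewrite opprK opprK addrC.
- apply: (is_derive_val_eq (is_derive_fN (is_derive_fcomp (is_derive1_atan _) (is_derive_fM (is_derive_fB (is_derive_fcst x t) (is_derive_fid t)) (is_derive_fcst de^-1 t))))).
  by rewrite /poisson; field; rewrite !gt_eqF// ?poisson_den// -expr_div_n ltr_pwDl ?sqr_ge0.
- apply: (continuous_comp (f := fun y => x - y)); last exact: continuous_poisson.
  by apply: (derive_continuous (df := fun=> 0 - 1)) => u; apply: is_derive_fB (is_derive_fcst _ _) (is_derive_fid _).
Qed.

Lemma poisson_mass_le de B x : 0 < de -> 0 <= B ->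
  intR (fun y => \1_`[-B, B] y * poisson de (x - y)) <= pi.
Proof.
move=> d0 B0; have [_ ->] := poisson_mass x d0 B0.
have := atan_ltpi2 ((x + B) / de); have := atan_gtNpi2 ((x - B) / de); lra.
Qed.

(** The point [x] is at distance at least [1 >= de] from both ends of [[-B, B]], so each arctangent
    contributes at least [pi / 4]. *)
Lemma poisson_mass_ge de B x : 0 < de -> de <= 1 -> `|x| <= B - 1 ->
  pi / 2 <= intR (fun y => \1_`[-B, B] y * poisson de (x - y)).
Proof.
move=> d0 d1 xB; have B0 : 0 <= B by have := normr_ge0 x; lra.
have [_ ->] := poisson_mass x d0 B0.
move: xB; rewrite ler_norml => /andP[xB1 xB2].
have H1 : atan 1 <= atan ((x + B) / de).
  by apply: le_atan; rewrite ler_pdivlMr//; lra.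
have H2 : atan ((x - B) / de) <= atan (- 1).
  by apply: le_atan; rewrite ler_pdivrMr//; lra.
move: H1 H2; rewrite atanN atan1; lra.
Qed.

Definition poisson_form de f : R :=
  intR (fun x => f x * intR (fun y => f y * poisson de (x - y))).

Section Expansion.
Variables (de B M : R) (f : R -> R).
Hypotheses (d0 : 0 < de) (B0 : 0 <= B).
Hypothesis mf : measurable_fun [set: R] f.
Hypothesis fM : forall x, `|f x| <= M.
Hypothesis fB : forall x, B < `|x| -> f x = 0.

Local Notation chi := (\1_`[-B, B] : R -> R).

Let f_chi x : chi x * f x = f x.
Proof.
rewrite indicE; case: (boolP (x \in _)) => [|/negP xB]; first by rewrite mul1r.
rewrite fB ?mulr0// ltNge; apply/negP; rewrite ler_norml => xB'.
by apply: xB; rewrite inE /= in_itv.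
Qed.

Let mf1 : measurable_fun [set: R * R] (fun p => f p.1).
Proof. exact: measurableT_comp mf measurable_fst. Qed.

Let mf2 : measurable_fun [set: R * R] (fun p => f p.2).
Proof. exact: measurableT_comp mf measurable_snd. Qed.

Let mP : measurable_fun [set: R * R] (fun p => poisson de (p.1 - p.2)).
Proof.
apply: (measurableT_comp (f := poisson de)).
  exact: continuous_measurable_fun (continuous_poisson d0).
exact: measurable_funB measurable_fst measurable_snd.
Qed.

Let M0 : 0 <= M. Proof. exact: le_trans (normr_ge0 _) (fM 0). Qed.

Let P_le u : `|poisson de u| <= de^-1.
Proof. by rewrite ger0_norm ?poisson_ge0// poisson_le. Qed.

Let box1 : boxed B (fun x y => chi x * chi y * (f x * f y * poisson de (x - y))).
Proof.
apply: (@boxedP _ _ _ (M * M * de^-1)).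
  exact: measurable_funM (measurable_funM mf1 mf2) mP.
by move=> x y; rewrite normrM ler_pM// normrM ler_pM.
Qed.

Let box2 : boxed B (fun x y => chi x * chi y * (f x ^+ 2 * poisson de (x - y))).
Proof.
apply: (@boxedP _ _ _ (M ^+ 2 * de^-1)).
  exact: measurable_funM (measurable_funX 2 mf1) mP.
by move=> x y; rewrite normrM ler_pM// normrX lerXn2r ?nnegrE.
Qed.

Let box3 : boxed B (fun x y => chi x * chi y * (f y ^+ 2 * poisson de (x - y))).
Proof.
apply: (@boxedP _ _ _ (M ^+ 2 * de^-1)).
  exact: measurable_funM (measurable_funX 2 mf2) mP.
by move=> x y; rewrite normrM ler_pM// normrX lerXn2r ?nnegrE.
Qed.

Let box4 :
  boxed B (fun x y => chi x * chi y * ((f x - f y) ^+ 2 * poisson de (x - y))).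
Proof.
apply: (@boxedP _ _ _ ((M + M) ^+ 2 * de^-1)).
  exact: measurable_funM (measurable_funX 2 (measurable_funB mf1 mf2)) mP.
move=> x y; rewrite normrM ler_pM// normrX lerXn2r ?nnegrE ?addr_ge0//.
by rewrite (le_trans (ler_normB _ _))// lerD.
Qed.

(* f(x) f(y) = (f(x)^2 + f(y)^2 - (f(x) - f(y))^2) / 2; the diagonal part is
   comparable with the L2 norm and the last square vanishes as de tends to 0. *)
Let diagonal : R :=
  intR (fun x => f x ^+ 2 * intR (fun y => chi y * poisson de (x - y))).

Lemma poisson_form_expand : poisson_form de f = diagonal -
  2^-1 * intR2 (fun x y => chi x * chi y * ((f x - f y) ^+ 2 * poisson de (x - y))).
Proof.
have E1 : poisson_form de f =
    intR2 (fun x y => chi x * chi y * (f x * f y * poisson de (x - y))).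
  rewrite /intR2; apply: eq_intR => x.
  have Lp := (poisson_mass x d0 B0).1.
  rewrite -intRZ; last first.
    have := @L1_mul_bounded _ _ f M Lp mf fM.
    congr L1; apply/funext => y.
    by rewrite mulrAC f_chi.
  by apply: eq_intR => y; rewrite -[in LHS](f_chi x) -[in LHS](f_chi y); ring.
have E2 : diagonal = intR2 (fun x y => chi x * chi y * (f x ^+ 2 * poisson de (x - y))).
  rewrite /intR2; apply: eq_intR => x.
  have Lp := (poisson_mass x d0 B0).1.
  rewrite -intRZ//; apply: eq_intR => y.
  rewrite -[in LHS](f_chi x) indicE; case: (x \in _) => /=; last by ring.
  by ring.
have E3 : diagonal = intR2 (fun x y => chi x * chi y * (f y ^+ 2 * poisson de (x - y))).
  rewrite E2; have [_ _ ->] := boxed_L1 box2; apply: eq_intR2 => x y.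
  by rewrite poissonB (mulrC (chi x)).
have E4 : intR2 (fun x y => chi x * chi y * ((f x - f y) ^+ 2 * poisson de (x - y)))
    + 2 * poisson_form de f = diagonal + diagonal.
  rewrite {1}E2 E3 E1 -(intR2D box2 box3) -(intR2Z 2 box1).
  have box1' : boxed B (fun x y => 2 * (chi x * chi y * (f x * f y * poisson de (x - y)))).
    case: box1 => mF [K FK]; split; first by apply: measurable_funM.
    exists (2 * K) => x y; rewrite normrM ger0_norm// -!mulrA ler_pM2l// !mulrA.
    by have := FK x y; rewrite !mulrA.
  by rewrite -(intR2D box4 box1'); apply: eq_intR2 => x y; ring.
lra.
Qed.

Let Lf2 : L1 (fun x => f x ^+ 2).
Proof.
apply: (@L1_bounded_support _ _ B (M ^+ 2)); first exact: measurable_funX 2 mf.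
  by move=> x; rewrite normrX lerXn2r ?nnegrE.
by move=> x /fB ->; rewrite expr0n.
Qed.

Let Ldiag :
  L1 (fun x => f x ^+ 2 * intR (fun y => chi y * poisson de (x - y))).
Proof.
have [_ + _] := boxed_L1 box2; congr L1; apply/funext => x.
rewrite -intRZ; last exact: (poisson_mass x d0 B0).1.
apply: eq_intR => y.
rewrite -[in RHS](f_chi x) indicE; case: (x \in _) => /=; last by ring.
by ring.
Qed.

(** The squared difference enters the expansion with a negative sign and is dropped; the diagonal
    weight is at most the total mass [pi]. *)
Lemma poisson_form_le : poisson_form de f <= pi * intR (fun x => f x ^+ 2).
Proof.
rewrite poisson_form_expand -intRZ//.
apply: (@le_trans _ _ diagonal).
  rewrite gerBl mulr_ge0// /intR2 intR_ge0// => x; apply: intR_ge0 => y.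
  apply: mulr_ge0; first by apply: mulr_ge0; rewrite indicE.
  by apply: mulr_ge0; [exact: sqr_ge0|exact: poisson_ge0].
apply: intR_le => //; first exact: L1Z.
by move=> x; rewrite mulrC ler_wpM2r ?sqr_ge0// poisson_mass_le.
Qed.

(** The margin 1 between the support and the ends of [[-B, B]] gives the diagonal weight its lower
    bound [pi / 2]. The error is half of [L ^+ 2 * de] times the area [(2 * B) ^+ 2] of the box. *)
Lemma poisson_form_ge (L : R) : de <= 1 ->
  (forall x, B - 1 < `|x| -> f x = 0) ->
  (forall x y, `|f x - f y| <= L * `|x - y|) ->
  pi / 2 * intR (fun x => f x ^+ 2) - 2 * B ^+ 2 * L ^+ 2 * de <= poisson_form de f.
Proof.
move=> d1 fB1 fL; rewrite poisson_form_expand; apply: lerB.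
  rewrite -intRZ//; apply: intR_le => //; first exact: L1Z.
  move=> x; have [xB|xB] := leP `|x| (B - 1); last first.
    by rewrite fB1// expr0n/= mulr0 mul0r.
  by rewrite [leRHS]mulrC ler_wpM2r ?sqr_ge0// poisson_mass_ge.
have mc : intR chi = 2 * B.
  have BB : - B <= B by rewrite -subr_ge0 opprK addr_ge0.
  have [_] := intR_FTC BB (fun t _ => is_derive_fid t) (fun t _ => @cst_continuous R R 1 t).
  have -> : (fun x => \1_`[- B, B] x * 1) = chi.
    by apply/funext => x; rewrite mulr1.
  by move=> ->; rewrite opprK; lra.
apply: (@le_trans _ _ (2^-1 * intR2 (fun x y => chi x * chi y * (L ^+ 2 * de)))).
  rewrite ler_pM2l ?invr_gt0//; apply: (@intR2_le _ B) => //.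
    by apply: (@boxedP _ _ _ `|L ^+ 2 * de|) => // x y.
  move=> x y; rewrite ler_wpM2l ?mulr_ge0 ?indicE//.
  apply: (@le_trans _ _ (L ^+ 2 * (x - y) ^+ 2 * poisson de (x - y))).
    rewrite ler_wpM2r ?poisson_ge0// -exprMn -[leLHS](real_normK (num_real _)).
    rewrite -[leRHS](real_normK (num_real _)) normrM lerXn2r ?nnegrE ?mulr_ge0//.
    by rewrite (le_trans (fL x y))// ler_wpM2r// ler_norm.
  by rewrite -mulrA ler_wpM2l ?sqr_ge0// poisson_sqr_le.
have -> : intR2 (fun x y => chi x * chi y * (L ^+ 2 * de)) =
    (2 * B) * (2 * B) * (L ^+ 2 * de).
  have Lc := L1_itv (- B) B.
  rewrite /intR2; transitivity (intR (fun x => (2 * B * (L ^+ 2 * de)) * chi x)).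
    apply: eq_intR => x.
    transitivity (intR (fun y => (chi x * (L ^+ 2 * de)) * chi y)).
      by apply: eq_intR => y; ring.
    by rewrite intRZ// mc; ring.
  by rewrite intRZ// mc; ring.
lra.
Qed.

End Expansion.

End PoissonForm.

(** * Cosine and sine transforms, and their action on convolutions *)

Section TrigTransforms.
Context {R : realType}.
Implicit Types (f k w T : R -> R) (x y t xi : R).

Definition trig_transform T f xi : R := intR (fun x => f x * T (x * xi)).

Definition convR k f x : R := intR (fun t => k t * f (x - t)).

Lemma measurable_mul2 : measurable_fun [set: R * R] (fun p => p.1 * p.2).
Proof. exact: measurable_funM measurable_fst measurable_snd. Qed.

Section SquaredTransform.
Variables (T w f : R -> R).
Hypotheses (mT : measurable_fun [set: R] T) (T1 : forall u, `|T u| <= 1).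
Hypotheses (Lw : L1 w) (Lf : L1 f).

Let mT1 x : measurable_fun [set: R] (fun y => T (x * y)).
Proof. by apply: (measurableT_comp mT); exact: measurable_funM. Qed.

Let mT2 x : measurable_fun [set: R] (fun y => T (y * x)).
Proof. by apply: (measurableT_comp mT); exact: measurable_funM. Qed.

Let mT12 : measurable_fun [set: R * R] (fun p => T (p.1 * p.2)).
Proof. exact: measurableT_comp mT measurable_mul2. Qed.

Let mT21 : measurable_fun [set: R * R] (fun p => T (p.2 * p.1)).
Proof.
apply: (measurableT_comp mT).
exact: measurable_funM measurable_snd measurable_fst.
Qed.

Let m1 (h : R -> R) : L1 h -> measurable_fun [set: R * R] (fun p => h p.1).
Proof. by move=> /L1_measurable mh; exact: measurableT_comp mh measurable_fst. Qed.

Let m2 (h : R -> R) : L1 h -> measurable_fun [set: R * R] (fun p => h p.2).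
Proof. by move=> /L1_measurable mh; exact: measurableT_comp mh measurable_snd. Qed.

Let LfT xi : L1 (fun x => f x * T (x * xi)).
Proof. exact: L1_mul_bounded Lf (mT2 xi) (fun=> T1 _). Qed.

Let mul_T_le (a b t : R) : `|a * (b * T t)| <= `|a| * `|b|.
Proof. by rewrite normrM ler_wpM2l// normrM ler_piMr. Qed.

Let wh xi : R := w xi * trig_transform T f xi.

Let Lwh : L1 wh.
Proof.
have mF : measurable_fun [set: R * R] (fun p => w p.1 * (f p.2 * T (p.2 * p.1))).
  exact: measurable_funM (m1 Lw) (measurable_funM (m2 Lf) mT21).
have := @fubini_L1 _ (fun xi x => w xi * (f x * T (x * xi))) _ _ mF (L1abs Lw)
  (L1abs Lf) (fun _ _ => mul_T_le _ _ _).
by congr L1; apply/funext => xi; rewrite /wh /trig_transform intRZ.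
Qed.

Let kernelT x y : R := intR (fun xi => w xi * (T (x * xi) * T (y * xi))).

Let whE x : intR (fun xi => wh xi * T (x * xi)) = intR (fun y => f y * kernelT x y)
  /\ L1 (fun y => f y * kernelT x y).
Proof.
have LTT y : L1 (fun xi => w xi * (T (x * xi) * T (y * xi))).
  apply: (@L1_mul_bounded _ _ _ 1 Lw); first exact: measurable_funM.
  by move=> xi; rewrite normrM mulr_ile1.
have mF : measurable_fun [set: R * R]
    (fun p => f p.1 * (w p.2 * (T (x * p.2) * T (p.1 * p.2)))).
  apply: measurable_funM; first exact: m1.
  apply: measurable_funM; first exact: m2.
  by apply: measurable_funM => //; exact: (measurableT_comp (mT1 x) measurable_snd).
have FB y xi : `|f y * (w xi * (T (x * xi) * T (y * xi)))| <= `|f y| * `|w xi|.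
  by rewrite normrM ler_wpM2l// normrM ler_piMr// normrM mulr_ile1.
split.
  have := @fubini_swap _ (fun y xi => f y * (w xi * (T (x * xi) * T (y * xi))))
    _ _ mF (L1abs Lf) (L1abs Lw) FB.
  under eq_intR do rewrite intRZ//.
  move=> ->; apply: eq_intR => xi.
  rewrite /wh /trig_transform mulrAC -intRZ//; apply: eq_intR => y; ring.
have := @fubini_L1 _ (fun y xi => f y * (w xi * (T (x * xi) * T (y * xi))))
    _ _ mF (L1abs Lf) (L1abs Lw) FB.
by congr L1; apply/funext => y; rewrite intRZ.
Qed.

(** The square is opened one factor at a time: [wh], the weight times one transform, is itself
    integrable, so two applications of Fubini to double integrals replace a triple integral. *)
Lemma weighted_transform_sqr :
  [/\ L1 (fun xi => w xi * trig_transform T f xi ^+ 2),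
      L1 (fun x => f x * intR (fun y => f y * kernelT x y)),
      forall x, L1 (fun y => f y * kernelT x y) &
      intR (fun xi => w xi * trig_transform T f xi ^+ 2) =
      intR (fun x => f x * intR (fun y => f y * kernelT x y))].
Proof.
have mF : measurable_fun [set: R * R] (fun p => wh p.1 * (f p.2 * T (p.2 * p.1))).
  exact: measurable_funM (m1 Lwh) (measurable_funM (m2 Lf) mT21).
have mF' : measurable_fun [set: R * R] (fun p => f p.1 * (wh p.2 * T (p.1 * p.2))).
  exact: measurable_funM (m1 Lf) (measurable_funM (m2 Lwh) mT12).
have LwT x : L1 (fun xi => wh xi * T (x * xi)).
  exact: L1_mul_bounded Lwh (mT1 x) (fun=> T1 _).
have E1 : (fun xi => w xi * trig_transform T f xi ^+ 2) =
    (fun xi => intR (fun x => wh xi * (f x * T (x * xi)))).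
  by apply/funext => xi; rewrite intRZ// expr2 mulrA.
have E2 : (fun x => f x * intR (fun y => f y * kernelT x y)) =
    (fun x => intR (fun xi => f x * (wh xi * T (x * xi)))).
  by apply/funext => x; rewrite intRZ// (whE x).1.
rewrite E1 E2; split.
- exact: (@fubini_L1 _ (fun xi x => wh xi * (f x * T (x * xi))) _ _ mF
    (L1abs Lwh) (L1abs Lf) (fun _ _ => mul_T_le _ _ _)).
- exact: (@fubini_L1 _ (fun x xi => f x * (wh xi * T (x * xi))) _ _ mF'
    (L1abs Lf) (L1abs Lwh) (fun _ _ => mul_T_le _ _ _)).
- by move=> x; exact: (whE x).2.
- apply: etrans (@fubini_swap _ (fun xi x => wh xi * (f x * T (x * xi))) _ _ mF
    (L1abs Lwh) (L1abs Lf) (fun _ _ => mul_T_le _ _ _)) _.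
  by apply: eq_intR => x; apply: eq_intR => xi; ring.
Qed.

End SquaredTransform.

Lemma measurable_cosR : measurable_fun [set: R] (@cos R).
Proof. by apply: continuous_measurable_fun; exact: continuous_cos. Qed.

Lemma measurable_sinR : measurable_fun [set: R] (@sin R).
Proof. by apply: continuous_measurable_fun; exact: continuous_sin. Qed.

(** The two transforms combine through [cos (x xi) cos (y xi) + sin (x xi) sin (y xi) = cos ((x - y)
    xi)], whose weighted integral is the Poisson kernel. *)
Lemma abel_parseval (de : R) f : 0 < de -> L1 f ->
  L1 (fun xi => abel_weight de xi *
    (trig_transform cos f xi ^+ 2 + trig_transform sin f xi ^+ 2)) /\
  intR (fun xi => abel_weight de xi *
    (trig_transform cos f xi ^+ 2 + trig_transform sin f xi ^+ 2)) =
  poisson_form de f.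
Proof.
move=> d0 Lf; have Lw := L1_abel_weight d0.
have [Lc Lc1 Lc2 Ec] :=
  @weighted_transform_sqr cos _ f measurable_cosR (@cos_max R) Lw Lf.
have [Ls Ls1 Ls2 Es] :=
  @weighted_transform_sqr sin _ f measurable_sinR (@sin_max R) Lw Lf.
under eq_fun do rewrite mulrDr.
split; first exact: L1D.
rewrite intRD// Ec Es -intRD//; apply: eq_intR => x.
rewrite -mulrDr -intRD//; congr (_ * _); apply: eq_intR => y.
rewrite -mulrDr; congr (_ * _).
have LTT (T : R -> R) : measurable_fun [set: R] T -> (forall u, `|T u| <= 1) ->
    L1 (fun xi => abel_weight de xi * (T (x * xi) * T (y * xi))).
  move=> mT T1; apply: (@L1_mul_bounded _ _ _ 1 Lw).
    by apply: measurable_funM; apply: (measurableT_comp mT); exact: measurable_funM.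
  by move=> xi; rewrite normrM mulr_ile1.
rewrite -intRD; [|exact: LTT measurable_cosR (@cos_max R)|
  exact: LTT measurable_sinR (@sin_max R)].
rewrite /poisson -(intR_abel_cos (x - y) d0); apply: eq_intR => xi.
by rewrite -mulrDr mulrBl cosB.
Qed.

Section Convolution.
Variables (k f : R -> R) (A N M L : R).
Hypotheses (Lk : L1 k) (kN : forall t, N < `|t| -> k t = 0).
Hypotheses (fA : forall x, A < `|x| -> f x = 0) (fM : forall x, `|f x| <= M).
Hypothesis fL : forall x y, `|f x - f y| <= L * `|x - y|.

Lemma lipschitz_continuous (g : R -> R) (K : R) :
  (forall x y, `|g x - g y| <= K * `|x - y|) -> continuous g.
Proof.
move=> gK x; apply/cvgrPdist_le => e e0; pose K' : R := `|K| + 1.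
have K'0 : 0 < K' by rewrite ltr_pwDr.
have eK : 0 < e / K' by rewrite divr_gt0.
have /cvgrPdist_le/(_ _ eK) : y @[y --> (x : R)] --> (x : R) by exact: cvg_id.
apply: filterS => y xy; rewrite (le_trans (gK x y))//.
apply: (@le_trans _ _ (K' * `|x - y|)); last by rewrite mulrC -ler_pdivlMr.
by rewrite ler_wpM2r// (le_trans (ler_norm K))// lerDl.
Qed.

Let mf : measurable_fun [set: R] f.
Proof. exact: continuous_measurable_fun (lipschitz_continuous fL). Qed.

Let mfx x : measurable_fun [set: R] (fun t => f (x - t)).
Proof. by apply: (measurableT_comp mf); exact: measurable_funB. Qed.

Let M0 : 0 <= M. Proof. exact: le_trans (normr_ge0 _) (fM 0). Qed.

Let Lkf x : L1 (fun t => k t * f (x - t)).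
Proof. exact: L1_mul_bounded Lk (mfx x) (fun=> fM _). Qed.

Lemma convR_support x : A + N < `|x| -> convR k f x = 0.
Proof.
move=> xAN; rewrite /convR (@eq_intR _ _ (fun=> 0)); last first.
  move=> t; have [tN|/kN->] := leP `|t| N; last by rewrite mul0r.
  rewrite fA ?mulr0//; have := ler_normD (x - t) t; rewrite subrK; lra.
exact: intR0.
Qed.

Lemma convR_bounded x : `|convR k f x| <= M * intR (fun t => `|k t|).
Proof.
rewrite -intRZ; last exact: L1abs.
apply: intR_norm_le; first exact: L1_measurable.
- by apply: L1Z; exact: L1abs.
- by move=> t; rewrite normrM mulrC ler_wpM2r.
Qed.

Lemma convR_lipschitz x y :
  `|convR k f x - convR k f y| <= L * intR (fun t => `|k t|) * `|x - y|.
Proof.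
rewrite /convR -intRB// mulrAC -intRZ; last exact: L1abs.
apply: intR_norm_le; first by apply: L1_measurable; exact: L1B.
- by apply: L1Z; exact: L1abs.
- move=> t; rewrite -mulrBr normrM mulrC ler_wpM2r//.
  rewrite (le_trans (fL _ _))//; have -> : x - t - (y - t) = x - y by ring.
  by [].
Qed.

Let Lf : L1 f.
Proof. exact: L1_bounded_support mf fM fA. Qed.

Let Lfc xi : L1 (fun x => f x * cos (x * xi)).
Proof.
apply: (@L1_mul_bounded _ _ _ 1) => //; last by move=> x; exact: cos_max.
by apply: (measurableT_comp measurable_cosR); exact: measurable_funM.
Qed.

Let Lfs xi : L1 (fun x => f x * sin (x * xi)).
Proof.
apply: (@L1_mul_bounded _ _ _ 1) => //; last by move=> x; exact: sin_max.
by apply: (measurableT_comp measurable_sinR); exact: measurable_funM.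
Qed.

(** Fubini followed by the translation [x = y + t]. The supports of [k] and [f] confine [x] to
    [[-(A + N), A + N]], which supplies the integrable majorant. *)
Let transform_convR (T : R -> R) xi : measurable_fun [set: R] T ->
  (forall u, `|T u| <= 1) ->
  trig_transform T (convR k f) xi =
  intR (fun t => k t * intR (fun y => f y * T ((y + t) * xi))).
Proof.
move=> mT T1; pose B := A + N.
pose F x t := k t * (f (x - t) * T (x * xi)).
have mTx : measurable_fun [set: R] (fun x => T (x * xi)).
  by apply: (measurableT_comp mT); exact: measurable_funM.
have mF : measurable_fun [set: R * R] (fun p => F p.1 p.2).
  apply: measurable_funM.
    exact: measurableT_comp (L1_measurable Lk) measurable_snd.
  apply: measurable_funM; last exact: (measurableT_comp mTx measurable_fst).
  apply: (measurableT_comp mf).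
  exact: measurable_funB measurable_fst measurable_snd.
have FB x t : `|F x t| <= (M * \1_`[-B, B] x) * `|k t|.
  rewrite /F normrM mulrC; have [tN|/kN ->] := leP `|t| N; last first.
    by rewrite normr0 !mulr0.
  rewrite ler_wpM2r// indicE; case: (boolP (x \in _)) => [_|/negP xB].
    by rewrite mulr1 normrM -[M]mulr1 ler_pM.
  rewrite fA ?mul0r ?normr0 ?mulr0// ltNge; apply/negP => xt.
  apply: xB; rewrite inE /= in_itv /= -ler_norml.
  by have := ler_normD (x - t) t; rewrite subrK /B; lra.
have LB : L1 (fun x => M * \1_`[-B, B] x) by apply: L1Z; exact: L1_itv.
transitivity (intR (fun x => intR (F x))).
  apply: eq_intR => x; rewrite mulrC /convR -intRZ//.
  by apply: eq_intR => t; rewrite /F; ring.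
rewrite (fubini_swap mF LB (L1abs Lk) FB); apply: eq_intR => t; rewrite /F.
have mfT : measurable_fun [set: R] (fun y => f y * T ((y + t) * xi)).
  apply: measurable_funM => //; apply: (measurableT_comp mTx (g := fun y => y + t)).
  exact: measurable_funD.
rewrite -(intR_shift (- t) mfT) -intRZ; last first.
  apply: (L1_shift (- t) (f := fun y => f y * T ((y + t) * xi))).
  apply: (@L1_mul_bounded _ _ _ 1) => //.
  apply: (measurableT_comp mTx (g := fun y => y + t)).
  exact: measurable_funD.
by apply: eq_intR => x; rewrite subrK.
Qed.

Let LkT (T : R -> R) xi : measurable_fun [set: R] T -> (forall u, `|T u| <= 1) ->
  L1 (fun t => k t * T (t * xi)).
Proof.
move=> mT T1; apply: (@L1_mul_bounded _ _ _ 1) => //.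
by apply: (measurableT_comp mT); exact: measurable_funM.
Qed.

(** Addition formula under the inner integral of [transform_convR]; together with its sine companion
    it says that the transforms multiply like complex numbers. *)
Lemma cos_transform_convR xi : trig_transform cos (convR k f) xi =
  trig_transform cos k xi * trig_transform cos f xi -
  trig_transform sin k xi * trig_transform sin f xi.
Proof.
rewrite (transform_convR _ measurable_cosR (@cos_max R)).
rewrite mulrC [X in _ - X]mulrC -!intRZ; try exact: LkT measurable_cosR (@cos_max R);
  try exact: LkT measurable_sinR (@sin_max R).
rewrite -intRB; try by apply: L1Z; exact: LkT measurable_cosR (@cos_max R).
  apply: eq_intR => t.
  transitivity (k t * (cos (t * xi) * trig_transform cos f xi -
      sin (t * xi) * trig_transform sin f xi)); last by ring.
  congr (_ * _); rewrite -!intRZ// -intRB; try by apply: L1Z.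
  by apply: eq_intR => y; rewrite mulrDl cosD; ring.
by apply: L1Z; exact: LkT measurable_sinR (@sin_max R).
Qed.

Lemma sin_transform_convR xi : trig_transform sin (convR k f) xi =
  trig_transform cos k xi * trig_transform sin f xi +
  trig_transform sin k xi * trig_transform cos f xi.
Proof.
rewrite (transform_convR _ measurable_sinR (@sin_max R)).
rewrite mulrC [X in _ + X]mulrC -!intRZ; try exact: LkT measurable_cosR (@cos_max R);
  try exact: LkT measurable_sinR (@sin_max R).
rewrite -intRD; try by apply: L1Z; exact: LkT measurable_cosR (@cos_max R).
  apply: eq_intR => t.
  transitivity (k t * (cos (t * xi) * trig_transform sin f xi +
      sin (t * xi) * trig_transform cos f xi)); last by ring.
  congr (_ * _); rewrite -!intRZ// -intRD; try by apply: L1Z.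
  by apply: eq_intR => y; rewrite mulrDl sinD; ring.
by apply: L1Z; exact: LkT measurable_sinR (@sin_max R).
Qed.

(** The multiplier has squared modulus at most [2 * C ^+ 2]; comparing Poisson forms with energies
    from both sides loses the further factor [pi / (pi / 2) = 2]. *)
Lemma convR_L2_bound (C : R) : 0 <= A -> 0 <= N ->
  (forall xi, `|trig_transform cos k xi| <= C) ->
  (forall xi, `|trig_transform sin k xi| <= C) ->
  intR (fun x => convR k f x ^+ 2) <= 4 * C ^+ 2 * intR (fun x => f x ^+ 2).
Proof.
(* The extra 1 in [B] is the support margin required by [poisson_form_ge]. *)
move=> A0 N0 kc ks; set g := convR k f; pose B := A + N + 1.
pose L' := L * intR (fun t => `|k t|); pose M' := M * intR (fun t => `|k t|).
have B0 : 0 <= B by rewrite !addr_ge0.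
have gL x y : `|g x - g y| <= L' * `|x - y| := convR_lipschitz x y.
have mg : measurable_fun [set: R] g.
  exact: continuous_measurable_fun (lipschitz_continuous gL).
have gM x : `|g x| <= M' := convR_bounded x.
have gB1 x : B - 1 < `|x| -> g x = 0.
  by rewrite /B addrK; exact: convR_support.
have gB x : B < `|x| -> g x = 0.
  by move=> xB; apply: gB1; lra.
have fB x : B < `|x| -> f x = 0.
  by move=> xB; apply: fA; rewrite (le_lt_trans _ xB)// /B; lra.
have Lg : L1 g := L1_bounded_support mg gM gB.
have forms de : 0 < de -> poisson_form de g <= 2 * C ^+ 2 * poisson_form de f.
  move=> d0; have [Lg' <-] := abel_parseval d0 Lg.
  have [Lf' <-] := abel_parseval d0 Lf.
  rewrite -intRZ//; apply: intR_le => //; first exact: L1Z.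
  move=> xi; rewrite mulrCA ler_wpM2l ?abel_weight_ge0//.
  rewrite cos_transform_convR sin_transform_convR.
  have := kc xi; have := ks xi.
  move: (trig_transform cos k xi) (trig_transform sin k xi) => a b bC aC.
  move: (trig_transform cos f xi) (trig_transform sin f xi) => p q.
  have -> : (a * p - b * q) ^+ 2 + (a * q + b * p) ^+ 2 =
    (a ^+ 2 + b ^+ 2) * (p ^+ 2 + q ^+ 2) by ring.
  rewrite ler_wpM2r ?addr_ge0 ?sqr_ge0//.
  have sq (c : R) : `|c| <= C -> c ^+ 2 <= C ^+ 2.
    move=> cC; rewrite -(real_normK (num_real c)) lerXn2r ?nnegrE//.
    exact: le_trans cC.
  by have := sq _ aC; have := sq _ bC; lra.
have main de : 0 < de -> de <= 1 -> pi / 2 * intR (fun x => g x ^+ 2) <=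
    2 * C ^+ 2 * pi * intR (fun x => f x ^+ 2) + 2 * B ^+ 2 * L' ^+ 2 * de.
  move=> d0 d1; have := poisson_form_ge d0 B0 mg gM gB d1 gB1 gL.
  have := poisson_form_le d0 B0 mf fM fB; have := forms de d0.
  have C2 : 0 <= 2 * C ^+ 2 by rewrite mulr_ge0// sqr_ge0.
  move=> H1 /(ler_wpM2l C2); lra.
have {main} : pi / 2 * intR (fun x => g x ^+ 2) <=
    2 * C ^+ 2 * pi * intR (fun x => f x ^+ 2).
  (* [B] and [L'] do not depend on [de], so the error disappears as [de] tends to 0. *)
  apply/ler_addgt0Pr => e e0.
  pose K := 2 * B ^+ 2 * L' ^+ 2 + 1.
  have K1 : 1 <= K.
    by rewrite lerDr; apply: mulr_ge0 (sqr_ge0 _); exact: mulr_ge0 (sqr_ge0 _).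
  have d0 : 0 < Num.min 1 (e / K).
    rewrite lt_min ltr01 divr_gt0//; exact: lt_le_trans K1.
  apply: le_trans (main _ d0 _) _; first by rewrite ge_min lexx.
  rewrite lerD2l; apply: (@le_trans _ _ (K * Num.min 1 (e / K))).
    by rewrite ler_wpM2r ?(ltW d0)// lerDl.
  have K0 : 0 < K by exact: lt_le_trans K1.
  by rewrite mulrC -ler_pdivlMr// ge_min lexx orbT.
have pi0 := pi_gt0 R => H.
rewrite -(ler_pM2l (_ : 0 < pi / 2)) ?divr_gt0//; apply: le_trans H _.
lra.
Qed.

End Convolution.

End TrigTransforms.

(** * Truncated Hilbert kernels *)

Section SparsePhase.
Context {R : realType}.
Implicit Types (s : seq (R * nat)) (a b t th xi eps : R).

Definition sparse s t : R := \sum_(p <- s) p.1 * t ^+ p.2.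

(** Exponents may repeat and coefficients may vanish in [s], whereas [osc_bound] wants distinct
    exponents with nonzero coefficients. Merging equal exponents and discarding zeros does not
    lengthen the list. *)
Lemma sparse_normal_form s : (forall p, p \in s -> (0 < p.2)%N) ->
  exists (S : seq nat) (c : nat -> R),
    [/\ uniq S, (size S <= size s)%N,
        forall k, k \in S -> (0 < k)%N /\ c k != 0 &
        forall th t, th + sparse s t = phase th c S t].
Proof.
move=> s0; pose c k := \sum_(p <- s | p.2 == k) p.1.
pose S0 := undup [seq p.2 | p <- s].
exists [seq k <- S0 | c k != 0], c; split.
- by rewrite filter_uniq// undup_uniq.
- rewrite size_filter (leq_trans (count_size _ _))// (leq_trans (size_undup _))//.
  by rewrite size_map.
- move=> k; rewrite mem_filter mem_undup => /andP[ck /mapP[p ps kp]].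
  by split => //; rewrite kp; exact: s0.
move=> th t; congr (_ + _); rewrite big_filter.
have -> : \sum_(k <- S0 | c k != 0) c k * t ^+ k = \sum_(k <- S0) c k * t ^+ k.
  rewrite [RHS](bigID (fun k => c k != 0))/= [X in _ + X]big1 ?addr0// => k.
  by rewrite negbK => /eqP ->; rewrite mul0r.
transitivity (\sum_(k <- S0) \sum_(p <- s | p.2 == k) p.1 * t ^+ p.2); last first.
  apply: eq_bigr => k _; rewrite /c mulr_suml.
  by apply: eq_bigr => p /eqP ->.
rewrite (exchange_big_dep xpredT)//= /sparse big_seq [RHS]big_seq.
apply: eq_bigr => p ps; rewrite (big_rem p.2) /=; last first.
  by rewrite mem_undup map_f.
rewrite eqxx big_seq_cond big1 ?addr0// => k /andP[].
by rewrite mem_rem_uniq ?undup_uniq// inE => /andP[/negPf kp _]; rewrite eq_sym kp.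
Qed.

Lemma derive_sparse s th t : exists l : R, is_derive t 1 (fun t => th + sparse s t) l.
Proof.
exists (0 + \sum_(p <- s) p.1 * (p.2%:R * t ^+ p.2.-1)).
apply: is_derive_fD (is_derive_fcst _ _) _.
by apply: (@is_derive_fsum R _ s (fun p t => p.1 * t ^+ p.2)
  (fun p t => p.1 * (p.2%:R * t ^+ p.2.-1))) => p; apply: is_derive_fZ; exact: is_derive_fX.
Qed.

Lemma continuous_derivable_at (f : R -> R) (x l : R) :
  is_derive x 1 f l -> {for x, continuous f}.
Proof. by move=> [df _]; apply/differentiable_continuous/derivable1_diffP. Qed.

Definition osc_phase s th t : R :=
  (cos (th + sparse s t) - cos (th + sparse s (- t))) / t.

Lemma continuous_osc_phase s th t : t != 0 -> {for t, continuous (osc_phase s th)}.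
Proof.
move=> t0; have [l dl] := derive_sparse s th t; have [l' dl'] := derive_sparse s th (- t).
have d1 := is_derive_fcomp (is_derive_cos _) dl.
have d2 := is_derive_fcomp (is_derive_cos _)
  (@is_derive_fcomp _ (fun t => th + sparse s t) (fun t => - t) _ _ _ dl' (is_derive_fN (is_derive_fid t))).
exact: continuous_derivable_at (is_derive_fM (is_derive_fB d1 d2) (is_derive_fV t0 (is_derive_fid t))).
Qed.

Lemma sparse_osc_bound (n : nat) : exists C : R, forall s th a b,
  (size s <= n)%N -> (forall p, p \in s -> (0 < p.2)%N) -> 0 < a -> a <= b ->
  L1 (fun t => \1_`[a, b] t * osc_phase s th t) /\
  `|intR (fun t => \1_`[a, b] t * osc_phase s th t)| <= C.
Proof.
have [C HC] := @osc_bound R n; exists C => s th a b sn s0 a0 ab.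
pose h := osc_phase s th.
have ch t : 0 < t -> {for t, continuous h}.
  by move=> t0; apply: continuous_osc_phase; rewrite gt_eqF.
(* The primitive starts at [a / 2] so that it has a two-sided derivative at [a] as well; the upper
   end is enlarged to [b + 1] for the same reason. *)
pose X x := \int[lebesgue_measure]_(t in `[a / 2, x]) h t.
have dX0 t : a <= t <= b -> is_derive t 1 X (h t).
  move=> /andP[at_ tb].
  have Lh : lebesgue_measure.-integrable `[a / 2, b + 1] (EFin \o h).
    apply: continuous_compact_integrable; first exact: segment_compact.
    apply: continuous_in_subspaceT => u /set_mem/=; rewrite in_itv /= => /andP[ua _].
    by apply: ch; rewrite (lt_le_trans _ ua)// divr_gt0.
  have tb1 : t < b + 1 by lra.
  have at2 : a / 2 < t by lra.
  have t0 : 0 < t by exact: lt_le_trans at_.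
  have [dX1 X'] := continuous_FTC1_closed tb1 Lh at2 (ch t t0).
  by apply: DeriveDef => //; rewrite -derive1E.
have [Lh ->] := intR_FTC ab dX0 (fun t tab => ch t (lt_le_trans a0 (andP tab).1)).
split => //; have [S [c [uS Ss Sk E]]] := sparse_normal_form s0.
apply: (HC S c th X a b) => //; first exact: leq_trans Ss sn.
by move=> t tab; have := dX0 t tab; rewrite /h /osc_phase /osc_integrand !E.
Qed.

End SparsePhase.

(** * The kernel cut off near the origin and at infinity *)

Section TruncatedKernel.
Context {R : realType}.
Implicit Types (f c : R -> R) (t x eps : R).

(** The condition at 0 makes the decomposition into half-lines hold at every point, so no null set
    has to be removed. *)
Lemma intR_fold (h : R -> R) : L1 h -> h 0 = 0 ->
  L1 (fun t => \1_`]0, +oo[ t * (h t + h (- t))) /\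
  intR h = intR (fun t => \1_`]0, +oo[ t * (h t + h (- t))).
Proof.
move=> Lh h0; have Lhn := L1_opp Lh.
have m1 : measurable_fun [set: R] (\1_`]0, +oo[ : R -> R).
  exact: measurable_indic.
have i1 (u : R) : `|\1_`]0, +oo[ u : R| <= 1.
  by rewrite indicE ger0_norm//; case: (_ \in _).
have Lp : L1 (fun t => \1_`]0, +oo[ t * h t).
  under eq_fun do rewrite mulrC.
  exact: L1_mul_bounded Lh m1 i1.
have Ln : L1 (fun t => \1_`]0, +oo[ t * h (- t)).
  under eq_fun do rewrite mulrC.
  exact: L1_mul_bounded Lhn m1 i1.
under eq_fun do rewrite mulrDr.
split; first exact: L1D.
rewrite intRD// -[X in _ + X]intR_opp; last exact: L1_measurable.
rewrite -intRD//; last first.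
  have := L1_opp Ln; congr L1; by apply/funext.
apply: eq_intR => t; rewrite !indicE !mem_setE !in_itv /= !andbT opprK oppr_gt0.
by case: (ltgtP t 0) => [||->]; rewrite ?mul1r ?mul0r ?addr0 ?add0r// h0 mulr0 addr0.
Qed.

Definition trunc_kernel c (eps N : R) t : R :=
  (\1_`[eps, N] t + \1_`[-N, -eps] t) * (c t / t).

Variables (c : R -> R) (eps N : R).
Hypotheses (e0 : 0 < eps) (eN : eps <= N).
Hypotheses (cc : continuous c) (c1 : forall t, `|c t| <= 1).

Local Notation k := (trunc_kernel c eps N).

Lemma trunc_kernel_support t : N < `|t| -> k t = 0.
Proof.
move=> Nt; rewrite /trunc_kernel !indicE !mem_setE !in_itv /=.
have -> : (eps <= t <= N) = false.
  apply/negP => /andP[et tN]; have t0 : 0 <= t by have := e0; lra.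
  by move: Nt; rewrite ger0_norm// ltNge tN.
have -> : (- N <= t <= - eps) = false.
  apply/negP => /andP[et tN]; have t0 : t <= 0 by have := e0; lra.
  by move: Nt; rewrite ler0_norm// ltrNr ltNge et.
by rewrite addr0 mul0r.
Qed.

Lemma trunc_kernel0 : k 0 = 0.
Proof. by rewrite /trunc_kernel invr0 !mulr0. Qed.

Lemma trunc_kernel_pos t : 0 < t -> k t = \1_`[eps, N] t * (c t / t).
Proof.
move=> t0; rewrite /trunc_kernel !indicE !mem_setE !in_itv /=.
have -> : (- N <= t <= - eps) = false by apply/negP => /andP[et tN]; have := e0; lra.
by rewrite addr0.
Qed.

Lemma trunc_kernel_neg t : 0 < t -> k (- t) = - (\1_`[eps, N] t * (c (- t) / t)).
Proof.
move=> t0; rewrite /trunc_kernel !indicE !mem_setE !in_itv /=.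
have -> : (eps <= - t <= N) = false by apply/negP => /andP[et tN]; have := e0; lra.
by rewrite add0r !lerN2 andbC invrN !mulrN.
Qed.

Lemma L1_trunc_kernel : L1 k.
Proof.
have H a b : 0 < a -> a <= b -> L1 (fun t => \1_`[a, b] t * (c t / t)) /\
    L1 (fun t => \1_`[-b, -a] t * (c t / t)).
  move=> a0 ab; split; apply: (L1_restrict (fun t => c t / t) (measurable_itv _)).1;
    apply: continuous_compact_integrable; try exact: segment_compact;
    apply: continuous_in_subspaceT => u /set_mem/=; rewrite in_itv /= => /andP[u1 u2];
    apply: continuousM; try exact: cc; apply: continuousV => //.
    by rewrite gt_eqF//; apply: lt_le_trans u1.
  by rewrite lt_eqF//; apply: le_lt_trans u2 _; rewrite oppr_lt0.
have [H1 H2] := H eps N e0 eN.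
by have := L1D H1 H2; congr L1; apply/funext => t; rewrite -mulrDl.
Qed.

Lemma intR_trunc_kernel (g : R -> R) (M : R) : measurable_fun [set: R] g ->
  (forall t, `|g t| <= M) ->
  L1 (fun t => \1_`[eps, N] t * ((c t * g t - c (- t) * g (- t)) / t)) /\
  intR (fun t => k t * g t) =
  intR (fun t => \1_`[eps, N] t * ((c t * g t - c (- t) * g (- t)) / t)).
Proof.
move=> mg gM; have Lkg := L1_mul_bounded L1_trunc_kernel mg gM.
have k0 : k 0 * g 0 = 0 by rewrite trunc_kernel0 mul0r.
have [L E] := intR_fold Lkg k0.
have EE : (fun t => \1_`]0, +oo[ t * (k t * g t + k (- t) * g (- t))) =
    (fun t => \1_`[eps, N] t * ((c t * g t - c (- t) * g (- t)) / t)).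
  apply/funext => t; rewrite [\1_`]0, +oo[ t]indicE mem_setE in_itv /= andbT.
  have [t0|t0] := ltP 0 t.
    by rewrite mul1r trunc_kernel_pos// trunc_kernel_neg//; ring.
  rewrite mul0r indicE mem_setE in_itv /=.
  have -> : (eps <= t <= N) = false by apply/negP => /andP[et tN]; have := e0; lra.
  by rewrite mul0r.
by rewrite E EE in L *.
Qed.

End TruncatedKernel.

Section MultiplierBound.
Context {R : realType}.

(* The product-to-sum formulas absorb the frequency into the phase as one more
   monomial. *)
Lemma multiplier_bound (n : nat) : exists C : R,
  forall (s : seq (R * nat)) (th eps N : R),
  (size s <= n)%N -> (forall p, p \in s -> (0 < p.2)%N) -> 0 < eps -> eps <= N ->
  let k := trunc_kernel (fun t => cos (th + sparse s t)) eps N in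
  (forall xi, `|trig_transform cos k xi| <= C) /\
  (forall xi, `|trig_transform sin k xi| <= C).
Proof.
have [C HC] := @sparse_osc_bound R n.+1; exists C => s th eps N sn s0 e0 eN k.
pose c t := cos (th + sparse s t).
have cc : continuous c.
  move=> t; have [l dl] := derive_sparse s th t.
  exact: continuous_derivable_at (is_derive_fcomp (is_derive_cos _) dl).
have c1 t : `|c t| <= 1 by exact: cos_max.
pose s1 xi := (xi, 1%N) :: s.
have s1E xi t : sparse (s1 xi) t = xi * t + sparse s t.
  by rewrite /sparse big_cons /= expr1.
have sparseB th' xi : L1 (fun t => \1_`[eps, N] t * osc_phase (s1 xi) th' t) /\
    `|intR (fun t => \1_`[eps, N] t * osc_phase (s1 xi) th' t)| <= C.
  by apply: HC => // p; rewrite inE => /predU1P[->//|/s0].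
have half (u v : R) : `|u| <= C -> `|v| <= C -> `|2^-1 * u + 2^-1 * v| <= C.
  by rewrite !ler_norml => /andP[? ?] /andP[? ?]; apply/andP; split; lra.
have combine (T : R -> R) xi th1 th2 : measurable_fun [set: R] T ->
    (forall u, `|T u| <= 1) ->
    (forall t, (c t * T (t * xi) - c (- t) * T (- t * xi)) / t =
      2^-1 * osc_phase (s1 xi) th1 t + 2^-1 * osc_phase (s1 (- xi)) th2 t) ->
    `|trig_transform T k xi| <= C.
  move=> mT T1 E.
  have mTx : measurable_fun [set: R] (fun t => T (t * xi)).
    by apply: (measurableT_comp mT); exact: measurable_funM.
  have [_ kE] := intR_trunc_kernel e0 eN cc mTx (fun=> T1 _).
  have [L1a Ba] := sparseB th1 xi; have [L1b Bb] := sparseB th2 (- xi).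
  have -> : trig_transform T k xi =
      2^-1 * intR (fun t => \1_`[eps, N] t * osc_phase (s1 xi) th1 t) +
      2^-1 * intR (fun t => \1_`[eps, N] t * osc_phase (s1 (- xi)) th2 t).
    rewrite -!intRZ// -intRD; try exact: L1Z.
    apply: (etrans kE).
    by apply: eq_intR => t; rewrite E; ring.
  exact: half.
split=> xi.
- apply: (combine cos xi th th measurable_cosR (@cos_max R)) => t.
  rewrite /osc_phase !s1E /c.
  have -> : th + (xi * t + sparse s t) = (th + sparse s t) + t * xi by ring.
  have -> : th + (xi * - t + sparse s (- t)) = (th + sparse s (- t)) + (- t * xi) by ring.
  have -> : th + (- xi * t + sparse s t) = (th + sparse s t) - t * xi by ring.
  have -> : th + (- xi * - t + sparse s (- t)) = (th + sparse s (- t)) - (- t * xi) by ring.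
  move: (th + sparse s t) (th + sparse s (- t)) => u v.
  have [->|t0] := eqVneq t 0; first by rewrite invr0 !mulr0 addr0.
  by rewrite !cosD !cosN !sinN; field.
(* Shifting the angle by [pi / 2] turns sines into cosines: [cos u * sin v] is half the sum of
   [cos (u + v - pi / 2)] and [cos (u - v + pi / 2)]. *)
- apply: (combine sin xi (th - pi / 2) (th + pi / 2) measurable_sinR (@sin_max R)) => t.
  rewrite /osc_phase !s1E /c.
  have -> : th - pi / 2 + (xi * t + sparse s t) = (th + sparse s t) + t * xi - pi / 2 by ring.
  have -> : th - pi / 2 + (xi * - t + sparse s (- t)) = (th + sparse s (- t)) + (- t * xi) - pi / 2 by ring.
  have -> : th + pi / 2 + (- xi * t + sparse s t) = (th + sparse s t) - t * xi + pi / 2 by ring.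
  have -> : th + pi / 2 + (- xi * - t + sparse s (- t)) = (th + sparse s (- t)) - (- t * xi) + pi / 2 by ring.
  move: (th + sparse s t) (th + sparse s (- t)) => u v.
  have [->|t0] := eqVneq t 0; first by rewrite invr0 !mulr0 addr0.
  by rewrite !cosBpihalf !cosDpihalf !sinD !cosN !sinN; field.
Qed.

End MultiplierBound.

(** * The real Hilbert operator on decaying Lipschitz functions *)

Section Energy.
Context {R : realType}.
Local Notation mu := (@lebesgue_measure R).
Implicit Types (f g : R -> R) (x t eps : R).

Definition energy f : \bar R := (\int[mu]_x (f x ^+ 2)%:E)%E.

Lemma energy_ge0 f : (0 <= energy f)%E.
Proof. by apply: integral_ge0 => x _; rewrite lee_fin sqr_ge0. Qed.

Lemma energy_le f g : measurable_fun [set: R] f -> measurable_fun [set: R] g ->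
  (forall x, `|f x| <= `|g x|) -> (energy f <= energy g)%E.
Proof.
move=> mf mg fg; apply: ge0_le_integral => //.
- by move=> x _; rewrite lee_fin sqr_ge0.
- by apply/measurable_EFinP; exact: measurable_funX 2 mf.
- by apply/measurable_EFinP; exact: measurable_funX 2 mg.
- move=> x _; rewrite lee_fin -(real_normK (num_real (f x))).
  by rewrite -(real_normK (num_real (g x))) lerXn2r ?nnegrE.
Qed.

Lemma energy_fatou (u : (R -> R)^nat) f (K : \bar R) :
  (forall n, measurable_fun [set: R] (u n)) ->
  {ae mu, forall x, u n x @[n --> \oo] --> f x} ->
  measurable_fun [set: R] f ->
  (forall n, (energy (u n) <= K)%E) -> (energy f <= K)%E.
Proof.
move=> mu_ uf mf uK.
have mu2 n : measurable_fun [set: R] (fun x => (u n x ^+ 2)%:E).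
  by apply/measurable_EFinP; exact: measurable_funX 2 (mu_ n).
have H : (\int[mu]_x limn_einf (fun n => (u n x ^+ 2)%:E) <=
    limn_einf (fun n => energy (u n)))%E.
  apply: (fatou mu measurableT mu2) => n x _.
  by rewrite lee_fin sqr_ge0.
apply: (@le_trans _ _ (limn_einf (fun n => energy (u n)))); last first.
  rewrite limn_einf_lim; apply: lime_le; first exact: is_cvg_einfs.
  apply: nearW => n; apply: le_trans (uK n).
  by apply: ereal_inf_lbound; exists n => /=.
apply: le_trans H; apply: ae_ge0_le_integral => //.
- by move=> x _; rewrite lee_fin sqr_ge0.
- by apply/measurable_EFinP; exact: measurable_funX 2 mf.
- move=> x _; rewrite limn_einf_lim; apply: lime_ge; first exact: is_cvg_einfs.
  apply: nearW => n; apply: le_ereal_inf_tmp => _ [m _ <-].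
  by rewrite lee_fin sqr_ge0.
(* Measurability of the lower limit is obtained from that of the upper limit by negation. *)
- have -> : (fun x => limn_einf (fun n => (u n x ^+ 2)%:E)) =
      (fun x => - limn_esup (fun n => (- u n x ^+ 2)%:E))%E.
    apply/funext => x; rewrite -limn_einfN; congr limn_einf.
    by apply/funext => n; rewrite /= opprK.
  apply: measurableT_comp => //; apply: measurable_fun_limn_esup => n.
  apply/measurable_EFinP; exact: measurable_funN (measurable_funX 2 (mu_ n)).
case: uf => N [mN N0 sN]; exists N; split=> // x nx; apply: sN => ux; apply: nx => _.
have c2 : (u n x ^+ 2)%:E @[n --> \oo] --> (f x ^+ 2)%:E.
  apply: cvg_EFin; first exact: nearW.
  by apply: (cvg_comp _ (fun y : R => y ^+ 2) ux); exact: exprn_continuous.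
by have [-> _] := cvg_limn_einf_sup c2.
Qed.

End Energy.

Section DominatedConvergence.
Context {R : realType}.
Local Notation mu := (@lebesgue_measure R).

Lemma intR_dominated (F : (R -> R)^nat) (f g : R -> R) :
  (forall n, measurable_fun [set: R] (F n)) ->
  (forall x, F n x @[n --> \oo] --> f x) -> L1 g ->
  (forall n x, `|F n x| <= g x) ->
  L1 f /\ intR (F n) @[n --> \oo] --> intR f.
Proof.
move=> mF Ff Lg Fg.
have mf : measurable_fun [set: R] f.
  by apply: (@measurable_fun_cvg _ _ _ _ F) => // x _; exact: Ff.
have H1 n : measurable_fun [set: R] (EFin \o F n).
  by apply/measurable_EFinP; exact: mF.
have H2 : measurable_fun [set: R] (EFin \o f) by apply/measurable_EFinP.
have H3 : {ae mu, forall x, [set: R] x -> (EFin \o F n) x @[n --> \oo] --> (EFin \o f) x}.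
  by apply: aeW => x _; apply: cvg_EFin; [exact: nearW|exact: Ff].
have H4 : {ae mu, forall x n, [set: R] x -> (`|(EFin \o F n) x| <= (EFin \o g) x)%E}.
  by apply: aeW => x n _ /=; rewrite lee_fin.
have [Lf _ H] := @dominated_convergence _ (measurableTypeR R) R mu setT measurableT
  _ _ _ H1 H2 H3 Lg H4; split=> //.
apply: fine_cvg; rewrite EFin_intR// in H.
Qed.

Lemma L1_cauchy : L1 (fun t : R => (1 + t ^+ 2)^-1).
Proof.
have p (t : R) : 0 < 1 + t ^+ 2 by rewrite ltr_pwDl// sqr_ge0.
have p' (t : R) : 0 <= (1 + t ^+ 2)^-1 by rewrite invr_ge0 ltW.
have cV : continuous (fun t : R => (1 + t ^+ 2)^-1).
  apply: (derive_continuous (df := fun t =>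
    - (0 + 2%:R * t ^+ 2.-1) / (1 + t ^+ 2) ^+ 2)) => u.
  apply: (@is_derive_fV _ (fun t => 1 + t ^+ 2)); first by rewrite gt_eqF.
  exact: is_derive_fD (is_derive_fcst _ _) (is_derive_fX _ _).
have [H _] := @intR_FTCy R (fun t => (1 + t ^+ 2)^-1) atan 0 (pi / 2)
  p' cV (@is_derive1_atan R) (@cvgy_atan R).
(* Both half-lines contain 0, so the sum is only a majorant of the function, which is enough. *)
apply: (@L1_dom _ _ _ _ (L1D H (L1_opp H))).
  exact: continuous_measurable_fun.
move=> t; rewrite ger0_norm ?invr_ge0 ?(ltW (p t))//.
rewrite !indicE !mem_setE !in_itv /= !andbT oppr_ge0 sqrrN.
have := p t; rewrite -invr_gt0; move: (_^-1) => v v0.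
by case: (leP 0 t) => [_|/ltW ->]; rewrite ?mul1r ?mul0r ?add0r// lerDl;
  case: (t <= 0); rewrite ?mul1r ?mul0r// ltW.
Qed.

End DominatedConvergence.

Section HilbertOperator.
Context {R : realType}.
Local Notation mu := (@lebesgue_measure R).
Implicit Types (f c : R -> R) (x y t eps L B : R).

(** A class stable under linear combinations and cutoffs. The Lipschitz bound controls the principal
    value at the origin, and the quadratic decay gives integrability at infinity and membership in
    L2. *)
Definition nice_with L B f : Prop :=
  (forall x y, `|f x - f y| <= L * `|x - y|) /\
  (forall x, `|f x| * (1 + x ^+ 2) <= B).

Definition nice f : Prop := exists L B, nice_with L B f.

(* The principal value of [f (x - t) * c t / t], folded onto the half-line
   [t > 0], where it converges absolutely. *)
Definition hilbert_integrand_fold c f x t : R :=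
  (c t * f (x - t) - c (- t) * f (x + t)) / t.

Definition hilbertR c f x : R :=
  intR (fun t => \1_`]0, +oo[ t * hilbert_integrand_fold c f x t).

Definition kernel_integrand c f x t : R := f (x - t) * c t / t.

Definition outside eps : set R := [set t | eps < `|t|].

Lemma open_outside eps : open (outside eps).
Proof.
have -> : outside eps = (fun t => `|t|) @^-1` `]eps, +oo[%classic.
  by apply/seteqP; split => t /=; rewrite in_itv /= andbT.
apply: open_comp; last exact: interval_open.
by move=> t _; exact: norm_continuous.
Qed.

Lemma measurable_outside eps : measurable (outside eps).
Proof. by apply: open_measurable; exact: open_outside. Qed.

Section Nice.
Variables (L B : R) (f : R -> R).
Hypothesis nf : nice_with L B f.

Lemma nice_B0 : 0 <= B.
Proof. by have [_ /(_ 0)] := nf; apply: le_trans; rewrite mulr_ge0// addr_ge0// sqr_ge0. Qed.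

Lemma nice_L0 : 0 <= L.
Proof.
have [/(_ 1 0) + _] := nf; rewrite subr0 normr1 mulr1.
exact: le_trans (normr_ge0 _).
Qed.

Lemma nice_bounded x : `|f x| <= B.
Proof.
have [_ /(_ x)] := nf; apply: le_trans.
by rewrite ler_peMr// lerDl sqr_ge0.
Qed.

Lemma nice_measurable : measurable_fun [set: R] f.
Proof. by apply: continuous_measurable_fun; exact: lipschitz_continuous nf.1. Qed.

(** Peetre's inequality [1 + t^2 <= 2 (1 + x^2) (1 + (x - t)^2)] moves the decay from [x - t] to [t]
    at the price of a factor depending on [x]. *)
Lemma nice_decay x t : `|f (x - t)| <= 2 * B * (1 + x ^+ 2) / (1 + t ^+ 2).
Proof.
have p (u : R) : 0 < 1 + u ^+ 2 by rewrite ltr_pwDl// sqr_ge0.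
rewrite ler_pdivlMr//; have [_ /(_ (x - t)) H] := nf.
apply: (@le_trans _ _ (`|f (x - t)| * (2 * (1 + x ^+ 2) * (1 + (x - t) ^+ 2)))).
  rewrite ler_wpM2l//; rewrite -subr_ge0.
  have -> : 2 * (1 + x ^+ 2) * (1 + (x - t) ^+ 2) - (1 + t ^+ 2) =
    1 + (x + (x - t)) ^+ 2 + 2 * (x * (x - t)) ^+ 2 by ring.
  by rewrite !addr_ge0 ?sqr_ge0// mulr_ge0// sqr_ge0.
have -> : `|f (x - t)| * (2 * (1 + x ^+ 2) * (1 + (x - t) ^+ 2)) =
  2 * (1 + x ^+ 2) * (`|f (x - t)| * (1 + (x - t) ^+ 2)) by ring.
have -> : 2 * B * (1 + x ^+ 2) = 2 * (1 + x ^+ 2) * B by ring.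
by rewrite ler_wpM2l// mulr_ge0// ltW.
Qed.

End Nice.

Lemma nice_decayD L B f x t : nice_with L B f ->
  `|f (x + t)| <= 2 * B * (1 + x ^+ 2) / (1 + t ^+ 2).
Proof. by move=> nf; have := nice_decay nf x (- t); rewrite opprK sqrrN. Qed.

Section Fold.
Variables (c : R -> R) (Lc : R).
Hypotheses (cc : continuous c) (c1 : forall t, `|c t| <= 1).
Hypothesis cL : forall t, 0 < t -> t <= 1 -> `|c t - c (- t)| <= Lc * t.

Let Lc0 : 0 <= Lc.
Proof. by have := cL ltr01 (lexx 1); rewrite mulr1; exact: le_trans. Qed.

(** The first summand handles [t <= 1], doubled because [1 + t ^+ 2 <= 2] there; the second handles
    [t > 1], with one copy of [nice_decay] for each sign. *)
Definition fold_bound L B x : R := 2 * (2 * L + Lc * B) + 4 * B * (1 + x ^+ 2).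

Lemma fold_bound_ge0 L B f x : nice_with L B f -> 0 <= fold_bound L B x.
Proof.
move=> nf; have B0 := nice_B0 nf; have L0 := nice_L0 nf.
apply: addr_ge0.
  by apply: mulr_ge0 => //; apply: addr_ge0; exact: mulr_ge0.
apply: mulr_ge0; first exact: mulr_ge0.
by rewrite addr_ge0// sqr_ge0.
Qed.

Lemma hilbert_integrand_fold_le L B f x t : nice_with L B f -> 0 < t ->
  `|hilbert_integrand_fold c f x t| <= fold_bound L B x * (1 + t ^+ 2)^-1.
Proof.
move=> nf t0; have B0 := nice_B0 nf; have L0 := nice_L0 nf.
have p (u : R) : 0 < 1 + u ^+ 2 by rewrite ltr_pwDl// sqr_ge0.
have K1 : 0 <= 2 * (2 * L + Lc * B).
  by rewrite mulr_ge0// addr_ge0 ?mulr_ge0.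
have K2 : 0 <= 4 * B * (1 + x ^+ 2) by rewrite !mulr_ge0// ltW.
rewrite /hilbert_integrand_fold normrM normfV (gtr0_norm t0) ler_pdivrMr//.
have [t1|t1] := leP t 1.
  apply: (@le_trans _ _ ((2 * L + Lc * B) * t)).
    (* Near the origin the numerator is of order [t]: one part uses the Lipschitz bound of [f], the
       other the smallness of the odd part of [c]. *)
    have -> : c t * f (x - t) - c (- t) * f (x + t) =
      c t * (f (x - t) - f (x + t)) + (c t - c (- t)) * f (x + t) by ring.
    rewrite (le_trans (ler_normD _ _))// [leRHS]mulrDl lerD//.
      rewrite normrM (le_trans (y := 1 * (L * `|x - t - (x + t)|)))//.
        by rewrite ler_pM// nf.1.
      have -> : x - t - (x + t) = - (2 * t) by ring.
      by rewrite normrN normrM !ger0_norm ?(ltW t0)// mul1r; lra.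
    by rewrite normrM mulrAC ler_pM// ?cL// (nice_bounded nf).
  rewrite ler_wpM2r ?(ltW t0)// ler_pdivlMr//.
  have t2 : t ^+ 2 <= 1 by rewrite expr_le1// ltW.
  apply: (@le_trans _ _ (2 * (2 * L + Lc * B))); last by rewrite /fold_bound lerDl.
  rewrite mulrC; apply: ler_wpM2r; first by rewrite addr_ge0 ?mulr_ge0.
  lra.
apply: (@le_trans _ _ (fold_bound L B x * (1 + t ^+ 2)^-1)); last first.
  rewrite ler_peMr ?(ltW t1)// mulr_ge0 ?invr_ge0 ?(ltW (p t))//.
  exact: addr_ge0.
apply: (@le_trans _ _ (4 * B * (1 + x ^+ 2) * (1 + t ^+ 2)^-1)); last first.
  by rewrite ler_wpM2r ?invr_ge0 ?(ltW (p t))// lerDr.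
have d1 := nice_decay nf x t; have d2 := nice_decayD x t nf.
rewrite (le_trans (ler_normB _ _))// !normrM.
have e1 : `|c t| * `|f (x - t)| <= `|f (x - t)| by rewrite ler_piMl.
have e2 : `|c (- t)| * `|f (x + t)| <= `|f (x + t)| by rewrite ler_piMl.
lra.
Qed.

Lemma measurable_fold f x : measurable_fun [set: R] f ->
  measurable_fun [set: R] (fun t => \1_`]0, +oo[ t * hilbert_integrand_fold c f x t).
Proof.
move=> mf; have mc := continuous_measurable_fun cc.
have mV : measurable_fun [set: R] (fun t : R => \1_`]0, +oo[ t * t^-1).
  have -> : (fun t : R => \1_`]0, +oo[ t * t^-1) =
      (fun t => t^-1) \_ (`]0, +oo[ : set R).
    apply/funext => t; rewrite patchE indicE.
    by case: ifP => _; rewrite ?mul1r ?mul0r.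
  apply/(measurable_restrict _ _ _).1 => //; rewrite setTI.
  apply: open_continuous_measurable_fun; first exact: interval_open.
  move=> t; rewrite inE /= in_itv /= andbT => t0.
  by apply: continuousV => //; rewrite gt_eqF.
have -> : (fun t => \1_`]0, +oo[ t * hilbert_integrand_fold c f x t) =
    (fun t => (\1_`]0, +oo[ t * t^-1) * (c t * f (x - t) - c (- t) * f (x + t))).
  by apply/funext => t; rewrite /hilbert_integrand_fold; ring.
apply: measurable_funM => //; apply: measurable_funB.
  by apply: measurable_funM => //; apply: (measurableT_comp mf); exact: measurable_funB.
apply: measurable_funM; first exact: (measurableT_comp mc).
by apply: (measurableT_comp mf); exact: measurable_funD.
Qed.

Lemma fold_indic_le L B f x t : nice_with L B f ->
  `|\1_`]0, +oo[ t * hilbert_integrand_fold c f x t| <=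
  fold_bound L B x * (1 + t ^+ 2)^-1.
Proof.
move=> nf; rewrite indicE mem_setE in_itv /= andbT.
have [t0|t0] := ltP 0 t; first by rewrite mul1r hilbert_integrand_fold_le.
rewrite mul0r normr0; apply: mulr_ge0; first exact: fold_bound_ge0 nf.
by rewrite invr_ge0 addr_ge0// sqr_ge0.
Qed.

Lemma L1_fold f x : nice f ->
  L1 (fun t => \1_`]0, +oo[ t * hilbert_integrand_fold c f x t).
Proof.
move=> [L [B nf]].
apply: (@L1_dom _ _ (fun t => fold_bound L B x * (1 + t ^+ 2)^-1)).
- exact: measurable_fold (nice_measurable nf).
- by apply: L1Z; exact: L1_cauchy.
- by move=> t; exact: fold_indic_le.
Qed.

Section PrincipalValue.
Variables (f : R -> R) (x : R).
Hypothesis nf : nice f.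

Local Notation g := (kernel_integrand c f x).
Local Notation far := outside.

Lemma pv_L1 eps : 0 < eps -> L1 (fun t => \1_(far eps) t * g t).
Proof.
move=> e0; have [L [B nfLB]] := nf; have B0 := nice_B0 nfLB.
have p (u : R) : 0 < 1 + u ^+ 2 by rewrite ltr_pwDl// sqr_ge0.
pose K := eps^-1 * (2 * B * (1 + x ^+ 2)).
have ei : 0 <= eps^-1 by rewrite invr_ge0 ltW.
have K0 : 0 <= K.
  by apply: (mulr_ge0 ei); apply: mulr_ge0 (ltW (p x)); exact: mulr_ge0.
apply: (@L1_dom _ _ (fun t => K * (1 + t ^+ 2)^-1)).
- have mc := continuous_measurable_fun cc; have mf := nice_measurable nfLB.
  have mV : measurable_fun [set: R] (fun t : R => \1_(far eps) t * t^-1).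
    have -> : (fun t : R => \1_(far eps) t * t^-1) = (fun t => t^-1) \_ (far eps).
      apply/funext => t; rewrite patchE indicE.
      by case: ifP => _; rewrite ?mul1r ?mul0r.
    apply/(measurable_restrict _ _ _).1 => //; first exact: measurable_outside.
    rewrite setTI; apply: open_continuous_measurable_fun; first exact: open_outside.
    move=> t; rewrite inE /= => t0.
    by apply: continuousV => //; rewrite -normr_gt0 (lt_trans e0).
  have -> : (fun t => \1_(far eps) t * g t) =
      (fun t => (\1_(far eps) t * t^-1) * (f (x - t) * c t)).
    by apply/funext => t; rewrite /kernel_integrand; ring.
  apply: measurable_funM => //; apply: measurable_funM => //.
  by apply: (measurableT_comp mf); exact: measurable_funB.
- by apply: L1Z; exact: L1_cauchy.
- move=> t; rewrite indicE; case: (boolP (t \in far eps)) => [|_]; last first.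
    by rewrite mul0r normr0; apply: mulr_ge0 (ltW _); rewrite ?invr_gt0.
  rewrite inE /outside /= => et; have t0 : 0 < `|t| by exact: lt_trans et.
  rewrite mul1r /kernel_integrand normrM normfV mulrC /K -mulrA.
  apply: ler_pM => //.
    by rewrite lef_pV2 ?posrE// ltW.
  rewrite normrM (le_trans _ (nice_decay nfLB x t))//.
  by rewrite ler_piMr.
Qed.

Lemma pv_fold eps : 0 < eps -> intR (fun t => \1_(far eps) t * g t) =
  intR (fun t => \1_`]0, +oo[ t * (\1_(far eps) t * hilbert_integrand_fold c f x t)).
Proof.
move=> e0; have g0 : \1_(far eps) 0 * g 0 = 0 by rewrite /kernel_integrand invr0 !mulr0.
have [_ ->] := intR_fold (pv_L1 e0) g0.
apply: eq_intR => t; congr (_ * _).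
have -> : \1_(far eps) (- t) = \1_(far eps) t :> R.
  have e : (- t \in far eps) = (t \in far eps).
    by apply/idP/idP; rewrite !inE /outside /= normrN.
  by rewrite !indicE e.
by rewrite /kernel_integrand /hilbert_integrand_fold opprK invrN; ring.
Qed.

(** After folding, the truncated integral misses only [0 < t <= eps], where the integrand is bounded
    by [K]; the error is therefore at most [K * eps]. *)
Lemma pv_cvg :
  intR (fun t => \1_(far eps) t * g t) @[eps --> 0^'+] --> hilbertR c f x.
Proof.
have [L [B nfLB]] := nf; pose K := fold_bound L B x.
have K0 : 0 <= K := fold_bound_ge0 x nfLB.
have bound eps : 0 < eps ->
    `|hilbertR c f x - intR (fun t => \1_(far eps) t * g t)| <= K * eps.
  move=> e0; rewrite pv_fold// /hilbertR.
  have Lh := L1_fold x nf; set h := hilbert_integrand_fold c f x in Lh *.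
  have L2 : L1 (fun t => \1_`]0, +oo[ t * (\1_(far eps) t * h t)).
    under eq_fun do rewrite mulrCA mulrC.
    apply: (@L1_mul_bounded _ _ _ 1 Lh); first exact: measurable_indic (measurable_outside _).
    by move=> t; rewrite indicE ger0_norm//; case: (_ \in _).
  rewrite -intRB//.
  have Li : L1 (fun t => K * \1_`[0, eps] t) by apply: L1Z; exact: L1_itv.
  have -> : K * eps = intR (fun t => K * \1_`[0, eps] t).
    rewrite intRZ; last exact: L1_itv.
    have [_] := intR_FTC (ltW e0) (fun t _ => is_derive_fid t)
      (fun t _ => @cst_continuous R R 1 t).
    have -> : (fun t => \1_`[0, eps] t * 1) = \1_`[0, eps] :> (R -> R).
      by apply/funext => t; rewrite mulr1.
    by move=> ->; rewrite subr0.
  apply: intR_norm_le => //; first by apply: L1_measurable; exact: L1B.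
  move=> t; have d1 : eps < `|t| -> \1_(far eps) t = 1 :> R.
    by move=> et; rewrite indicE mem_set.
  have d0 : `|t| <= eps -> \1_(far eps) t = 0 :> R.
    by move=> et; rewrite indicE memNset// /outside /=; apply/negP; rewrite -leNgt.
  move: (\1_(far eps) t : R) d1 d0 => d d1 d0.
  rewrite !indicE !mem_setE !in_itv /= !andbT.
  have [t0|t0] := ltP 0 t; last first.
    by rewrite !mul0r subr0 normr0; exact: mulr_ge0 K0 (ler0n _ _).
  rewrite !mul1r (ltW t0) /=; have [te|et] := leP `|t| eps; last first.
    by rewrite d1// mul1r subrr normr0; exact: mulr_ge0 K0 (ler0n _ _).
  rewrite d0// mul0r subr0; have -> : t <= eps by rewrite (le_trans (ler_norm t)).
  rewrite mulr1 (le_trans (hilbert_integrand_fold_le x nfLB t0))//.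
  rewrite ler_piMr// invf_le1 ?lerDl ?sqr_ge0//.
  by rewrite ltr_pwDl// sqr_ge0.
apply/cvgrPdist_le => e e0.
have eK : 0 < e / (K + 1) by rewrite divr_gt0// ltr_pwDr.
near=> eps; have eps0 : 0 < eps by [].
apply: le_trans (bound eps eps0) _.
apply: (@le_trans _ _ ((K + 1) * eps)); first by rewrite ler_wpM2r ?(ltW eps0)// lerDl.
rewrite mulrC -ler_pdivlMr ?ltr_pwDr//; near: eps.
exact: nbhs_right_le.
Unshelve. all: by end_near. Qed.

End PrincipalValue.

End Fold.

End HilbertOperator.

Section Cutoff.
Context {R : realType}.
Implicit Types (x y u v : R) (n : nat).

Definition cutoff n x : R := Num.max 0 (Num.min 1 (n.+1%:R - `|x|)).

Lemma cutoff_ge0 n x : 0 <= cutoff n x.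
Proof. by rewrite le_max lexx. Qed.

Lemma cutoff_le1 n x : cutoff n x <= 1.
Proof. by rewrite ge_max ler01 ge_min lexx. Qed.

Lemma cutoff_norm_le1 n x : `|cutoff n x| <= 1.
Proof. by rewrite ger0_norm ?cutoff_ge0// cutoff_le1. Qed.

Lemma cutoff_lipschitz n x y : `|cutoff n x - cutoff n y| <= `|x - y|.
Proof.
have clamp u v : `|Num.max 0 (Num.min 1 u) - Num.max 0 (Num.min 1 v)| <= `|u - v|.
  wlog uv : u v / v <= u => [H|].
    by case: (leP v u) => [/H//|/ltW /H]; rewrite distrC (distrC v).
  rewrite (ger0_norm (x := u - v)) ?subr_ge0// ler_norml.
  by apply/andP; split; case: (leP 1 u) => ?; case: (leP 1 v) => ?;
    case: (leP 0 u) => ?; case: (leP 0 v) => ?; rewrite /Num.max; repeat (case: ifP); lra.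
apply: le_trans (clamp _ _) _.
have -> : n.+1%:R - `|x| - (n.+1%:R - `|y|) = `|y| - `|x| by ring.
by rewrite [leRHS]distrC ler_dist_dist.
Qed.

Lemma cutoff_eq1 n x : `|x| <= n%:R -> cutoff n x = 1.
Proof.
move=> xn; rewrite /cutoff min_l ?max_r//.
by rewrite -natr1; lra.
Qed.

Lemma cutoff_eq0 n x : n.+1%:R < `|x| -> cutoff n x = 0.
Proof.
move=> nx; rewrite /cutoff max_l// ge_min; apply/orP; right; lra.
Qed.

(** The cutoff has slope at most 1, so the constants do not depend on [n]; this is what later allows
    dominated convergence. *)
Lemma nice_cutoff L B (f : R -> R) n : nice_with L B f ->
  nice_with (L + B) B (fun x => f x * cutoff n x).
Proof.
move=> nf; split=> [x y|x].
  have -> : f x * cutoff n x - f y * cutoff n y =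
    (f x - f y) * cutoff n x + f y * (cutoff n x - cutoff n y) by ring.
  rewrite (le_trans (ler_normD _ _))// [leRHS]mulrDl lerD//.
    by rewrite normrM (le_trans _ (nf.1 x y))// ler_piMr// cutoff_norm_le1.
  by rewrite normrM ler_pM ?cutoff_lipschitz// (nice_bounded nf).
rewrite normrM (le_trans _ (nf.2 x))// mulrAC ler_piMr ?cutoff_norm_le1//.
by rewrite mulr_ge0// addr_ge0// sqr_ge0.
Qed.

End Cutoff.

(** * The energy bound, by truncation and passage to the limit *)

Section HilbertBound.
Context {R : realType}.
Local Notation mu := (@lebesgue_measure R).
Variables (c : R -> R) (Lc C : R).
Hypotheses (cc : continuous c) (c1 : forall t, `|c t| <= 1).
Hypothesis cL : forall t, 0 < t -> t <= 1 -> `|c t - c (- t)| <= Lc * t.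
Hypothesis cosC : forall eps N xi, 0 < eps -> eps <= N ->
  `|trig_transform cos (trunc_kernel c eps N) xi| <= C.
Hypothesis sinC : forall eps N xi, 0 < eps -> eps <= N ->
  `|trig_transform sin (trunc_kernel c eps N) xi| <= C.

(** Kernel and function are truncated together, so that [convR_L2_bound] applies for each [n]. *)
Let trunc f n (x : R) := convR (trunc_kernel c n.+1%:R^-1 n.+1%:R)
  (fun y => f y * cutoff n y) x.

Let eps_gt0 n : 0 < n.+1%:R^-1 :> R.
Proof. by rewrite invr_gt0. Qed.

Let eps_le n : n.+1%:R^-1 <= n.+1%:R :> R.
Proof. by rewrite (@le_trans _ _ 1) ?invf_le1 ?ler1n. Qed.

Let trunc_cvg f x : nice f -> trunc f n x @[n --> \oo] --> hilbertR c f x.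
Proof.
move=> [L [B nf]].
pose F n t : R := \1_`[n.+1%:R^-1, n.+1%:R] t *
  hilbert_integrand_fold c (fun y => f y * cutoff n y) x t.
have tE n : trunc f n x = intR (F n).
  have nfn := nice_cutoff n nf.
  have mg : measurable_fun [set: R] (fun t => f (x - t) * cutoff n (x - t)).
    have mx : measurable_fun [set: R] (fun t => x - t) by exact: measurable_funB.
    exact: (measurableT_comp (nice_measurable nfn) mx).
  have [_ E] := intR_trunc_kernel (eps_gt0 n) (eps_le n) cc mg
    (fun t => nice_bounded nfn (x - t)).
  rewrite /trunc /convR E; apply: eq_intR => t.
  by rewrite /F /hilbert_integrand_fold opprK.
rewrite (_ : (fun n => trunc f n x) = (fun n => intR (F n))); last exact/funext.
have bnd n t : `|F n t| <= `|\1_`]0, +oo[ t *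
    hilbert_integrand_fold c (fun y => f y * cutoff n y) x t|.
  rewrite /F !indicE !mem_setE !in_itv /= andbT.
  have [t0|t0] := ltP 0 t.
    rewrite mul1r normrM ler_piMl// ger0_norm//.
    by case: (_ && _).
  have -> : (n.+1%:R^-1 <= t) = false.
    by apply/negbTE; rewrite -ltNge (le_lt_trans t0).
  by rewrite /= !mul0r.
suff : L1 (fun t => \1_`]0, +oo[ t * hilbert_integrand_fold c f x t) /\
    intR (F n) @[n --> \oo] --> hilbertR c f x by case.
apply: (@intR_dominated _ F _ (fun t => fold_bound Lc (L + B) B x * (1 + t ^+ 2)^-1)).
- move=> n; have nfn := nice_cutoff n nf.
  have -> : F n = (fun t => \1_`[n.+1%:R^-1, n.+1%:R] t * (\1_`]0, +oo[ t *
      hilbert_integrand_fold c (fun y => f y * cutoff n y) x t)).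
    apply/funext => t; rewrite /F !indicE !mem_setE !in_itv /= andbT.
    have [t0|t0] := ltP 0 t; first by rewrite mul1r.
    have -> : (n.+1%:R^-1 <= t) = false.
      by apply/negbTE; rewrite -ltNge (le_lt_trans t0).
    by rewrite /= !mul0r.
  apply: measurable_funM; first exact: measurable_indic.
  exact: measurable_fold cc _ _ (nice_measurable nfn).
- move=> t; have [t0|t0] := ltP 0 t; last first.
    rewrite (_ : (fun n => F n t) = (fun=> 0)).
      rewrite indicE mem_setE in_itv /= andbT ltNge t0 mul0r; exact: cvg_cst.
    apply/funext => n; rewrite /F indicE mem_setE in_itv /=.
    have -> : (n.+1%:R^-1 <= t) = false.
      by apply/negbTE; rewrite -ltNge (le_lt_trans t0).
    by rewrite /= !mul0r.
  (* For fixed [t > 0] the sequence is eventually constant: [t] enters the interval and both cutoffs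
     become 1. *)
  apply: cvg_near_cst; near=> n.
  have tn : t <= n%:R by near: n; exact: nbhs_infty_ger.
  have tVn : t^-1 <= n%:R by near: n; exact: nbhs_infty_ger.
  have n1 : `|x - t| <= n%:R by near: n; exact: nbhs_infty_ger.
  have n2 : `|x + t| <= n%:R by near: n; exact: nbhs_infty_ger.
  have nS : n%:R <= n.+1%:R :> R by rewrite ler_nat.
  rewrite /F !indicE !mem_setE !in_itv /= andbT t0 (le_trans tn nS) andbT.
  have -> : n.+1%:R^-1 <= t.
    rewrite -[t]invrK lef_pV2 ?posrE ?invr_gt0//.
    exact: le_trans tVn nS.
  by rewrite /hilbert_integrand_fold !cutoff_eq1// !mulr1.
- by apply: L1Z; exact: L1_cauchy.
- move=> n t; apply: le_trans (bnd n t) _.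
  by apply: fold_indic_le => //; exact: nice_cutoff.
Unshelve. all: by end_near. Qed.

Let measurable_trunc f n : nice f -> measurable_fun [set: R] (trunc f n).
Proof.
move=> [L [B nf]]; have nfn := nice_cutoff n nf.
have Lk := L1_trunc_kernel (eps_gt0 n) (eps_le n) cc.
apply: continuous_measurable_fun.
exact: lipschitz_continuous (convR_lipschitz Lk (nice_bounded nfn) nfn.1).
Qed.

Lemma measurable_hilbertR f : nice f -> measurable_fun [set: R] (hilbertR c f).
Proof.
move=> nf; apply: (@measurable_fun_cvg _ _ _ _ (trunc f)) => [n|x _].
  exact: measurable_trunc.
exact: trunc_cvg.
Qed.

Lemma energy_hilbertR f : nice f ->
  (energy (hilbertR c f) <= (4 * C ^+ 2)%:E * energy f)%E.
Proof.
move=> nf; apply: (@energy_fatou _ (trunc f)).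
- by move=> n; exact: measurable_trunc.
- by apply: aeW => x; exact: trunc_cvg.
- exact: measurable_hilbertR.
move=> n; have [L [B nfLB]] := nf; have nfn := nice_cutoff n nfLB.
set fn := fun y => f y * cutoff n y in nfn.
set k := trunc_kernel c n.+1%:R^-1 n.+1%:R.
have Lk : L1 k := L1_trunc_kernel (eps_gt0 n) (eps_le n) cc.
have kN t : n.+1%:R < `|t| -> k t = 0.
  by apply: trunc_kernel_support; exact: eps_gt0.
have fnA x : n.+1%:R < `|x| -> fn x = 0.
  by move=> xn; rewrite /fn cutoff_eq0// mulr0.
have fnB := nice_bounded nfn; have mfn := nice_measurable nfn.
have n0 : 0 <= n.+1%:R :> R by [].
have H := convR_L2_bound Lk kN fnA fnB nfn.1 n0 n0
  (fun xi => cosC xi (eps_gt0 n) (eps_le n)) (fun xi => sinC xi (eps_gt0 n) (eps_le n)).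
have L1sq (g : R -> R) (A M : R) : measurable_fun [set: R] g ->
    (forall x, `|g x| <= M) -> (forall x, A < `|x| -> g x = 0) ->
    energy g = (intR (fun x => g x ^+ 2))%:E.
  move=> mg gM gA; rewrite -EFin_intR//.
  apply: (@L1_bounded_support _ _ A (M ^+ 2)); first exact: measurable_funX 2 mg.
    have M0 : 0 <= M by rewrite (le_trans _ (gM 0)).
    by move=> x; rewrite normrX lerXn2r ?nnegrE.
  by move=> x /gA ->; rewrite expr0n.
have E1 : energy (trunc f n) = (intR (fun x => trunc f n x ^+ 2))%:E.
  apply: (L1sq _ (n.+1%:R + n.+1%:R) _ (measurable_trunc n nf)).
    exact: convR_bounded Lk fnB nfn.1.
  exact: convR_support kN fnA.
have E2 : energy fn = (intR (fun x => fn x ^+ 2))%:E by exact: L1sq mfn fnB fnA.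
apply: (@le_trans _ _ ((4 * C ^+ 2)%:E * energy fn)%E).
  by rewrite E1 E2 -EFinM lee_fin.
apply: lee_wpmul2l; first by rewrite lee_fin mulr_ge0// sqr_ge0.
apply: energy_le => //; first exact: nice_measurable nfLB.
by move=> x; rewrite normrM ler_piMr// cutoff_norm_le1.
Qed.

End HilbertBound.

(** * Density and completeness in L2 *)

Section EnergyAlgebra.
Context {R : realType}.
Local Notation mu := (@lebesgue_measure R).
Implicit Types (f g u v : R -> R).

Let msqr u : measurable_fun [set: R] u ->
  measurable_fun [set: R] (fun x => (u x ^+ 2)%:E).
Proof. by move=> m; apply/measurable_EFinP; exact: measurable_funX 2 m. Qed.

Lemma energyZ a u : measurable_fun [set: R] u ->
  (energy (fun x => (a * u x)%R) = (a ^+ 2)%:E * energy u)%E.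
Proof.
move=> m; rewrite /energy -ge0_integralZl//; last first.
- by rewrite lee_fin sqr_ge0.
- by move=> x _; rewrite lee_fin sqr_ge0.
- exact: msqr.
by apply: eq_integral => x _; rewrite -EFinM exprMn.
Qed.

Lemma energyD u v : measurable_fun [set: R] u -> measurable_fun [set: R] v ->
  (energy (fun x => (u x + v x)%R) <= 2%:E * energy u + 2%:E * energy v)%E.
Proof.
move=> m m'.
have H (w : R -> R) : measurable_fun [set: R] w ->
    (2%:E * energy w = \int[mu]_x (2 * w x ^+ 2)%:E)%E.
  move=> mw; rewrite /energy -ge0_integralZl//; first exact: msqr.
  by move=> x _; rewrite lee_fin sqr_ge0.
have mH (w : R -> R) : measurable_fun [set: R] w ->
    measurable_fun [set: R] (fun x => (2 * w x ^+ 2)%:E).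
  move=> mw; apply/measurable_EFinP; apply: measurable_funM => //.
  exact: measurable_funX 2 mw.
have pos (w : R -> R) x : (0 <= (2 * w x ^+ 2)%:E)%E.
  by rewrite lee_fin mulr_ge0// sqr_ge0.
rewrite !H// -ge0_integralD//; try exact: mH.
apply: ge0_le_integral => //.
- by move=> x _; rewrite lee_fin sqr_ge0.
- by apply: msqr; exact: measurable_funD.
- by apply: emeasurable_funD; exact: mH.
- move=> x _; rewrite -EFinD lee_fin; have := sqr_ge0 (u x - v x).
  by rewrite sqrrB sqrrD; lra.
Qed.

Lemma energyB u v : measurable_fun [set: R] u -> measurable_fun [set: R] v ->
  (energy (fun x => (u x - v x)%R) <= 2%:E * energy u + 2%:E * energy v)%E.
Proof.
move=> m m'; have mN : measurable_fun [set: R] (fun x => -1 * v x).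
  exact: measurable_funM.
have := energyD m mN; rewrite energyZ// sqrrN expr1n mul1e.
by under eq_fun do rewrite mulN1r.
Qed.

Lemma energy_eq0 u : measurable_fun [set: R] u -> energy u = 0%E ->
  {ae mu, forall x, u x = 0}.
Proof.
move=> m u0; have mu2 := msqr m.
have : ae_eq mu setT (fun x => (u x ^+ 2)%:E) (cst 0%E).
  apply/(ae_eq_integral_abs mu measurableT mu2).
  rewrite -[RHS]u0; apply: eq_integral => x _.
  by rewrite /= ger0_norm// sqr_ge0.
case=> N [mN N0 sN]; exists N; split => // x nx; apply: sN => /(_ Logic.I)[] u2.
by apply: nx; move/eqP: u2; rewrite sqrf_eq0 => /eqP.
Qed.

Lemma energy_ae0 u : measurable_fun [set: R] u ->
  {ae mu, forall x, u x = 0} -> energy u = 0%E.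
Proof.
move=> m u0; have mu2 := msqr m.
rewrite /energy (@ae_eq_integral _ _ _ mu setT (cst 0%E))//; first exact: integral0.
by case: u0 => N [mN N0 sN]; exists N; split => // x nx; apply: sN => ux;
  apply: nx => _; rewrite ux expr0n.
Qed.

(** Dominated convergence for the squares; a single good index is what the approximation arguments
    use. *)
Lemma energy_dominated (u : (R -> R)^nat) (G : R -> R) (e : R) :
  (forall n, measurable_fun [set: R] (u n)) ->
  {ae mu, forall x, u n x @[n --> \oo] --> (0 : R)} ->
  L1 (fun x => G x ^+ 2) -> (forall n x, `|u n x| <= G x) -> 0 < e ->
  exists n, (energy (u n) <= e%:E)%E.
Proof.
move=> m u0 LG uG e0.
have H3 : {ae mu, forall x, [set: R] x ->
    (u n x ^+ 2)%:E @[n --> \oo] --> (cst 0%E : R -> \bar R) x}.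
  case: u0 => N [mN N0 sN]; exists N; split => // x nx; apply: sN => ux.
  have h : u n x ^+ 2 @[n --> \oo] --> (0 ^+ 2 : R).
    by apply: (cvg_comp _ (fun y : R => y ^+ 2) ux); exact: exprn_continuous.
  rewrite expr0n /= in h.
  by apply: nx => _; apply: cvg_EFin; [exact: nearW|exact: h].
have H4 : {ae mu, forall x n, [set: R] x ->
    (`|(u n x ^+ 2)%:E| <= (EFin \o (fun x => G x ^+ 2)%R) x)%E}.
  apply: aeW => x n _ /=; rewrite lee_fin normrX lerXn2r ?nnegrE//.
  exact: le_trans (uG n x).
have [_ _] := @dominated_convergence _ (measurableTypeR R) R mu setT measurableT
  (fun n x => (u n x ^+ 2)%:E) _ _ (fun n => msqr (m n)) (measurable_cst _) H3 LG H4.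
rewrite integral0 => /fine_cvgP[Hfin /cvgrPdist_le /(_ e e0) Hle].
have [n _ Hn] : \forall n \near \oo, (energy (u n) <= e%:E)%E.
  near=> n; rewrite -[X in (X <= _)%E]fineK; last by near: n; exact: Hfin.
  rewrite lee_fin; have : `|0 - fine (energy (u n))| <= e by near: n; exact: Hle.
  by rewrite sub0r normrN; apply: le_trans (ler_norm _).
by exists n; apply: Hn => /=.
Unshelve. all: by end_near. Qed.

End EnergyAlgebra.

(** * Density of Lipschitz functions of quadratic decay *)

Section Density.
Context {R : realType}.
Local Notation mu := (@lebesgue_measure R).
Implicit Types (f g : R -> R).

Definition L2r f := measurable_fun [set: R] f /\ (energy f < +oo)%E.

Lemma L2r_L1 f : L2r f -> L1 (fun x => f x ^+ 2).
Proof.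
move=> [m fin]; apply/integrableP; split.
  by apply/measurable_EFinP; exact: measurable_funX 2 m.
apply: le_lt_trans fin; apply: ge0_le_integral => //.
- by apply: measurableT_comp => //; apply/measurable_EFinP; exact: measurable_funX 2 m.
- by apply/measurable_EFinP; exact: measurable_funX 2 m.
- by move=> x _ /=; rewrite ger0_norm ?sqr_ge0.
Qed.

(** Cutting both the domain and the values yields a bounded function of bounded support, which can
    then be averaged. *)
Definition truncation f n (x : R) : R :=
  if (`|x| <= n%:R) && (`|f x| <= n%:R) then f x else 0.

Lemma measurable_truncation f n : measurable_fun [set: R] f ->
  measurable_fun [set: R] (truncation f n).
Proof.
move=> m; apply: measurable_fun_if => //; last exact: measurable_funTS.
apply: measurable_and; apply: measurable_fun_ler => //.
exact: (measurableT_comp (@normr_measurable R setT)).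
Qed.

Lemma truncation_dense f (e : R) : L2r f -> 0 < e ->
  exists n, (energy (fun x => (f x - truncation f n x)%R) <= e%:E)%E.
Proof.
move=> fL e0; have m := fL.1.
apply: (@energy_dominated _ (fun n x => f x - truncation f n x) (fun x => `|f x|)) => //.
- by move=> n; apply: measurable_funB => //; exact: measurable_truncation.
- apply: aeW => x; apply: cvg_near_cst; near=> n.
  rewrite /truncation ifT ?subrr//; apply/andP; split; near: n;
    exact: nbhs_infty_ger.
- have := L2r_L1 fL; congr L1; apply/funext => x.
  by rewrite real_normK// num_real.
- move=> n x; rewrite /truncation; case: ifP => _; first by rewrite subrr normr0.
  by rewrite subr0.
Unshelve. all: by end_near. Qed.

Section Average.
Variables (g : R -> R) (A M : R).
Hypotheses (mg : measurable_fun [set: R] g) (gM : forall x, `|g x| <= M).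
Hypothesis gA : forall x, A < `|x| -> g x = 0.

Let Lg : L1 g. Proof. exact: L1_bounded_support mg gM gA. Qed.

Let F x := \int[mu]_(t in `]-oo, x]) g t.

Let M0 : 0 <= M. Proof. exact: le_trans (normr_ge0 _) (gM 0). Qed.

Let FE x : F x = intR (fun t => \1_`]-oo, x] t * g t).
Proof. exact: intR_itv. Qed.

Let Lgx x : L1 (fun t => \1_`]-oo, x] t * g t).
Proof.
under eq_fun do rewrite mulrC.
apply: (@L1_mul_bounded _ _ _ 1 Lg); first exact: measurable_indic.
by move=> t; rewrite indicE ger0_norm//; case: (_ \in _).
Qed.

Let itv_mass (x y : R) : x <= y -> intR (\1_`[x, y] : R -> R) = y - x.
Proof.
move=> xy; have [_] := intR_FTC xy (fun t _ => is_derive_fid t)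
  (fun t _ => @cst_continuous R R 1 t).
have -> : (fun t => \1_`[x, y] t * 1) = \1_`[x, y] :> (R -> R).
  by apply/funext => t; rewrite mulr1.
by [].
Qed.

Let F_lip x y : `|F x - F y| <= M * `|x - y|.
Proof.
wlog xy : x y / y <= x => [H|].
  by case: (leP y x) => [/H//|/ltW /H]; rewrite distrC (distrC y).
rewrite (ger0_norm (x := x - y)) ?subr_ge0// !FE -intRB// -itv_mass//.
rewrite -intRZ; last exact: L1_itv.
apply: intR_norm_le; first by apply: L1_measurable; exact: L1B.
- by apply: L1Z; exact: L1_itv.
move=> t; rewrite !indicE !mem_setE !in_itv /=.
have [ty|yt] := leP t y.
  by rewrite (le_trans ty xy) subrr normr0 mulr_ge0.
rewrite mul0r subr0 (ltW yt) /=; case: (t <= x); last by rewrite mul0r normr0 mulr0.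
by rewrite mul1r mulr1.
Qed.

(** The primitive is constant on each side of the support of [g], so its difference quotients vanish
    far away. *)
Let F_far x y : (A < x /\ A < y) \/ (x < - A /\ y < - A) -> F x = F y.
Proof.
move=> H; rewrite !FE; apply: eq_intR => t.
rewrite !indicE !mem_setE !in_itv /=; case: (leP `|t| A) => [|/gA ->]; last first.
  by rewrite !mulr0.
rewrite ler_norml => /andP[At tA]; case: H => -[Ax Ay].
  by rewrite !(le_trans tA) ?ltW.
by rewrite !leNgt (lt_le_trans Ax) ?(lt_le_trans Ay).
Qed.

(** The mean of [g] over an interval of length [1 / (n + 1)] starting at [x]. *)
Let avg n x : R := n.+1%:R * (F (x + n.+1%:R^-1) - F x).

Let inv_le1 n : n.+1%:R^-1 <= 1 :> R.
Proof. by rewrite invf_le1 ?ler1n. Qed.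

Let avgM n x : `|avg n x| <= M.
Proof.
rewrite /avg normrM (ger0_norm (x := n.+1%:R))//.
apply: (@le_trans _ _ (n.+1%:R * (M * `|x + n.+1%:R^-1 - x|))).
  by rewrite ler_wpM2l.
rewrite addrC addKr ger0_norm ?invr_ge0// mulrCA mulfV ?mulr1//.
Qed.

Let avg0 n x : `|A| + 1 < `|x| -> avg n x = 0.
Proof.
move=> xA; rewrite /avg (F_far (y := x)) ?subrr ?mulr0//.
have n0 : 0 <= n.+1%:R^-1 :> R by rewrite invr_ge0.
have n1 := inv_le1 n; have A1 := ler_norm A; have A2 := ler_norm (- A).
rewrite normrN in A2; move: (n.+1%:R^-1 : R) n0 n1 xA => r n0 n1.
by case: (ger0P x) => x0 xA; [left|right]; split; lra.
Qed.

(** The Lipschitz constant grows with [n], which is harmless because density is qualitative; the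
    decay is bounded support in disguise. *)
Lemma avg_nice n : nice (avg n).
Proof.
exists (n.+1%:R * (M + M)), (M * (1 + (`|A| + 1) ^+ 2)); split.
  move=> x y; rewrite /avg -mulrBr normrM (ger0_norm (x := n.+1%:R))// -mulrA.
  rewrite ler_wpM2l// mulrDl.
  have -> : F (x + n.+1%:R^-1) - F x - (F (y + n.+1%:R^-1) - F y) =
    (F (x + n.+1%:R^-1) - F (y + n.+1%:R^-1)) - (F x - F y) by ring.
  rewrite (le_trans (ler_normB _ _))// lerD//.
  have := F_lip (x + n.+1%:R^-1) (y + n.+1%:R^-1).
  by rewrite opprD addrACA subrr addr0.
move=> x; have [xA|xA] := leP `|x| (`|A| + 1); last first.
  by rewrite avg0// normr0 mul0r mulr_ge0// addr_ge0// sqr_ge0.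
rewrite ler_pM ?addr_ge0 ?sqr_ge0// lerD2l -(real_normK (num_real x)).
by rewrite lerXn2r ?nnegrE ?addr_ge0.
Qed.

(* The averages are difference quotients of a primitive of g, hence converge
   almost everywhere by Lebesgue's differentiation theorem. *)
Lemma avg_dense (e : R) : 0 < e ->
  exists n, (energy (fun x => (g x - avg n x)%R) <= e%:E)%E.
Proof.
move=> e0; pose B := `|A| + 1.
apply: (@energy_dominated _ (fun n x => g x - avg n x)
  (fun x => (M + M) * \1_`[-B, B] x)) => //.
- move=> n; apply: measurable_funB => //.
  by have [L' [B' nf]] := avg_nice n; exact: nice_measurable nf.
- have int y : mu.-integrable `]-oo, y] (EFin \o g).
    by apply: integrableS Lg.
  have loc : locally_integrable [set: R] g.
    by apply: open_integrable_locally => //; exact: openT.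
  case: (FTC1Ny int loc) => N [mN N0 sN]; exists N; split => // x nx; apply: sN.
  move=> [dF F'x]; apply: nx; rewrite -(subrr (g x)); apply: cvgB; first exact: cvg_cst.
  pose D h : R := h^-1 *: ((F \o shift x) (h *: 1) - F x).
  have H : D h @[h --> 0^'] --> g x by rewrite -F'x derive1E; exact: dF.
  have n0 n : n.+1%:R^-1 != 0 :> R by rewrite invr_eq0 pnatr_eq0.
  have {}H := (cvgr_dnbhsP D 0 (g x)).1 H (fun n => n.+1%:R^-1)
    (conj n0 (@cvg_harmonic R)).
  have E : (fun n : nat => D (n.+1%:R^-1)) = avg ^~ x.
    by apply/funext => n; rewrite /D /avg /= invrK /GRing.scale /= mulr1 (addrC _ x).
  by rewrite E in H.
- have := L1_itv (- B) B => /(L1Z ((M + M) ^+ 2)); congr L1; apply/funext => x.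
  by rewrite exprMn indicE; case: (_ \in _); rewrite /= ?expr1n ?expr0n.
- move=> n x; rewrite indicE mem_setE in_itv /= -ler_norml.
  have [xB|xB] := leP `|x| B.
    by rewrite mulr1 (le_trans (ler_normB _ _))// lerD.
  rewrite avg0// gA ?subrr ?normr0 ?mulr0//.
  by apply: le_lt_trans xB; rewrite /B (le_trans (ler_norm A))// lerDl.
Qed.

End Average.

Lemma nice_dense f (e : R) : L2r f -> 0 < e ->
  exists2 h, nice h & (energy (fun x => (f x - h x)%R) <= e%:E)%E.
Proof.
move=> fL e0; have m := fL.1.
(* Each of the two approximations costs [e / 4], and [energyD] doubles both. *)
have e4 : 0 < e / 4 by rewrite divr_gt0.
have [n Hn] := truncation_dense fL e4.
set g := truncation f n in Hn; have mg : measurable_fun [set: R] g.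
  exact: measurable_truncation.
have gM x : `|g x| <= n%:R.
  by rewrite /g /truncation; case: ifP => [/andP[]//|_]; rewrite normr0.
have gA x : n%:R < `|x| -> g x = 0.
  by move=> nx; rewrite /g /truncation leNgt nx.
have [k Hk] := avg_dense mg gM gA e4.
have nh := avg_nice mg gM gA k.
eexists; first exact: nh.
have [L [B nLB]] := nh; have mh := nice_measurable nLB.
set h := (h in energy (fun x => g x - h x)) in Hk nLB mh *.
have := energyD (measurable_funB m mg) (measurable_funB mg mh).
under eq_fun do rewrite addrA subrK.
move=> H; apply: (le_trans H).
apply: (@le_trans _ _ (2%:E * (e / 4)%:E + 2%:E * (e / 4)%:E)%E).
  by apply: leeD; apply: lee_wpmul2l.
by rewrite -!EFinM -EFinD lee_fin; lra.
Qed.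

End Density.

(** * Completeness for geometrically convergent sequences *)

Section Completeness.
Context {R : realType}.
Local Notation mu := (@lebesgue_measure R).
Variables (u : (R -> R)^nat) (A : R).
Hypotheses (mu_ : forall n, measurable_fun [set: R] (u n)) (A0 : 0 <= A).
Hypothesis uA : forall n,
  (energy (fun x => (u n.+1 x - u n x)%R) <= (A / 4 ^+ n)%:E)%E.

Let v n (x : R) := u n.+1 x - u n x.

Let mv n : measurable_fun [set: R] (v n).
Proof. exact: measurable_funB. Qed.

(** Splitting off the first increment, the factor 2 of [energyD] is offset by the ratio 4: [2 * (4 *
    A / 4 ^+ n.+1) + 2 * (A / 4 ^+ n)] is exactly [4 * A / 4 ^+ n]. *)
Lemma energy_telescope m n :
  (energy (fun x => (u (n + m)%N x - u n x)%R) <= (4 * A / 4 ^+ n)%:E)%E.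
Proof.
elim: m n => [|m IH] n.
  rewrite addn0 /energy; under eq_integral do rewrite subrr expr0n/=.
  by rewrite integral0 lee_fin divr_ge0 ?mulr_ge0 ?exprn_ge0.
have -> : (fun x => u (n + m.+1)%N x - u n x) =
    (fun x => (u (n.+1 + m)%N x - u n.+1 x) + v n x).
  by apply/funext => x; rewrite addSnnS /v addrA subrK.
apply: (le_trans (energyD (measurable_funB (mu_ _) (mu_ _)) (mv n))).
apply: (@le_trans _ _ (2%:E * (4 * A / 4 ^+ n.+1)%:E + 2%:E * (A / 4 ^+ n)%:E)%E).
  by apply: leeD; apply: lee_wpmul2l => //; [exact: IH|exact: uA].
rewrite -!EFinM -EFinD lee_fin exprS le_eqVlt; apply/orP; left; apply/eqP.
by field; rewrite expf_neq0.
Qed.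

Let Z (x : R) : \bar R := (\sum_(n <oo) (2 ^+ n * v n x ^+ 2)%:E)%E.

Let mZn n : measurable_fun [set: R] (fun x => (2 ^+ n * v n x ^+ 2)%:E).
Proof.
apply/measurable_EFinP; apply: measurable_funM => //.
exact: measurable_funX 2 (mv n).
Qed.

Let Zn0 n x : (0 <= (2 ^+ n * v n x ^+ 2)%:E)%E.
Proof. by rewrite lee_fin; apply: mulr_ge0 (sqr_ge0 _); exact: exprn_ge0. Qed.

Let mZ : measurable_fun [set: R] Z.
Proof. by apply: ge0_emeasurable_sum. Qed.

Let half_sum (n : nat) : \sum_(i < n) (2^-1 : R) ^+ i <= 2.
Proof.
suff -> : \sum_(i < n) (2^-1 : R) ^+ i = 2 - 2 * 2^-1 ^+ n.
  by rewrite gerBl mulr_ge0// exprn_ge0// invr_ge0.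
elim: n => [|n IH]; first by rewrite big_ord0 expr0; ring.
by rewrite big_ord_recr /= IH exprS; field.
Qed.

(** The weight [2 ^+ n] against [A / 4 ^+ n] still leaves the geometric series [A / 2 ^+ n]. *)
Let int_Z : (\int[mu]_x Z x <= (2 * A)%:E)%E.
Proof.
rewrite integral_nneseries//.
apply: lime_le; first by apply: is_cvg_nneseries => n _ _; exact: integral_ge0.
apply: nearW => n; rewrite big_mkord.
apply: (@le_trans _ _ (\sum_(i < n) (A * 2^-1 ^+ i)%:E)%E).
  apply: lee_sum => i _.
  have -> : (\int[mu]_x (2 ^+ i * v i x ^+ 2)%:E = (2 ^+ i)%:E * energy (v i))%E.
    rewrite /energy -ge0_integralZl//.
    - by apply/measurable_EFinP; exact: measurable_funX 2 (mv i).
    - by move=> x _; rewrite lee_fin sqr_ge0.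
  apply: (@le_trans _ _ ((2 ^+ i)%:E * (A / 4 ^+ i)%:E)%E).
    by apply: lee_wpmul2l; [rewrite lee_fin exprn_ge0|exact: uA].
  rewrite -EFinM lee_fin le_eqVlt; apply/orP; left; apply/eqP.
  have -> : (4 : R) = 2 * 2 by ring.
  by rewrite exprMn exprVn; field; rewrite expf_neq0.
by rewrite sumEFin lee_fin -mulr_sumr mulrC ler_wpM2r.
Qed.

Let good : set R := [set x | (Z x < +oo)%E].

Let mgood : measurable good.
Proof.
by have := emeasurable_fun_infty_o measurableT mZ +oo%E; rewrite setTI.
Qed.

Let good_ae : {ae mu, forall x, good x}.
Proof.
have iZ : mu.-integrable setT Z.
  apply/integrableP; split => //.
  apply: le_lt_trans (ltry (2 * A)); apply: le_trans int_Z.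
  under eq_integral do rewrite gee0_abs ?nneseries_ge0//.
  by [].
have [N [mN N0 sN]] := integrable_ae measurableT iZ.
exists N; split => // x nx; apply: sN => Zx; apply: nx.
by move: (Zx Logic.I); rewrite fin_numE /good /= ltey => /andP[].
Qed.

Let good_cvg x : good x -> cvg (u n x @[n --> \oo]).
Proof.
move=> gx; have Z0 : (0 <= Z x)%E by apply: nneseries_ge0 => n _ _; exact: Zn0.
have Zfin : Z x \is a fin_num by rewrite ge0_fin_numE.
have sumZ n : \sum_(i < n) 2 ^+ i * v i x ^+ 2 <= fine (Z x).
  rewrite -lee_fin fineK// -sumEFin -(big_mkord xpredT (fun i => (2 ^+ i * v i x ^+ 2)%:E)).
  by apply: nneseries_lim_ge => i _ _; exact: Zn0.
have amgm n : `|v n x| <= 2^-1 * (2^-1 ^+ n + 2 ^+ n * v n x ^+ 2).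
  have p : 0 < (2 : R) ^+ n by rewrite exprn_gt0.
  rewrite exprVn -(real_normK (num_real (v n x))).
  move: (2 ^+ n) `|v n x| p => t w p.
  have -> : 2^-1 * (t^-1 + t * w ^+ 2) = w + 2^-1 * t^-1 * (1 - t * w) ^+ 2.
    by field; rewrite gt_eqF.
  rewrite lerDl; apply: mulr_ge0 (sqr_ge0 _).
  by apply: mulr_ge0; rewrite invr_ge0// ltW.
have cv : cvgn [normed series (fun n => v n x)].
  apply: nondecreasing_is_cvgn.
    by apply: nondecreasing_series => n _ _; exact: normr_ge0.
  exists (2^-1 * (2 + fine (Z x))) => _ [n _ <-].
  have -> : [normed series (fun n => v n x)] n = \sum_(i < n) `|v i x|.
    by rewrite -(big_mkord xpredT (fun i => `|v i x|)).
  apply: (le_trans (ler_sum _ (fun (i : 'I_n) _ => amgm i))).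
  by rewrite -mulr_sumr ler_pM2l ?invr_gt0// big_split /=; apply: lerD (half_sum n) (sumZ n).
have := normed_cvg cv.
have -> : (fun n => u n x) = (fun n => series (fun n => v n x) n + u 0%N x).
  by apply/funext => n; rewrite /series /= telescope_sumr// subrK.
by move=> cs; apply: is_cvgD => //; exact: is_cvg_cst.
Qed.

(* The weights 2^n make the increments absolutely summable almost everywhere,
   since 2 |v| <= 2^-n + 2^n v^2. *)
Lemma energy_complete : exists g : R -> R, measurable_fun [set: R] g /\
  forall n, (energy (fun x => (g x - u n x)%R) <= (4 * A / 4 ^+ n)%:E)%E.
Proof.
(* Replacing the sequence by 0 off [good] makes it converge everywhere, so the limit is
   measurable. *)
pose w n x := \1_good x * u n x : R.
have mw n : measurable_fun [set: R] (w n).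
  by apply: measurable_funM => //; exact: measurable_indic.
have cw x : cvg (w n x @[n --> \oo]).
  rewrite /w indicE; case: (boolP (x \in good)) => [|_].
    rewrite inE => /good_cvg; rewrite (_ : (fun n => _) = u^~ x)//.
    by apply/funext => n; rewrite mul1r.
  rewrite (_ : (fun n => _) = fun=> 0); first exact: is_cvg_cst.
  by apply/funext => n; rewrite mul0r.
pose g x := lim (w n x @[n --> \oo]).
have mg : measurable_fun [set: R] g.
  by apply: (@measurable_fun_cvg _ _ _ _ w) => // x _; exact: cw.
exists g; split => // n.
apply: (@energy_fatou _ (fun m x => u (n + m)%N x - u n x)).
- by move=> m; exact: measurable_funB.
- case: good_ae => N [mN N0 sN]; exists N; split => // x nx; apply: sN => gx.
  apply: nx; apply: cvgB; last exact: cvg_cst.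
  have -> : (fun m => u (n + m)%N x) = (fun m => w (m + n)%N x).
    by apply/funext => m; rewrite /w indicE mem_set// mul1r addnC.
  by rewrite (cvg_shiftn n (fun m => w m x)); exact: cw.
- exact: measurable_funB.
- by move=> m; exact: energy_telescope.
Qed.

End Completeness.

(** * Extension of a bounded operator by density *)

Section BoundedExtension.
Context {R : realType}.
Local Notation mu := (@lebesgue_measure R).
Implicit Types (f g h : R -> R).
Variables (H : (R -> R) -> (R -> R)) (K : R).
Hypothesis K0 : 0 <= K.
Hypothesis mH : forall h, nice h -> measurable_fun [set: R] (H h).
Hypothesis HK : forall h, nice h -> (energy (H h) <= K%:E * energy h)%E.
Hypothesis Hlin : forall a b h h', nice h -> nice h' ->
  H (fun x => a * h x + b * h' x) = (fun x => a * H h x + b * H h' x).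

Lemma nice_lin a b h h' : nice h -> nice h' -> nice (fun x => a * h x + b * h' x).
Proof.
move=> [L [B [hL hB]]] [L' [B' [hL' hB']]].
exists (`|a| * L + `|b| * L'), (`|a| * B + `|b| * B'); split => [x y|x].
  have -> : a * h x + b * h' x - (a * h y + b * h' y) =
    a * (h x - h y) + b * (h' x - h' y) by ring.
  rewrite (le_trans (ler_normD _ _))// !normrM [leRHS]mulrDl -!mulrA.
  by rewrite lerD// ler_wpM2l.
apply: (@le_trans _ _ ((`|a| * `|h x| + `|b| * `|h' x|) * (1 + x ^+ 2))).
  by rewrite ler_wpM2r ?addr_ge0 ?sqr_ge0// (le_trans (ler_normD _ _))// !normrM.
by rewrite [leLHS]mulrDl -!mulrA lerD// ler_wpM2l.
Qed.

Lemma nice_mfun h : nice h -> measurable_fun [set: R] h.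
Proof. by move=> [L [B nh]]; exact: nice_measurable nh. Qed.

(* [g] is the value at [f] of the continuous extension of [H]. *)
Definition extends_to f g : Prop := measurable_fun [set: R] g /\
  forall e : R, 0 < e -> exists h, [/\ nice h,
    (energy (fun x => (f x - h x)%R) <= e%:E)%E &
    (energy (fun x => (g x - H h x)%R) <= e%:E)%E].

Lemma extends_to_nice h : nice h -> extends_to h (H h).
Proof.
move=> nh; split; first exact: mH.
have E0 (k : R -> R) : energy (fun x => k x - k x) = 0%E.
  by rewrite /energy; under eq_integral do rewrite subrr expr0n/=; rewrite integral0.
by move=> e e0; exists h; rewrite !E0 lee_fin ltW.
Qed.

Lemma extends_to_lin a b f f' g g' :
  measurable_fun [set: R] f -> measurable_fun [set: R] f' ->
  extends_to f g -> extends_to f' g' ->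
  extends_to (fun x => a * f x + b * f' x) (fun x => a * g x + b * g' x).
Proof.
move=> mf mf' [mg G] [mg' G']; split.
  by apply: measurable_funD; apply: measurable_funM.
(* [2 * a ^+ 2 + 2 * b ^+ 2] is the loss in [energyD] and [energyZ]; the added 1 keeps [D] positive
   when [a] and [b] vanish. *)
move=> e e0; pose D := 2 * a ^+ 2 + 2 * b ^+ 2 + 1.
have a2 := sqr_ge0 a; have b2 := sqr_ge0 b.
have D0 : 0 < D by rewrite /D; lra.
have eD : 0 < e / D by rewrite divr_gt0.
have [h [nh fh gh]] := G _ eD; have [h' [nh' fh' gh']] := G' _ eD.
exists (fun x => a * h x + b * h' x).
have comb (p p' q q' : R -> R) : measurable_fun [set: R] p ->
    measurable_fun [set: R] p' -> measurable_fun [set: R] q ->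
    measurable_fun [set: R] q' ->
    (energy (fun x => (p x - q x)%R) <= (e / D)%:E)%E ->
    (energy (fun x => (p' x - q' x)%R) <= (e / D)%:E)%E ->
    (energy (fun x => (a * p x + b * p' x - (a * q x + b * q' x))%R) <= e%:E)%E.
  move=> mp mp' mq mq' E E'.
  have m1 : measurable_fun [set: R] (fun x => a * (p x - q x)).
    by apply: measurable_funM => //; exact: measurable_funB.
  have m2 : measurable_fun [set: R] (fun x => b * (p' x - q' x)).
    by apply: measurable_funM => //; exact: measurable_funB.
  have -> : (fun x => a * p x + b * p' x - (a * q x + b * q' x)) =
      (fun x => a * (p x - q x) + b * (p' x - q' x)).
    by apply/funext => x; ring.
  apply: (le_trans (energyD m1 m2)).
  rewrite !energyZ; try exact: measurable_funB.
  apply: (@le_trans _ _ (2%:E * ((a ^+ 2)%:E * (e / D)%:E) +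
      2%:E * ((b ^+ 2)%:E * (e / D)%:E))%E).
    by apply: leeD; apply: lee_wpmul2l => //; apply: lee_wpmul2l => //;
      rewrite lee_fin sqr_ge0.
  rewrite -!EFinM -EFinD lee_fin.
  have -> : 2 * (a ^+ 2 * (e / D)) + 2 * (b ^+ 2 * (e / D)) =
    (2 * a ^+ 2 + 2 * b ^+ 2) * (e / D) by ring.
  rewrite -[leRHS](divfK (lt0r_neq0 D0)) [leRHS]mulrC.
  apply: ler_wpM2r; first exact: ltW.
  by rewrite /D lerDl.
split.
- exact: nice_lin.
- by apply: comb => //; exact: nice_mfun.
- by rewrite Hlin//; apply: comb => //; exact: mH.
Qed.

(** The factor 4 comes from two uses of the doubled triangle inequality, one between [g] and [H h],
    one between [h] and [f]. *)
Lemma extends_to_bound f g : L2r f -> extends_to f g ->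
  (energy g <= (4 * K)%:E * energy f)%E.
Proof.
move=> [mf ffin] [mg G].
have fy : energy f \is a fin_num by rewrite ge0_fin_numE ?energy_ge0.
apply/lee_addgt0Pr => e e0; pose D := 2 + 4 * K.
have D0 : 0 < D by rewrite /D; have := K0; lra.
have eD : 0 < e / D by rewrite divr_gt0.
have [h [nh fh gh]] := G _ eD; have mh := nice_mfun nh.
have Eh : (energy h <= 2%:E * energy f + 2%:E * (e / D)%:E)%E.
  have -> : h = (fun x => f x - (f x - h x)) by apply/funext => x; ring.
  apply: (le_trans (energyB mf (measurable_funB mf mh))).
  by apply: leeD => //; apply: lee_wpmul2l.
have Eg : (energy g <= 2%:E * (e / D)%:E + 2%:E * (K%:E * energy h))%E.
  have -> : g = (fun x => (g x - H h x) + H h x) by apply/funext => x; ring.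
  apply: (le_trans (energyD (measurable_funB mg (mH nh)) (mH nh))).
  by apply: leeD; apply: lee_wpmul2l => //; exact: HK.
apply: (le_trans Eg).
apply: (@le_trans _ _ (2%:E * (e / D)%:E + 2%:E * (K%:E *
    (2%:E * energy f + 2%:E * (e / D)%:E)))%E).
  by apply: leeD => //; apply: lee_wpmul2l => //; apply: lee_wpmul2l.
rewrite -(fineK fy) -?EFinM -?EFinD -?EFinM -?EFinD -?EFinM -?EFinD lee_fin.
have -> : 2 * (e / D) + 2 * (K * (2 * fine (energy f) + 2 * (e / D))) =
  4 * K * fine (energy f) + D * (e / D) by rewrite /D; ring.
by rewrite mulrC (mulrC D) divfK// gt_eqF.
Qed.

(** Approximants with error [4 ^- n] have consecutive differences of energy at most [4 / 4 ^+ n], so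
    their images satisfy the hypothesis of [energy_complete] with [A = 4 * K]. *)
Lemma extends_to_exists f : L2r f -> exists g, extends_to f g.
Proof.
move=> fL; have mf := fL.1.
have e0 n : 0 < (4 ^+ n)^-1 :> R by rewrite invr_gt0 exprn_gt0.
have Q n : exists h : R -> R, nice h /\
    (energy (fun x => (f x - h x)%R) <= (4 ^+ n)^-1%:E)%E.
  by have [k nk kE] := nice_dense fL (e0 n); exists k.
have [h hP] := choice Q.
have mh n := nice_mfun (hP n).1.
pose A := 4 * K.
have A0 : 0 <= A by rewrite mulr_ge0.
have step n : (energy (fun x => (H (h n.+1) x - H (h n) x)%R) <= (A / 4 ^+ n)%:E)%E.
  have E : (fun x => H (h n.+1) x - H (h n) x) = H (fun x => 1 * h n.+1 x + (-1) * h n x).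
    by rewrite Hlin; [apply/funext => x; ring|exact: (hP _).1|exact: (hP _).1].
  rewrite E; have nd := nice_lin 1 (-1) (hP n.+1).1 (hP n).1.
  apply: (le_trans (HK nd)); 
  have -> : A / 4 ^+ n = K * (4 / 4 ^+ n) by rewrite /A; ring.
  rewrite EFinM.
  apply: lee_wpmul2l; first by rewrite lee_fin.
  have -> : (fun x => 1 * h n.+1 x + -1 * h n x) =
      (fun x => (f x - h n x) - (f x - h n.+1 x)).
    by apply/funext => x; ring.
  apply: (le_trans (energyB (measurable_funB mf (mh n)) (measurable_funB mf (mh n.+1)))).
  apply: (@le_trans _ _ (2%:E * (4 ^+ n)^-1%:E + 2%:E * (4 ^+ n)^-1%:E)%E).
    apply: leeD; apply: lee_wpmul2l => //; first exact: (hP n).2.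
    apply: le_trans (hP n.+1).2 _.
    by rewrite lee_fin lef_pV2 ?posrE ?exprn_gt0// ler_eXn2l// ltr1n.
  by rewrite -!EFinM -EFinD lee_fin; lra.
have [g [mg gE]] := energy_complete (fun n => mH (hP n).1) A0 step.
exists g; split => // e ep.
(* One index serves both errors, [1 / 4 ^+ n] for [f] and [4 * A / 4 ^+ n] for [g]. *)
have [n Hn] : exists n, (4 * A + 1) / 4 ^+ n <= e.
  have [n nB] : exists n : nat, (4 * A + 1) / e < n%:R.
    have Ae : 0 <= (4 * A + 1) / e by rewrite divr_ge0 ?(ltW ep)// addr_ge0 ?mulr_ge0.
    by exists (Num.bound ((4 * A + 1) / e)); exact: archi_boundP.
  exists n; rewrite ler_pdivrMr ?exprn_gt0// [leRHS]mulrC -ler_pdivrMr//.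
  by rewrite (le_trans (ltW nB))// -natrX ler_nat ltnW// ltn_expl.
have Dn : 0 <= (4 ^+ n)^-1 :> R by rewrite ltW.
exists (h n); split; first exact: (hP n).1.
- apply: le_trans (hP n).2 _; rewrite lee_fin (le_trans _ Hn)//.
  by rewrite ler_peMl// lerDr mulr_ge0.
- apply: le_trans (gE n) _; rewrite lee_fin (le_trans _ Hn)//.
  by rewrite ler_wpM2r// lerDl.
Qed.

End BoundedExtension.

(** * Complex-valued functions *)

Section RealExtension.
Context {R : realType}.
Local Notation mu := (@lebesgue_measure R).
Implicit Types (f g h : R -> R).

Lemma nice_L2r h : nice h -> L2r h.
Proof.
move=> [L [B nh]]; have mh := nice_measurable nh; split => //.
have B0 := nice_B0 nh.
have Lh : L1 (fun x => h x ^+ 2).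
  apply: (@L1_dom _ _ (fun x => B * B * (1 + x ^+ 2)^-1)).
  - exact: measurable_funX 2 mh.
  - by apply: L1Z; exact: L1_cauchy.
  move=> x; have p : 0 < 1 + x ^+ 2 by rewrite ltr_pwDl// sqr_ge0.
  rewrite ler_pdivlMr// normrX expr2 -mulrA ler_pM ?mulr_ge0 ?(ltW p)//.
    exact: nice_bounded nh x.
  exact: nh.2.
by rewrite /energy EFin_intR// ltry.
Qed.

Lemma L2r_lin a b f g : L2r f -> L2r g -> L2r (fun x => a * f x + b * g x).
Proof.
move=> [mf ff] [mg fg]; have m1 : measurable_fun [set: R] (fun x => a * f x).
  exact: measurable_funM.
have m2 : measurable_fun [set: R] (fun x => b * g x) by exact: measurable_funM.
split; first exact: measurable_funD.
apply: (le_lt_trans (energyD m1 m2)); rewrite !energyZ//.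
by apply: lte_add_pinfty; apply: lte_mul_pinfty => //; apply: lte_mul_pinfty => //;
  rewrite lee_fin sqr_ge0.
Qed.

Variables (c : R -> R) (Lc C : R).
Hypotheses (cc : continuous c) (c1 : forall t, `|c t| <= 1).
Hypothesis cL : forall t, 0 < t -> t <= 1 -> `|c t - c (- t)| <= Lc * t.
Hypothesis cosC : forall eps N xi, 0 < eps -> eps <= N ->
  `|trig_transform cos (trunc_kernel c eps N) xi| <= C.
Hypothesis sinC : forall eps N xi, 0 < eps -> eps <= N ->
  `|trig_transform sin (trunc_kernel c eps N) xi| <= C.

Let K : R := 4 * C ^+ 2.

Let K0 : 0 <= K. Proof. exact: mulr_ge0 (ler0n _ 4) (sqr_ge0 C). Qed.

Let mH h : nice h -> measurable_fun [set: R] (hilbertR c h).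
Proof. exact: (measurable_hilbertR cc c1 cL). Qed.

Let HK h : nice h -> (energy (hilbertR c h) <= K%:E * energy h)%E.
Proof. exact: (energy_hilbertR cc c1 cL cosC sinC). Qed.

Let Hlin a b h h' : nice h -> nice h' ->
  hilbertR c (fun x => a * h x + b * h' x) =
  (fun x => a * hilbertR c h x + b * hilbertR c h' x).
Proof.
move=> nh nh'; apply/funext => x.
have L1h := L1_fold cc c1 cL x nh; have L1h' := L1_fold cc c1 cL x nh'.
rewrite /hilbertR -!intRZ// -intRD; try exact: L1Z.
by apply: eq_intR => t; rewrite /hilbert_integrand_fold; ring.
Qed.

Local Notation ext := (extends_to (hilbertR c)).

(** The difference [g - g'] extends a function of zero energy, so the bound forces its energy to
    vanish. Compatibility with equality a.e., linearity and agreement on nice functions are all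
    instances. *)
Lemma ext_unique f f' g g' : L2r f -> L2r f' -> ext f g -> ext f' g' ->
  {ae mu, forall x, f x = f' x} -> {ae mu, forall x, g x = g' x}.
Proof.
move=> fL fL' fg fg' ff'.
have E := extends_to_lin mH Hlin 1 (-1) fL.1 fL'.1 fg fg'.
have B := extends_to_bound K0 mH HK (L2r_lin 1 (-1) fL fL') E.
have {B} : energy (fun x => 1 * g x + -1 * g' x) = 0%E.
  apply/eqP; rewrite eq_le energy_ge0 andbT (le_trans B)// energy_ae0 ?mule0//.
    exact: (L2r_lin 1 (-1) fL fL').1.
  case: ff' => N [mN N0 sN]; exists N; split => // x nx; apply: sN => fx.
  by apply: nx; rewrite /= fx; ring.
move=> /(energy_eq0 E.1)[N [mN N0 sN]]; exists N; split => // x nx; apply: sN => gx.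
by apply: nx; apply/eqP; rewrite -subr_eq0 -gx; apply/eqP; ring.
Qed.

Lemma hilbert_extension : exists T : (R -> R) -> (R -> R),
  [/\ forall f, L2r f -> measurable_fun [set: R] (T f) /\
        (energy (T f) <= (16 * C ^+ 2)%:E * energy f)%E,
      forall f f', L2r f -> L2r f' -> {ae mu, forall x, f x = f' x} ->
        {ae mu, forall x, T f x = T f' x},
      forall a b f f', L2r f -> L2r f' ->
        {ae mu, forall x, T (fun x => a * f x + b * f' x) x = a * T f x + b * T f' x} &
      forall h, nice h -> {ae mu, forall x, T h x = hilbertR c h x}].
Proof.
have Tex f : exists g, L2r f -> ext f g.
  (* Outside L2 the operator takes the arbitrary value [f]. *)
  have [fL|] := pselect (L2r f); last by exists f.
  by have [g fg] := extends_to_exists K0 mH HK Hlin fL; exists g.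
have [T TP] := choice Tex; exists T; split.
- move=> f fL; have fT := TP f fL; split; first exact: fT.1.
  have := extends_to_bound K0 mH HK fL fT.
  by have -> : 4 * K = 16 * C ^+ 2 by rewrite /K; ring.
- by move=> f f' fL fL'; apply: ext_unique => //; exact: TP.
- move=> a b f f' fL fL'; have fL2 := L2r_lin a b fL fL'.
  have E := extends_to_lin mH Hlin a b fL.1 fL'.1 (TP _ fL) (TP _ fL').
  by apply: (ext_unique fL2 fL2 (TP _ fL2) E); exact: aeW.
- move=> h nh; have hL := nice_L2r nh.
  by apply: (ext_unique hL hL (TP _ hL) (extends_to_nice mH nh)); exact: aeW.
Qed.

End RealExtension.

Section ComplexAssembly.
Context {R : realType}.
Local Notation mu := (@lebesgue_measure R).
Local Open Scope complex_scope.
Implicit Types (f g : R -> R[i]) (Q : R -> R).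

Local Notation re f := (fun x => complex.Re (f x)).
Local Notation im f := (fun x => complex.Im (f x)).

Lemma cmod_sqr (z : R[i]) : cmod z ^+ 2 = complex.Re z ^+ 2 + complex.Im z ^+ 2.
Proof.
by case: z => a b; rewrite /cmod /ComplexField.Normc.normc sqr_sqrtr// addr_ge0 ?sqr_ge0.
Qed.

Lemma cmod_ge0 (z : R[i]) : 0 <= cmod z.
Proof. by case: z => a b; exact: sqrtr_ge0. Qed.

Lemma Re_le_cmod (z : R[i]) : `|complex.Re z| <= cmod z.
Proof.
rewrite -(ler_pXn2r (n := 2)) ?nnegrE ?cmod_ge0// cmod_sqr real_normK ?num_real//.
by rewrite lerDl sqr_ge0.
Qed.

Lemma Im_le_cmod (z : R[i]) : `|complex.Im z| <= cmod z.
Proof.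
rewrite -(ler_pXn2r (n := 2)) ?nnegrE ?cmod_ge0// cmod_sqr real_normK ?num_real//.
by rewrite lerDr sqr_ge0.
Qed.

(** Three seminorms suffice: the first derivative gives the Lipschitz bound, and the function with
    weights 1 and [x ^+ 2] gives the decay. *)
Lemma schwartz_nice f : schwartz f -> nice (re f) /\ nice (im f).
Proof.
move=> [sm dec].
have gen (u : R -> R) : (forall x, derivable u x 1) ->
    (exists B : R, forall x, `|derive1 u x| <= B) ->
    (exists B : R, forall x, `|u x| <= B) ->
    (exists B : R, forall x, `|x| ^+ 2 * `|u x| <= B) -> nice u.
  move=> du [L uL] [B0 uB0] [B2 uB2]; exists L, (B0 + B2); split => [x y|x].
    wlog xy : x y / y <= x => [H|].
      by case: (leP y x) => [/H//|/ltW /H]; rewrite distrC (distrC y).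
    rewrite (ger0_norm (x := x - y)) ?subr_ge0//.
    have dL (t : R) : is_derive t 1 (fun t => L * t) L.
      by apply: (is_derive_val_eq (is_derive_fZ L (is_derive_fid t))); rewrite mulr1.
    have du' (t : R) : is_derive t 1 u (derive1 u t) by apply: DeriveDef; rewrite ?derive1E.
    have := @derive_comparison _ u (derive1 u) (fun=> 0) (fun=> 0) (fun t => L * t)
      (fun=> L) y x xy (fun t _ => du' t) (fun t _ => is_derive_fcst 0 t) (fun t _ => dL t).
    by rewrite subrr subr0 -mulrBr; apply => t _; rewrite subr0.
  by rewrite mulrDr mulr1 lerD// -(real_normK (num_real x)) mulrC.
have [B00 H00] := dec 0%N 0%N; have [B20 H20] := dec 2%N 0%N.
have [B01 H01] := dec 0%N 1%N.
split; apply: gen.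
- by move=> x; have [] := sm 0%N x.
- exists B01 => x; apply: le_trans (H01 x); rewrite expr0 mul1r.
  exact: (Re_le_cmod (cderiven 1 f x)).
- exists B00 => x; apply: le_trans (H00 x); rewrite expr0 mul1r.
  exact: (Re_le_cmod (cderiven 0 f x)).
- exists B20 => x; apply: le_trans (H20 x); rewrite ler_wpM2l ?exprn_ge0//.
  exact: (Re_le_cmod (cderiven 0 f x)).
- by move=> x; have [] := sm 0%N x.
- exists B01 => x; apply: le_trans (H01 x); rewrite expr0 mul1r.
  exact: (Im_le_cmod (cderiven 1 f x)).
- exists B00 => x; apply: le_trans (H00 x); rewrite expr0 mul1r.
  exact: (Im_le_cmod (cderiven 0 f x)).
- exists B20 => x; apply: le_trans (H20 x); rewrite ler_wpM2l ?exprn_ge0//.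
  exact: (Im_le_cmod (cderiven 0 f x)).
Qed.

Definition energyC f : \bar R := (energy (re f) + energy (im f))%E.

Lemma energyC_ge0 f : (0 <= energyC f)%E.
Proof. by rewrite adde_ge0 ?energy_ge0. Qed.

Lemma L2norm_energyC f : cmeasurable f -> L2norm f = (energyC f `^ 2^-1)%E.
Proof.
move=> [mr mi]; rewrite /L2norm unlock; congr (_ `^ _)%E.
rewrite /energyC /energy -ge0_integralD//; last 4 first.
- by move=> x _; rewrite lee_fin sqr_ge0.
- by apply/measurable_EFinP; exact: measurable_funX 2 mr.
- by move=> x _; rewrite lee_fin sqr_ge0.
- by apply/measurable_EFinP; exact: measurable_funX 2 mi.
apply: eq_integral => x _ /=.
by rewrite ?poweR_EFin ger0_norm ?cmod_ge0// powR_mulrn ?cmod_ge0// cmod_sqr.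
Qed.

Lemma in_L2P f : in_L2 f <-> L2r (re f) /\ L2r (im f).
Proof.
split=> [[cm fin]|[[m1 E1] [m2 E2]]].
  move: fin; rewrite L2norm_energyC// => /lty_poweRy.
  rewrite invr_eq0 pnatr_eq0 => /(_ isT) fin; case: cm => m1 m2.
  split; split => //; apply: le_lt_trans fin; rewrite /energyC.
    by rewrite leeDl// energy_ge0.
  by rewrite leeDr// energy_ge0.
split => //; rewrite L2norm_energyC//; apply: poweR_lty.
by rewrite /energyC lte_add_pinfty.
Qed.

(** Since [sin Q = - cos (pi / 2 + Q)], the complex kernel is expressed by two cosine kernels that
    differ only in the angle. *)
Lemma Re_integrand Q f x t : complex.Re (hilbert_integrand Q f x t) =
  complex.Re (f (x - t)) * cos (0 + Q t) / t +
  complex.Im (f (x - t)) * cos (pi / 2 + Q t) / t.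
Proof.
rewrite /hilbert_integrand /expi -fmorphV /=; case: (f (x - t)) => p q /=.
by rewrite add0r (addrC (pi / 2)) cosDpihalf; ring.
Qed.

Lemma Im_integrand Q f x t : complex.Im (hilbert_integrand Q f x t) =
  complex.Im (f (x - t)) * cos (0 + Q t) / t -
  complex.Re (f (x - t)) * cos (pi / 2 + Q t) / t.
Proof.
rewrite /hilbert_integrand /expi -fmorphV /=; case: (f (x - t)) => p q /=.
by rewrite add0r (addrC (pi / 2)) cosDpihalf; ring.
Qed.

End ComplexAssembly.

Section Fewnomials.
Context {R : realType}.
Local Notation mu := (@lebesgue_measure R).
Local Open Scope complex_scope.
Variables (d : nat) (a : 'I_d -> R) (alpha : 'I_d -> nat).
Hypothesis alpha0 : forall i, (0 < alpha i)%N.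
Implicit Types (f : R -> R[i]) (u : R -> R) (x t th eps : R).

Local Notation Q := (fewnomial a alpha).

Definition coef_list : seq (R * nat) := [seq (a i, alpha i) | i <- enum 'I_d].

Lemma size_coef_list : size coef_list = d.
Proof. by rewrite size_map size_enum_ord. Qed.

Lemma coef_list_gt0 p : p \in coef_list -> (0 < p.2)%N.
Proof. by move=> /mapP[i _ ->]; exact: alpha0. Qed.

Lemma fewnomialE t : Q t = sparse coef_list t.
Proof. by rewrite /sparse big_map big_enum. Qed.

Definition phase_cos th t : R := cos (th + Q t).

Lemma phase_cosE th : phase_cos th = (fun t => cos (th + sparse coef_list t)).
Proof. by apply/funext => t; rewrite /phase_cos fewnomialE. Qed.

Lemma continuous_phase_cos th : continuous (phase_cos th).
Proof.
rewrite phase_cosE => t; have [l dl] := derive_sparse coef_list th t.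
exact: continuous_derivable_at (is_derive_fcomp (is_derive_cos _) dl).
Qed.

Lemma phase_cos_le1 th t : `|phase_cos th t| <= 1.
Proof. exact: cos_max. Qed.

(** Positive exponents give [t ^+ alpha i <= t] on []0, 1]]. The constant depends on the
    coefficients, but it is used only for convergence of the principal value. *)
Lemma phase_cos_odd_part th t : 0 < t -> t <= 1 ->
  `|phase_cos th t - phase_cos th (- t)| <= (2 * \sum_(i < d) `|a i|) * t.
Proof.
move=> t0 t1; apply: le_trans (cos_lipschitz _ _) _.
rewrite opprD addrACA subrr add0r -sumrB -mulrA mulr_suml mulr_sumr.
apply: le_trans (ler_norm_sum _ _ _) _; apply: ler_sum => i _.
rewrite -mulrBr normrM mulrCA ler_wpM2l// (le_trans (ler_normB _ _))//.
rewrite !normrX normrN (ger0_norm (ltW t0)).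
have : t ^+ alpha i <= t.
  rewrite -(prednK (alpha0 i)) exprS ler_piMr ?(ltW t0)//.
  by rewrite exprn_ile1// ltW.
lra.
Qed.

Local Notation far := outside.
Local Notation g th u x := (kernel_integrand (phase_cos th) u x).

Lemma pv_hilbert_integrand f x :
  nice (fun x => complex.Re (f x)) -> nice (fun x => complex.Im (f x)) ->
  pv_converges (hilbert_integrand Q f x) /\
  hilbert_transform Q f x =
    (hilbertR (phase_cos 0) (fun x => complex.Re (f x)) x +
     hilbertR (phase_cos (pi / 2)) (fun x => complex.Im (f x)) x) +i*
    (hilbertR (phase_cos 0) (fun x => complex.Im (f x)) x -
     hilbertR (phase_cos (pi / 2)) (fun x => complex.Re (f x)) x).
Proof.
set f1 := fun x => complex.Re (f x); set f2 := fun x => complex.Im (f x).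
move=> n1 n2; set k := hilbert_integrand Q f x.
have mfar := @measurable_outside R.
have L th u eps : nice u -> 0 < eps -> L1 (fun t => \1_(far eps) t * g th u x t).
  move=> nu e0; exact: (pv_L1 (@continuous_phase_cos th) (phase_cos_le1 th) x nu e0).
have Cv th u : nice u ->
    intR (fun t => \1_(far eps) t * g th u x t) @[eps --> 0^'+] -->
    hilbertR (phase_cos th) u x.
  by move=> nu; exact: (pv_cvg (@continuous_phase_cos th) (phase_cos_le1 th)
    (@phase_cos_odd_part th) nu).
have reE : (fun t => complex.Re (k t)) = (fun t => g 0 f1 x t + g (pi / 2) f2 x t).
  by apply/funext => t; rewrite Re_integrand.
have imE : (fun t => complex.Im (k t)) = (fun t => g 0 f2 x t - g (pi / 2) f1 x t).
  by apply/funext => t; rewrite Im_integrand.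
have ReT eps : 0 < eps -> complex.Re (truncated_integral k eps) =
    intR (fun t => \1_(far eps) t * g 0 f1 x t) +
    intR (fun t => \1_(far eps) t * g (pi / 2) f2 x t).
  move=> e0; rewrite /= reE intR_itv; last exact: mfar.
  rewrite -intRD; [|exact: L|exact: L].
  by apply: eq_intR => t; rewrite mulrDr.
have ImT eps : 0 < eps -> complex.Im (truncated_integral k eps) =
    intR (fun t => \1_(far eps) t * g 0 f2 x t) -
    intR (fun t => \1_(far eps) t * g (pi / 2) f1 x t).
  move=> e0; rewrite /= imE intR_itv; last exact: mfar.
  rewrite -intRB; [|exact: L|exact: L].
  by apply: eq_intR => t; rewrite mulrBr.
have ReC : complex.Re (truncated_integral k eps) @[eps --> 0^'+] -->
    hilbertR (phase_cos 0) f1 x + hilbertR (phase_cos (pi / 2)) f2 x.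
  apply: cvg_trans (cvgD (Cv 0 f1 n1) (Cv (pi / 2) f2 n2)).
  by apply: near_eq_cvg; near=> eps; rewrite ReT.
have ImC : complex.Im (truncated_integral k eps) @[eps --> 0^'+] -->
    hilbertR (phase_cos 0) f2 x - hilbertR (phase_cos (pi / 2)) f1 x.
  apply: cvg_trans (cvgB (Cv 0 f2 n2) (Cv (pi / 2) f1 n1)).
  by apply: near_eq_cvg; near=> eps; rewrite ImT.
split; last first.
  rewrite /hilbert_transform /pv_integral -/k.
  by rewrite (cvg_lim _ ReC)// (cvg_lim _ ImC).
split; [|exact: (cvgP _ ReC)|exact: (cvgP _ ImC)].
move=> eps e0; split.
  rewrite (_ : (fun t => _) = EFin \o (fun t => complex.Re (k t)))// reE.
  apply/(L1_restrict _ (mfar eps)); under eq_fun do rewrite mulrDr.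
  by apply: L1D; exact: L.
rewrite (_ : (fun t => _) = EFin \o (fun t => complex.Im (k t)))// imE.
apply/(L1_restrict _ (mfar eps)); under eq_fun do rewrite mulrBr.
by apply: L1B; exact: L.
Unshelve. all: by end_near. Qed.

End Fewnomials.

Lemma ae_imply4 (R : realType) (P1 P2 P3 P4 W : R -> Prop) :
  {ae @lebesgue_measure R, forall x, P1 x} ->
  {ae @lebesgue_measure R, forall x, P2 x} ->
  {ae @lebesgue_measure R, forall x, P3 x} ->
  {ae @lebesgue_measure R, forall x, P4 x} ->
  (forall x, P1 x -> P2 x -> P3 x -> P4 x -> W x) ->
  {ae @lebesgue_measure R, forall x, W x}.
Proof.
move=> h1 h2 h3 h4 HW; have F := ae_filter_ringOfSetsType (@lebesgue_measure R).
apply: filterS (filterI (filterI h1 h2) (filterI h3 h4)) => x [[? ?] [? ?]].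
exact: HW.
Qed.

Theorem theorem1p1 (R : realType) (d : nat) (d_ge1 : (1 <= d)%N) :
  exists C : R,
    forall (a : 'I_d -> R) (alpha : 'I_d -> nat),
      (forall i, (0 < alpha i)%N) ->
      (forall f : R -> R[i], schwartz f ->
         forall x : R, pv_converges (hilbert_integrand (fewnomial a alpha) f x)) /\
      exists T : (R -> R[i]) -> (R -> R[i]),
        [/\ L2_linear_operator T,
            forall f : R -> R[i], schwartz f ->
              T f = hilbert_transform (fewnomial a alpha) f %[ae @lebesgue_measure R] &
            forall f : R -> R[i], in_L2 f ->
              (L2norm (T f) <= C%:E * L2norm f)%E].
Proof.
(* [C] is fixed before the coefficients and exponents are introduced, hence depends on [d] only. *)
have [C HC] := @multiplier_bound R d.
exists ((64 * C ^+ 2) `^ 2^-1) => a alpha alpha0; split.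
  move=> f /schwartz_nice[n1 n2] x.
  exact: (pv_hilbert_integrand a alpha0 x n1 n2).1.
have ext th := @hilbert_extension R (phase_cos a alpha th) _ C
  (@continuous_phase_cos R d a alpha th) (phase_cos_le1 a alpha th)
  (@phase_cos_odd_part R d a alpha alpha0 th).
have {}ext th : exists T : (R -> R) -> (R -> R),
  [/\ forall f, L2r f -> measurable_fun [set: R] (T f) /\
        (energy (T f) <= (16 * C ^+ 2)%:E * energy f)%E,
      forall f f', L2r f -> L2r f' -> {ae lebesgue_measure, forall x, f x = f' x} ->
        {ae lebesgue_measure, forall x, T f x = T f' x},
      forall k l f f', L2r f -> L2r f' ->
        {ae lebesgue_measure, forall x, T (fun x => k * f x + l * f' x) x =
          k * T f x + l * T f' x} &
      forall h, nice h ->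
        {ae lebesgue_measure, forall x, T h x = hilbertR (phase_cos a alpha th) h x}].
  apply: ext => eps N xi e0 eN; rewrite phase_cosE.
    by apply: (HC _ th eps N _ _ e0 eN).1; [rewrite size_coef_list|exact: coef_list_gt0].
  by apply: (HC _ th eps N _ _ e0 eN).2; [rewrite size_coef_list|exact: coef_list_gt0].
have [T0 [T0b T0ae T0lin T0H]] := ext 0.
have [T1 [T1b T1ae T1lin T1H]] := ext (pi / 2).
pose re (f : R -> R[i]) := fun x => complex.Re (f x).
pose im (f : R -> R[i]) := fun x => complex.Im (f x).
(* This is [T0 - i T1] acting on [re f + i im f], because
   [exp (i Q) = cos Q - i cos (pi / 2 + Q)]. *)
pose T (f : R -> R[i]) : R -> R[i] := fun x =>
  Complex (T0 (re f) x + T1 (im f) x) (T0 (im f) x - T1 (re f) x).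
have K0 : (0 <= (16 * C ^+ 2)%:E)%E by rewrite lee_fin mulr_ge0// sqr_ge0.
have TE f : in_L2 f -> cmeasurable (T f) /\
    (energyC (T f) <= (64 * C ^+ 2)%:E * energyC f)%E.
  move=> /in_L2P[fr fi].
  have [m0r E0r] := T0b _ fr; have [m0i E0i] := T0b _ fi.
  have [m1r E1r] := T1b _ fr; have [m1i E1i] := T1b _ fi.
  split; first by split; [exact: measurable_funD|exact: measurable_funB].
  set e := (16 * C ^+ 2)%:E in K0 E0r E0i E1r E1i.
  (* Each component costs a factor 2, and both [re f] and [im f] occur in each of them; this turns
     16 into 64. *)
  apply: (@le_trans _ _ ((2%:E * (e * energy (re f)) + 2%:E * (e * energy (im f))) +
      (2%:E * (e * energy (im f)) + 2%:E * (e * energy (re f))))%E).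
    apply: leeD.
      by apply: (le_trans (energyD m0r m1i)); apply: leeD; apply: lee_wpmul2l.
    by apply: (le_trans (energyB m0i m1r)); apply: leeD; apply: lee_wpmul2l.
  have [_ rfin] := fr; have [_ ifin] := fi.
  have rf : energy (re f) \is a fin_num by rewrite ge0_fin_numE ?energy_ge0.
  have jf : energy (im f) \is a fin_num by rewrite ge0_fin_numE ?energy_ge0.
  rewrite /energyC -/(re f) -/(im f); move: rf jf.
  move: (energy (re f)) (energy (im f)) => [x||] [y||]// _ _.
  by rewrite /e lee_fin; lra.
have TL2 f : in_L2 f -> in_L2 (T f).
  move=> fL; have [mT ET] := TE f fL; split => //; rewrite L2norm_energyC//.
  apply: poweR_lty; apply: (le_lt_trans ET).
  have [fr fi] := (in_L2P f).1 fL.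
  apply: lte_mul_pinfty => //; first by rewrite lee_fin mulr_ge0// sqr_ge0.
  by rewrite /energyC lte_add_pinfty//; [exact: fr.2|exact: fi.2].
exists T; split.
- split=> //.
  + move=> f g /in_L2P[fr fi] /in_L2P[gr gi] fg.
    have re_fg : {ae lebesgue_measure, forall x, re f x = re g x}.
      by case: fg => N [mN N0 sN]; exists N; split => // x nx; apply: sN => fx;
        apply: nx; rewrite /re /= fx.
    have im_fg : {ae lebesgue_measure, forall x, im f x = im g x}.
      by case: fg => N [mN N0 sN]; exists N; split => // x nx; apply: sN => fx;
        apply: nx; rewrite /im /= fx.
    have e1 := T0ae _ _ fr gr re_fg; have e2 := T1ae _ _ fi gi im_fg.
    have e3 := T0ae _ _ fi gi im_fg; have e4 := T1ae _ _ fr gr re_fg.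
    apply: (ae_imply4 e1 e2 e3 e4) => x E1 E2 E3 E4.
    by rewrite /T E1 E2 E3 E4.
  + move=> z f g /in_L2P[fr fi] /in_L2P[gr gi].
    (* A complex scalar mixes real and imaginary parts, so each component involves three real
       functions, while linearity of the real extensions is stated for two. *)
    have lin3 (S : (R -> R) -> R -> R) k l u v w :
        (forall k l f f', L2r f -> L2r f' ->
          {ae lebesgue_measure, forall x, S (fun x => k * f x + l * f' x) x =
            k * S f x + l * S f' x}) ->
        L2r u -> L2r v -> L2r w ->
        {ae lebesgue_measure, forall x, S (fun x => k * u x + l * v x + w x) x =
          k * S u x + l * S v x + S w x}.
      move=> Slin Lu Lv Lw; have Luv := L2r_lin k l Lu Lv.
      have h1 := Slin k l u v Lu Lv; have h2 := Slin 1 1 _ _ Luv Lw.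
      apply: (ae_imply4 h1 h2 h1 h2) => x E1 E2 _ _.
      rewrite E1 !mul1r in E2; rewrite -E2; congr (S _ x).
      by apply/funext => y; rewrite !mul1r.
    have reE : re (fun x => z * f x + g x) = (fun x =>
        complex.Re z * re f x + (- complex.Im z) * im f x + re g x).
      apply/funext => x; rewrite /re /im; case: (z) => p q.
      by case: (f x) => s t; case: (g x) => s' t' /=; ring.
    have imE : im (fun x => z * f x + g x) = (fun x =>
        complex.Re z * im f x + complex.Im z * re f x + im g x).
      apply/funext => x; rewrite /re /im; case: (z) => p q.
      by case: (f x) => s t; case: (g x) => s' t' /=; ring.
    have h1 := lin3 T0 (complex.Re z) (- complex.Im z) _ _ _ T0lin fr fi gr.
    have h2 := lin3 T1 (complex.Re z) (complex.Im z) _ _ _ T1lin fi fr gi.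
    have h3 := lin3 T0 (complex.Re z) (complex.Im z) _ _ _ T0lin fi fr gi.
    have h4 := lin3 T1 (complex.Re z) (- complex.Im z) _ _ _ T1lin fr fi gr.
    apply: (ae_imply4 h1 h2 h3 h4) => x E1 E2 E3 E4.
    rewrite /T reE imE E1 E2 E3 E4.
    case: {h1 h2 h3 h4 E1 E2 E3 E4 reE imE} z => p q /=.
    by move=> _; apply/eqP; rewrite eq_complex /=; apply/andP; split; apply/eqP; ring.
- move=> f /schwartz_nice[n1 n2].
  have h1 := T0H _ n1; have h2 := T1H _ n2.
  have h3 := T0H _ n2; have h4 := T1H _ n1.
  apply: (ae_imply4 h1 h2 h3 h4) => x E1 E2 E3 E4.
  by rewrite /T E1 E2 E3 E4 (pv_hilbert_integrand a alpha0 x n1 n2).2.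
- move=> f fL; have [mT ET] := TE f fL.
  rewrite !L2norm_energyC//; last by case: fL.
  have -> : ((64 * C ^+ 2) `^ 2^-1)%:E = ((64 * C ^+ 2)%:E `^ 2^-1)%E by [].
  rewrite -poweRM ?energyC_ge0//; last by rewrite lee_fin mulr_ge0// sqr_ge0.
  apply: gt0_ler_poweR => //; rewrite in_itv /= leey andbT ?energyC_ge0//.
  by rewrite mule_ge0 ?energyC_ge0// lee_fin mulr_ge0// sqr_ge0.
Qed.
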